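(* Let $(D_n)_{n\ge1}$ be connected regular domains of the family $\mathcal D$ such that $x_0\in D_1$, $D_n\Subset D_{n+1}$ for all $n$, and $D=\bigcup_{n\ge1}D_n$, and suppose that for every $n$ the relative kernel $K_{D_n}$ has a jointly continuous version on $D_n\times\partial D_n$ (this version is used). Let $D^K$ be a compact metrizable compactification of $D$, $\partial_{\mathrm m}^KD\subseteq D^K\setminus D$ a Borel set, and $\kappa:\partial_{\mathrm m}^KD\to\mathcal E(D)$ a Borel bijection; write $K_D(x,\eta)=\kappa(\eta)(x)$. Assume that there are $n_1<n_2<\cdots$ (one sequence for all $\eta$) such that $$K_D(\cdot,\eta)\,\omega_{x_0}^{D_{n_j}}\Longrightarrow\delta_\eta\ \text{ weakly on }D^K\quad\text{for every }\eta\in\partial_{\mathrm m}^KD.$$ Fix such a sequence and relabel $(D_{n_j})_j$ as $(D_n)_n$ (if the convergence holds along the full original sequence, the original sequence is kept). Let $D^G$ be any compact metrizable compactification of $D$, let $\widehat D=D^G\vee D^K$ be the common refinement with projection $p_K:\widehat D\to D^K$, and put $\widehat\partial_{\mathrm m}D=p_K^{-1}(\partial_{\mathrm m}^KD)$ and $\widehat K_D(x,\widehat\eta)=K_D(x,p_K(\widehat\eta))$. Let $u>0$ be harmonic on $D$ and regard $d\lambda_n^u(y)=u(y)\,d\omega_{x_0}^{D_n}(y)$ ($y\in\partial D_n$) as measures on $\widehat D$. Then $(\lambda_n^u)$ has weakly convergent subsequences on $\widehat D$, and every such limit $\widehat\mu_u$ satisfies $$\widehat\mu_u(\widehat D)=u(x_0),\qquad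 \widehat\mu_u(\widehat D\setminus\widehat\partial_{\mathrm m}D)=0,$$ $$u(x)=\int_{\widehat\partial_{\mathrm m}D}\widehat K_D(x,\widehat\eta)\,d\widehat\mu_u(\widehat\eta),\qquad x\in D.$$ Moreover, for $\widehat\mu_u$-almost every $\widehat\eta$ there are indices $n_j\uparrow\infty$, which may be chosen from the subsequence defining $\widehat\mu_u$, and points $y_j\in\partial D_{n_j}$ such that $$y_j\longrightarrow\widehat\eta\ \text{ in }\widehat D,\qquad K_{D_{n_j}}(\cdot,y_j)\longrightarrow\widehat K_D(\cdot,\widehat\eta)\ \text{ locally uniformly in }D.$$ If, in addition, $K_{D_n}(\cdot,y)$ is a minimal positive harmonic function on $D_n$ for all $n$ and all $y\in\partial D_n$, then every approximating kernel $K_{D_{n_j}}(\cdot,y_j)$ is minimal on its inner domain.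
   Context: Let $X$ be a metric space. A domain is a nonempty connected open set; $V\Subset U$ means that $\overline V$ is compact and contained in $U$. Measures are positive Borel measures (completed when integrable functions are considered). A harmonic measure on a domain $U$ with $\partial U\ne\varnothing$ is a family $\{\omega_x^U:x\in U\}$ of measures on $\partial U$ with $\omega_x^U(\partial U)=1$ and $\omega_x^U\ll\omega_y^U$ for all $x,y\in U$; write $\omega_x^U(f)=\int_{\partial U}f\,d\omega_x^U$. It is continuous if $x\mapsto\omega_x^U(f)$ is continuous on $U$ for every $f\in\bigcap_{x\in U}L^1(\partial U,\omega_x^U)$, and Radon if every $\omega_x^U$ is Radon. The domain $U$ is regular if for every $\zeta\in\partial U$ and every bounded Borel $f$ on $\partial U$ continuous at $\zeta$ one has $\omega_x^U(f)\to f(\zeta)$ as $U\ni x\to\zeta$. Standing framework: $\mathcal D$ is a family of domains of $X$, each with nonempty boundary and equipped with a continuous Radon harmonic measure, such that (i) every $U\in\mathcal D$ is the union of an increasing sequence of regular domains of $\mathcal D$ whose closures are compact and contained in $U$; (ii) for $V\Subset U$ in $\mathcal D$ with $V$ regular, $\omega_x^U(f)=\int_{\partial V}\omega_y^U(f)\,d\omega_x^V(y)$ for all $x\in V$ and all bounded Borel $f$ on $\partial U$. $D\subseteq X$ is a domain and $x_0\in D$ is fixed. A function $u:W\to\mathbb R$ on an open set $W$ is harmonic if it is continuous and $u(x)=\int_{\partial V}u\,d\omega_x^V$ for every regular $V\in\mathcal D$ with $V\Subset W$ and every $x\in V$. A (strictly) positive harmonic function $h$ on a domain is minimal if every harmonic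 $v$ with $0\le v\le h$ equals $ch$ for some $c\in[0,1]$. $\mathcal H_1(D)$ is the set of strictly positive harmonic functions $h$ on $D$ with $h(x_0)=1$, with the topology of locally uniform convergence, and $\mathcal E(D)$ is its set of extreme points (equivalently, the minimal functions in $\mathcal H_1(D)$), with the inherited Borel structure. For regular $U\in\mathcal D$ with $U\Subset D$, $x_0\in U$, the relative kernel is $K_U(x,y)=\frac{d\omega_x^U}{d\omega_{x_0}^U}(y)$, $x\in U$, $y\in\partial U$. A compactification of $D$ is a compact Hausdorff space containing $D$ (with its topology) as a dense subspace. For compact metrizable compactifications $D^G,D^K$ of $D$, the common refinement is $D^G\vee D^K=\overline{\{(x,x):x\in D\}}\subseteq D^G\times D^K$, with $D$ identified with its diagonal image, and $p_K$ is the restriction of the second coordinate projection. On a compact space $Y$, $\mu_n\Longrightarrow\mu$ means $\int f\,d\mu_n\to\int f\,d\mu$ for every $f\in C(Y)$. Measures on $\partial D_n$ are regarded as measures on compactifications through $\partial D_n\subset D$. *)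

(* Defs.v *)
From HB Require Import structures.
From mathcomp Require Import all_boot all_order all_algebra.
From mathcomp Require Import all_classical all_reals all_analysis.

Set Implicit Arguments.
Unset Strict Implicit.
Unset Printing Implicit Defensive.

Import Order.TTheory GRing.Theory Num.Theory.
Import numFieldNormedType.Exports.

Local Open Scope classical_set_scope.
Local Open Scope ring_scope.

(* [borel p] is the space T with its Borel sigma-algebra. The library requires
   measurable types to be pointed; p only serves as that point. *)
Definition pointed_at (T : topologicalType) (p : T) : Type := T.

HB.instance Definition _ (T : topologicalType) (p : T) :=
  Choice.on (pointed_at p).
HB.instance Definition _ (T : topologicalType) (p : T) :=
  isPointed.Build (pointed_at p) p.

Notation borel p := (g_sigma_algebraType (open : set (set (pointed_at p)))).

Section topology.
Context {T : topologicalType}.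
Implicit Types (U V W : set T).

Definition boundary U := closure U `\` U°.

Definition domain U := [/\ U !=set0, connected U & open U].

Definition compactly_contained V U := compact (closure V) /\ closure V `<=` U.

Definition locally_uniform_cvg {R : realType} W (f_ : nat -> T -> R)
    (f : T -> R) :=
  forall x, W x -> exists2 N, nbhs x N & {uniform N, f_ @ \oo --> f}.

End topology.

Section measures.
Context {R : realType} {T : topologicalType} {p : T}.
Local Open Scope ereal_scope.

Definition radon (mu : set (borel p) -> \bar R) :=
  (forall K : set T, compact K -> mu K < +oo) /\
  (forall A : set (borel p), measurable A ->
    mu A = ereal_sup [set mu K | K in [set K : set T | compact K /\ K `<=` A]]).

(* Membership in L^1 for the completion of mu. The library integral of such a
   nonnegative f is the supremum of the integrals of the Borel simple functions
   below f, hence agrees with the integral for the completed measure. *)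
Definition completed_integrable (mu : {measure set (borel p) -> \bar R})
    (E : set T) (f : T -> R) :=
  exists g : T -> R, mu.-integrable E (EFin \o g) /\ ae_eq mu E f g.

Definition weak_cvg (mu_ : nat -> set (borel p) -> \bar R)
    (mu : set (borel p) -> \bar R) :=
  forall f : T -> R, continuous f ->
    \int[mu_ n]_y (f y)%:E @[n --> \oo] --> \int[mu]_y (f y)%:E.

End measures.

(* A measure on the boundary of U is encoded as a Borel measure on X that gives
   the boundary full mass. A real function on W `<=` X is encoded as a function
   X -> R of which only the values on W matter. *)
Section harmonic_spaces.
Context {R : realType} {X : metricType R} {p : X}.
Implicit Types (U V W : set X) (omega : X -> probability (borel p) R).

Definition harmonic_measure U omega :=
  (forall x, U x -> omega x (boundary U) = 1%E) /\
  (forall x y, U x -> U y -> omega x `<< omega y).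

Definition continuous_harmonic_measure U omega :=
  forall f : X -> R,
    (forall x, U x -> completed_integrable (omega x) (boundary U) f) ->
    {within U, continuous (fun x => \int[omega x]_(y in boundary U) f y)}.

Definition radon_harmonic_measure U omega := forall x, U x -> radon (omega x).

Definition bounded_borel (E : set X) (f : X -> R) :=
  measurable_fun (E : set (borel p)) f /\
  exists M : R, forall y, E y -> `|f y| <= M.

Definition regular U omega :=
  forall zeta, boundary U zeta ->
  forall f : X -> R, bounded_borel (boundary U) f ->
    f y @[y --> within (boundary U) (nbhs zeta)] --> f zeta ->
    \int[omega x]_(y in boundary U) f y @[x --> within U (nbhs zeta)]
      --> f zeta.

Variables (DD : set (set X)) (omega : set X -> X -> probability (borel p) R).

Record harmonic_framework : Prop := HarmonicFramework {
  framework_domain : forall U, DD U -> domain U /\ boundary U !=set0 ;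
  framework_measure : forall U, DD U ->
    [/\ harmonic_measure U (omega U), continuous_harmonic_measure U (omega U)
      & radon_harmonic_measure U (omega U)] ;
  framework_exhaustion : forall U, DD U -> exists V : nat -> set X,
    [/\ forall n, [/\ DD (V n), regular (V n) (omega (V n))
                    & compactly_contained (V n) U],
        forall n, V n `<=` V n.+1
      & \bigcup_n V n = U] ;
  framework_consistent : forall U V, DD U -> DD V ->
    compactly_contained V U -> regular V (omega V) ->
    forall f : X -> R, bounded_borel (boundary U) f ->
    forall x, V x ->
      \int[omega U x]_(z in boundary U) f z =
      \int[omega V x]_(y in boundary V)
        (\int[omega U y]_(z in boundary U) f z)
}.

Definition harmonic_on W (u : X -> R) :=
  {within W, continuous u} /\
  forall V, DD V -> regular V (omega V) -> compactly_contained V W ->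
    forall x, V x -> u x = \int[omega V x]_(y in boundary V) u y.

Definition positive_harmonic W (u : X -> R) :=
  harmonic_on W u /\ forall x, W x -> 0 < u x.

Definition minimal_harmonic W (h : X -> R) :=
  positive_harmonic W h /\
  forall v, harmonic_on W v -> (forall x, W x -> 0 <= v x <= h x) ->
    exists2 c : R, 0 <= c <= 1 & forall x, W x -> v x = c * h x.

Definition normalized_harmonic (D : set X) (x0 : X) : set (D -> R) :=
  [set sigL D h | h in [set h | positive_harmonic D h /\ h x0 = 1]].

Definition extreme_harmonic (D : set X) (x0 : X) : set (D -> R) :=
  [set h | normalized_harmonic x0 h /\
    forall (h1 h2 : D -> R) (t : R),
      normalized_harmonic x0 h1 -> normalized_harmonic x0 h2 -> 0 < t < 1 ->
      h = (fun x => t * h1 x + (1 - t) * h2 x) -> h1 = h /\ h2 = h].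

Local Open Scope charge_scope.

(* k is a version of the density (x, y) |-> d omega_x^U / d omega_x0^U (y). *)
Definition relative_kernel U (x0 : X) (k : X -> X -> R) :=
  forall x, U x ->
    ae_eq (omega U x0) (boundary U) (fun y => (k x y)%:E)
      ('d (charge_of_finite_measure (omega U x)) '/d (omega U x0)).

Definition jointly_continuous U (k : X -> X -> R) :=
  {within U `*` boundary U, continuous (fun z : X * X => k z.1 z.2)}.

End harmonic_spaces.

Section compactifications.
Context {T : topologicalType} {D : set T}.

Record compactification {Y : topologicalType} (i : D -> Y) : Prop :=
  Compactification {
    compactification_compact : compact [set: Y] ;
    compactification_hausdorff : hausdorff_space Y ;
    compactification_inj : injective i ;
    compactification_continuous : continuous i ;
    compactification_embedding : forall A : set D, open A ->
      exists2 B : set Y, open B & i @^-1` B = A ;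
    compactification_dense : dense (range i)
  }.

Context {YG YK : topologicalType}.
Variables (iG : D -> YG) (iK : D -> YK).

Definition common_refinement : set (YG * YK) :=
  closure (range (fun x => (iG x, iK x))).

Definition refinement_incl (x : D) : common_refinement :=
  SigSub (mem_set (subset_closure (imageT (fun x => (iG x, iK x)) x))).

Definition refinement_proj (e : common_refinement) : YK := (set_val e).2.

End compactifications.

(* The measure [u d mu] on F `<=` D, regarded as a measure on Y through i. *)
Definition weighted_image {R : realType} {X : topologicalType} {p : X}
    {D : set X} {Y : topologicalType} {q : Y} (i : D -> Y)
    (mu : {measure set (borel p) -> \bar R}) (F : set X) (u : X -> R) :
    set (borel q) -> \bar R :=
  fun B => (\int[mu]_(y in F `&` set_val @` (i @^-1` B)) (u y)%:E)%E.

(* Main.v *)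
Require Import Defs.
From HB Require Import structures.
From mathcomp Require Import all_boot all_order all_algebra.
From mathcomp Require Import all_classical all_reals all_analysis.
From mathcomp Require Import measurable_realfun.
From mathcomp Require Import ring lra.

Set Implicit Arguments.
Unset Strict Implicit.
Unset Printing Implicit Defensive.

Import Order.TTheory GRing.Theory Num.Theory.
Import numFieldNormedType.Exports.

Local Open Scope classical_set_scope.
Local Open Scope ring_scope.

(** Let [E n] be the given domains along some subsequence, [W_n] the harmonic
    measure of [E n] at the base point [x0], and [k_n] the kernel of [E n]. Since
    harmonic measures of regular domains have full support, the kernels are
    nonnegative harmonic functions with value 1 at [x0]. Every positive harmonic
    [v] on [D] satisfies [v x = \int k_n x y v y dW_n(y)] on [E n]. Harnack
    estimates ([admissible_modulus], [admissible_bound]) follow, so normalized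
    positive harmonic functions and kernels form a normal family.

    The measures [u dW_n] are followed jointly with the positions [j y] of the
    boundary points in the common refinement and with the kernels [k_n _ y].
    Every boundary point is coded by the answers to countably many yes-no
    questions about its position and its kernel. Along a diagonal subsequence
    the masses of all prefixes of codes converge, and the limits are realized by
    nested intervals ([coding_limit]). This gives a measure [P] of mass [u x0] on
    a space of limit codes [t], a limit position [e t], and a limit [h t] of
    kernels, which is positive harmonic with [h t x0 = 1] and satisfies
    [u x = \int h t x dP(t)] ([barycenter]).

    Almost every [h t] is extreme ([ae_extreme]). Indeed, [h t dW_n] is a
    probability under which [k_n x] has mean [h t x]. Integrated over [t], its
    second moment is [\int (k_n x y)^2 u y dW_n(y)], which converges to
    [\int (h t x)^2 dP(t)]; hence the variances vanish in the mean. A proper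
    convex combination of two different functions, however, has variances
    bounded away from zero at some point [x] ([extreme_of_no_variance]).

    So [h t] is represented by a point [eta t] of the minimal boundary, and
    [h t dW_n] concentrates at [eta t] by assumption. Draw [t] from [P] and then
    [y] from [h t dW_n]: then [y] has law [u dW_n], and [k_n x y] is close to
    [h t x] because the variance is small. For a continuous function [a] on the
    second compactification, the limit of [\int k_n x y a(y) u y dW_n(y)] can
    therefore be computed in two ways, and the projection of [e t] and [eta t]
    have the same law under the measure [h t x dP(t)]
    ([position_parameter_test]). Comparing second moments once more, [e t]
    itself represents [h t] for almost every [t] ([parameter_position]).

    The law of [e] is thus a weak limit with the required properties
    ([limit_measure]), and every weak limit of the given measures is of this
    form, by uniqueness of limits along a further subsequence. The approximating
    boundary points of almost every point come from the codes: a prefix of a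
    limit code is realized on arbitrarily late boundaries
    ([approximable_set]). *)

(** * Integrals of bounded measurable functions against finite measures *)

Section bounded_measurable.
Context d (T : measurableType d) (R : realType).
Implicit Types (A B : set T) (f g : T -> R).

(** This class is stable under the algebraic operations and integrable for every
    finite measure, so that it can take the place of integrability. *)
Definition bounded_measurable A f :=
  measurable_fun A f /\ exists M : R, forall x, A x -> `|f x| <= M.

Lemma bounded_measurable_cst A (r : R) : bounded_measurable A (fun=> r).
Proof. by split; [exact: measurable_cst|exists `|r|]. Qed.

Lemma bounded_measurableD A f g : bounded_measurable A f ->
  bounded_measurable A g -> bounded_measurable A (fun x => f x + g x).
Proof.
move=> [mf [M fM]] [mg [N gN]]; split; first exact: measurable_funD.
by exists (M + N) => x Ax; rewrite (le_trans (ler_normD _ _))// lerD ?fM ?gN.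
Qed.

Lemma bounded_measurableM A f g : bounded_measurable A f ->
  bounded_measurable A g -> bounded_measurable A (fun x => f x * g x).
Proof.
move=> [mf [M fM]] [mg [N gN]]; split; first exact: measurable_funM.
by exists (M * N) => x Ax; rewrite normrM ler_pM ?fM ?gN.
Qed.

Lemma bounded_measurableZ A (r : R) f : bounded_measurable A f ->
  bounded_measurable A (fun x => r * f x).
Proof. by apply: bounded_measurableM; exact: bounded_measurable_cst. Qed.

Lemma bounded_measurableB A f g : bounded_measurable A f ->
  bounded_measurable A g -> bounded_measurable A (fun x => f x - g x).
Proof.
move=> [mf [M fM]] [mg [N gN]]; split; first exact: measurable_funB.
by exists (M + N) => x Ax; rewrite (le_trans (ler_normB _ _))// lerD ?fM ?gN.
Qed.

Lemma bounded_measurable_norm A f : bounded_measurable A f ->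
  bounded_measurable A (fun x => `|f x|).
Proof.
move=> [mf [M fM]]; split; first exact: measurableT_comp.
by exists M => x Ax; rewrite normr_id fM.
Qed.

Lemma bounded_measurable_sqr A f : bounded_measurable A f ->
  bounded_measurable A (fun x => f x ^+ 2).
Proof. by move=> bf; apply: bounded_measurableM. Qed.

Lemma bounded_measurableS A B f : measurable B -> A `<=` B ->
  bounded_measurable B f -> bounded_measurable A f.
Proof.
move=> mB AB [mf [M fM]]; split; first exact: measurable_funS mf.
by exists M => x /AB /fM.
Qed.

Lemma eq_bounded_measurable A f g : (forall x, A x -> f x = g x) ->
  bounded_measurable A f -> bounded_measurable A g.
Proof.
move=> fg [mf [M fM]]; split.
  by apply: eq_measurable_fun mf => x; rewrite inE => /fg.
by exists M => x Ax; rewrite -fg ?fM.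
Qed.

Lemma bounded_measurable_patch A f : measurable A ->
  bounded_measurable A f -> bounded_measurable setT (f \_ A).
Proof.
move=> mA [mf [M fM]]; split; first exact/(measurable_restrictT f mA).1.
exists (Num.max M 0) => x _; rewrite patchE; case: ifPn => [|_].
  by rewrite inE => /fM fxM; rewrite le_max fxM.
by rewrite normr0 le_max lexx orbT.
Qed.

Lemma bounded_measurable_indic A B : measurable B ->
  bounded_measurable A (\1_B : T -> R).
Proof.
move=> mB; split; first exact: measurable_indic.
by exists 1 => x _; rewrite indicE; case: (_ \in _); rewrite ?normr1 ?normr0.
Qed.

End bounded_measurable.

Section finite_measure_integral.
Context d (T : measurableType d) (R : realType).
Variable mu : {finite_measure set T -> \bar R}.
Implicit Types (A B : set T) (f g : T -> R).

Lemma bounded_measurable_integrable A f : measurable A ->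
  bounded_measurable A f -> mu.-integrable A (EFin \o f).
Proof.
move=> mA [mf [M fM]]; apply: measurable_bounded_integrable => //.
  by rewrite -ge0_fin_numE//; exact: fin_num_measure.
exists M; split; first exact: num_real.
by move=> N MN x /= Ax; rewrite (le_trans (fM _ Ax))// ltW.
Qed.

Lemma Rintegral_EFin A f : measurable A -> bounded_measurable A f ->
  (\int[mu]_(x in A) f x)%:E = (\int[mu]_(x in A) (f x)%:E)%E.
Proof.
move=> mA bf; rewrite /Rintegral fineK//.
by apply: integrable_fin_num => //; exact: bounded_measurable_integrable.
Qed.

Lemma bmRintegralD A f g : measurable A -> bounded_measurable A f ->
  bounded_measurable A g -> \int[mu]_(x in A) (f x + g x) =
  \int[mu]_(x in A) f x + \int[mu]_(x in A) g x.
Proof.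
by move=> mA bf bg; apply: RintegralD => //;
  apply: bounded_measurable_integrable.
Qed.

Lemma bmRintegralB A f g : measurable A -> bounded_measurable A f ->
  bounded_measurable A g -> \int[mu]_(x in A) (f x - g x) =
  \int[mu]_(x in A) f x - \int[mu]_(x in A) g x.
Proof.
by move=> mA bf bg; apply: RintegralB => //;
  apply: bounded_measurable_integrable.
Qed.

Lemma bmRintegralZl A f (r : R) : measurable A -> bounded_measurable A f ->
  \int[mu]_(x in A) (r * f x) = r * \int[mu]_(x in A) f x.
Proof.
by move=> mA bf; apply: RintegralZl => //; apply: bounded_measurable_integrable.
Qed.

Lemma le_bmRintegral A f g : measurable A -> bounded_measurable A f ->
  bounded_measurable A g -> (forall x, A x -> f x <= g x) ->
  \int[mu]_(x in A) f x <= \int[mu]_(x in A) g x.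
Proof.
by move=> mA bf bg fg; apply: le_Rintegral => //;
  apply: bounded_measurable_integrable.
Qed.

Lemma le_norm_bmRintegral A f g : measurable A -> bounded_measurable A f ->
  bounded_measurable A g -> (forall x, A x -> `|f x| <= g x) ->
  `|\int[mu]_(x in A) f x| <= \int[mu]_(x in A) g x.
Proof.
move=> mA bf bg fg; apply: (@le_trans _ _ (\int[mu]_(x in A) `|f x|)).
  by apply: le_normr_Rintegral => //; exact: bounded_measurable_integrable.
by apply: le_bmRintegral => //; exact: bounded_measurable_norm.
Qed.

Lemma le_norm_bmRintegral_cst A f (e : R) : measurable A ->
  measurable_fun A f -> (forall x, A x -> `|f x| <= e) ->
  `|\int[mu]_(x in A) f x| <= e * fine (mu A).
Proof.
move=> mA mf fe; rewrite -Rintegral_cst//.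
by apply: le_norm_bmRintegral => //; [split => //; exists e|
  exact: bounded_measurable_cst].
Qed.

Lemma bmRintegral_sum A (I : Type) (r : seq I) (P : pred I) (f : I -> T -> R) :
  measurable A -> (forall i, P i -> bounded_measurable A (f i)) ->
  bounded_measurable A (fun x => \sum_(i <- r | P i) f i x) /\
  \int[mu]_(x in A) (\sum_(i <- r | P i) f i x) =
  \sum_(i <- r | P i) \int[mu]_(x in A) f i x.
Proof.
move=> mA bf; elim: r => [|i r [bIH IH]].
  under eq_fun do rewrite big_nil.
  split; first exact: bounded_measurable_cst.
  by rewrite big_nil Rintegral_cst// mul0r.
case: (boolP (P i)) => Pi; last first.
  by under eq_fun do rewrite big_cons (negPf Pi); rewrite big_cons (negPf Pi).
under eq_fun do rewrite big_cons Pi.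
rewrite big_cons Pi -IH -bmRintegralD//; last exact: bf.
by split => //; apply: bounded_measurableD => //; exact: bf.
Qed.

Lemma bounded_cvg_Rintegral A (f_ : nat -> T -> R) f (M : R) : measurable A ->
  (forall n, measurable_fun A (f_ n)) ->
  (forall n x, A x -> `|f_ n x| <= M) ->
  (forall x, A x -> f_ n x @[n --> \oo] --> f x) ->
  bounded_measurable A f /\
  \int[mu]_(x in A) f_ n x @[n --> \oo] --> \int[mu]_(x in A) f x.
Proof.
move=> mA mf_ f_M f_f.
have mf : measurable_fun A f by exact: (measurable_fun_cvg mf_).
have bf : bounded_measurable A f.
  split => //; exists M => x Ax.
  have : `|f_ n x| @[n --> \oo] --> `|f x| by apply: cvg_norm; exact: f_f.
  move=> /cvg_lim <- //; apply: limr_le.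
    by apply: is_cvg_norm; apply/cvg_ex; eexists; exact: f_f.
  by apply: nearW => n; exact: f_M.
split => //; apply: fine_cvg; rewrite fineK; last first.
  by apply: integrable_fin_num => //; exact: bounded_measurable_integrable.
apply: (@dominated_cvg _ _ _ mu A mA _ _ (cst M%:E)) => //.
- by move=> n; apply/measurable_EFinP.
- by move=> x Ax; apply/cvg_EFin; [exact: nearW|exact: f_f].
- exact: (bounded_measurable_integrable mA (bounded_measurable_cst _ _)).
Qed.

Lemma bmRintegral_setC0 A B f : measurable A -> measurable B -> mu B = 0%E ->
  bounded_measurable A f ->
  \int[mu]_(x in A `\` B) f x = \int[mu]_(x in A) f x.
Proof.
move=> mA mB B0 bf; rewrite /Rintegral.
by rewrite -(@negligible_integral _ _ _ mu A B)//;
  exact: bounded_measurable_integrable.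
Qed.

End finite_measure_integral.

Section fubini_bounded.
Context d1 d2 (T1 : measurableType d1) (T2 : measurableType d2) (R : realType).
Variables (mu1 : {finite_measure set T1 -> \bar R})
  (mu2 : {finite_measure set T2 -> \bar R}).

(** Extending [F] by zero outside [A `*` B] reduces the claim to Fubini's theorem
    on the whole product. *)
Lemma bounded_Fubini (A : set T1) (B : set T2) (F : T1 -> T2 -> R) :
  measurable A -> measurable B ->
  bounded_measurable (A `*` B) (fun z => F z.1 z.2) ->
  bounded_measurable A (fun x => \int[mu2]_(y in B) F x y) /\
  \int[mu1]_(x in A) \int[mu2]_(y in B) F x y =
  \int[mu2]_(y in B) \int[mu1]_(x in A) F x y.
Proof.
move=> mA mB bF; have mAB : measurable (A `*` B) by exact: measurableX.
pose G := (fun z => F z.1 z.2) \_ (A `*` B).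
have [mG [M GM]] : bounded_measurable setT G.
  exact: bounded_measurable_patch.
have iG : (mu1 \x mu2)%E.-integrable setT (EFin \o G).
  apply: measurable_bounded_integrable => //.
    have := @product_measure1E _ _ _ _ _ mu1 mu2 _ _ measurableT measurableT.
    rewrite setXTT => muT; apply: (@le_lt_trans _ _ (mu1 setT * mu2 setT)%E).
      by rewrite -muT.
    rewrite lte_mul_pinfty// ?fin_num_measure//.
    by rewrite -ge0_fin_numE// fin_num_measure.
  exists M; split; first exact: num_real.
  by move=> N MN z _ /=; rewrite (le_trans (GM _ I))// ltW.
have GE x y : A x -> B y -> G (x, y) = F x y.
  by move=> Ax By; rewrite /G patchE mem_set.
have GoutA x y : ~ A x -> G (x, y) = 0.
  by move=> Ax; rewrite /G patchE memNset// => -[].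
have GoutB x y : ~ B y -> G (x, y) = 0.
  by move=> By; rewrite /G patchE memNset// => -[].
have mG1 x : bounded_measurable setT (fun y => G (x, y)).
  split; last by exists M => y _; exact: GM.
  by apply: (measurableT_comp mG); exact: measurable_pair1.
have mG2 y : bounded_measurable setT (fun x => G (x, y)).
  split; last by exists M => x _; exact: GM.
  by apply: (measurableT_comp mG); exact: measurable_pair2.
have E1 x : A x ->
    (\int[mu2]_(y in B) F x y)%:E = (\int[mu2]_y (G (x, y))%:E)%E.
  move=> Ax; rewrite -Rintegral_EFin//; congr EFin.
  rewrite Rintegral_mkcond; apply: eq_Rintegral => y _; rewrite patchE.
  by case: ifPn => [|/negP]; rewrite inE => By;
    [rewrite GE|exact/esym/GoutB].
have E2 y : B y ->
    (\int[mu1]_(x in A) F x y)%:E = (\int[mu1]_x (G (x, y))%:E)%E.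
  move=> By; rewrite -Rintegral_EFin//; congr EFin.
  rewrite Rintegral_mkcond; apply: eq_Rintegral => x _; rewrite patchE.
  by case: ifPn => [|/negP]; rewrite inE => Ax;
    [rewrite GE|exact/esym/GoutA].
split.
  split.
    apply/measurable_EFinP.
    apply: (@eq_measurable_fun _ _ _ _ _ (fun x => \int[mu2]_y (G (x, y))%:E)%E).
      by move=> x; rewrite inE => Ax /=; rewrite E1.
    exact: measurable_funTS (measurable_fubini_F iG).
  exists (M * fine (mu2 setT)) => x Ax.
  have -> : \int[mu2]_(y in B) F x y = \int[mu2]_y G (x, y).
    by apply: EFin_inj; rewrite E1// Rintegral_EFin.
  apply: le_norm_bmRintegral_cst => //; first exact: (mG1 x).1.
  by move=> y _; exact: GM.
rewrite /Rintegral; congr fine.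
transitivity (\int[mu1]_x \int[mu2]_y (G (x, y))%:E)%E.
  rewrite integral_mkcond; apply: eq_integral => x _; rewrite patchE.
  case: ifPn => [|/negP]; rewrite inE => Ax; first exact: E1.
  by rewrite integral0_eq// => y _; rewrite GoutA.
rewrite (Fubini iG) [RHS]integral_mkcond.
apply: eq_integral => y _; rewrite patchE.
case: ifPn => [|/negP]; rewrite inE => By; first by rewrite [RHS]E2.
by rewrite integral0_eq// => x _ /=; rewrite GoutB.
Qed.

End fubini_bounded.

Section density.
Context d (T : measurableType d) (R : realType).
Variables (mu : {finite_measure set T -> \bar R}) (g : T -> R).
Hypotheses (bg : bounded_measurable setT g) (g0 : forall x, 0 <= g x).

Definition density of bounded_measurable setT g & (forall x, 0 <= g x) :
  set T -> \bar R := fun B => (\int[mu]_(x in B) (g x)%:E)%E.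

Local Notation nu := (density bg g0).

Let nu0 : nu set0 = 0%E. Proof. exact: integral_set0. Qed.

Let nu_ge0 A : (0 <= nu A)%E.
Proof. by apply: integral_ge0 => x _; rewrite lee_fin. Qed.

Let nu_sigma_additive : semi_sigma_additive nu.
Proof.
apply: semi_sigma_additive_nng_induced => [|x]; last by rewrite lee_fin.
by apply/measurable_EFinP; case: bg.
Qed.

HB.instance Definition _ :=
  isMeasure.Build _ _ _ nu nu0 nu_ge0 nu_sigma_additive.

Let nu_fin : fin_num_fun nu.
Proof.
move=> A mA; apply: integrable_fin_num => //.
apply: bounded_measurable_integrable => //.
exact: bounded_measurableS bg.
Qed.

HB.instance Definition _ := Measure_isFinite.Build _ _ _ nu nu_fin.

(** [g] and the Radon-Nikodym derivative of the measure that it defines have the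
    same integral over every measurable set, hence agree almost everywhere. *)
Lemma Rintegral_density A (f : T -> R) : measurable A -> bounded_measurable A f ->
  \int[nu]_(x in A) f x = \int[mu]_(x in A) (f x * g x).
Proof.
move=> mA bf; rewrite /Rintegral; congr fine.
have numu : nu `<< mu.
  apply/null_content_dominatesP => B mB muB0.
  by apply: null_set_integral => //; apply/measurable_EFinP;
    case: (bounded_measurableS measurableT (@subsetT _ B) bg).
have bgA : bounded_measurable A g by exact: bounded_measurableS bg.
rewrite -(Radon_Nikodym_change_of_variables numu)//; last first.
  exact: bounded_measurable_integrable.
have RNg : ae_eq mu A
    (Radon_Nikodym (charge_of_finite_measure nu) mu) (EFin \o g).
  apply: integral_ae_eq => //.
  - apply: (integrableS measurableT) => //.
    exact: Radon_Nikodym_integrable.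
  - by apply/measurable_EFinP; case: bgA.
  - by move=> E EA mE; rewrite -Radon_Nikodym_integral.
under [RHS]eq_integral do rewrite EFinM.
apply: ae_eq_integral => //.
- apply: emeasurable_funM; first by apply/measurable_EFinP; case: bf.
  by apply: measurable_funTS.
- by apply: emeasurable_funM; apply/measurable_EFinP; [case: bf|case: bgA].
- exact: ae_eqe_mul2l.
Qed.

End density.

Section finite_pushforward.
Context d1 d2 (T1 : measurableType d1) (T2 : measurableType d2) (R : realType).
Variables (mu : {finite_measure set T1 -> \bar R}) (f : T1 -> T2).
Hypothesis mf : measurable_fun setT f.

Definition image_measure of measurable_fun setT f : set T2 -> \bar R :=
  pushforward mu f.

Local Notation nu := (image_measure mf).

Let nu0 : nu set0 = 0%E.
Proof. by rewrite /image_measure /pushforward preimage_set0 measure0. Qed.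

Let nu_ge0 A : (0 <= nu A)%E. Proof. exact: measure_ge0. Qed.

Let nu_sigma_additive : semi_sigma_additive nu.
Proof.
move=> F mF tF mUF; rewrite /image_measure /pushforward preimage_bigcup.
apply: measure_semi_sigma_additive.
- by move=> n; rewrite -[X in measurable X]setTI; exact: mf.
- apply/trivIsetP => /= i j _ _ ij; rewrite -preimage_setI.
  by move/trivIsetP : tF => /(_ _ _ _ _ ij) ->//; rewrite preimage_set0.
- by rewrite -preimage_bigcup -[X in measurable X]setTI; exact: mf.
Qed.

HB.instance Definition _ :=
  isMeasure.Build _ _ _ nu nu0 nu_ge0 nu_sigma_additive.

Let nu_fin : fin_num_fun nu.
Proof.
move=> A mA; apply: fin_num_measure.
by rewrite -[X in measurable X]setTI; exact: mf.
Qed.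

HB.instance Definition _ := Measure_isFinite.Build _ _ _ nu nu_fin.

Lemma Rintegral_image_measure (g : T2 -> R) : bounded_measurable setT g ->
  \int[nu]_y g y = \int[mu]_x g (f x).
Proof.
move=> [mg [M gM]]; rewrite /Rintegral; congr fine.
rewrite (@integral_pushforward _ _ _ _ _ f mf mu setT (EFin \o g))//.
  exact/measurable_EFinP.
rewrite preimage_setT; apply: (@bounded_measurable_integrable _ _ _ _ _ (g \o f)) => //.
split; first exact: measurableT_comp.
by exists M => x _; exact: gM.
Qed.

End finite_pushforward.

(** * Borel measures on topological spaces *)

Section borel_measurability.
Context {T : topologicalType} {p : T}.
Implicit Types (A : set T).

Lemma open_borel A : open A -> measurable (A : set (borel p)).
Proof. exact: sub_sigma_algebra. Qed.

Lemma closed_borel A : closed A -> measurable (A : set (borel p)).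
Proof.
move=> cA; have oA : open (~` A) by exact: closed_openC.
by rewrite -[A]setCK; apply: measurableC; exact: open_borel.
Qed.

Lemma within_continuous_preimage {S : topologicalType} A (f : T -> S)
    (O : set S) : {within A, continuous f} -> open O ->
  exists2 W, open W & A `&` f @^-1` O = A `&` W.
Proof.
move=> /continuousP cf oO; have /open_subspaceP[W oW WA] := cf _ oO.
by exists W => //; rewrite [RHS]setIC WA setIC.
Qed.

Lemma within_continuous_borel {S : topologicalType} {q : S} A (f : T -> S) :
  measurable (A : set (borel p)) -> {within A, continuous f} ->
  measurable_fun (A : set (borel p)) (f : borel p -> borel q).
Proof.
move=> mA cf; apply: (@measurability _ _ (borel p) (borel q) A f open) => //.
move=> _ [V oV <-].
have [W oW ->] := within_continuous_preimage cf oV.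
by apply: measurableI => //; exact: open_borel.
Qed.

Lemma within_continuous_measurable {R : realType} A (f : T -> R) :
  measurable (A : set (borel p)) -> {within A, continuous f} ->
  measurable_fun (A : set (borel p)) f.
Proof.
move=> mA cf; apply: (measurability _ (RGenOpens.measurableE R)).
move=> _ [_ [a [b ->] <-]].
have oab : open (`]a, b[%classic : set R) by exact: interval_open.
have [W oW ->] := within_continuous_preimage cf oab.
by apply: measurableI => //; exact: open_borel.
Qed.

Lemma compact_within_bounded {R : realType} A (f : T -> R) :
  compact A -> {within A, continuous f} ->
  exists M, forall x, A x -> `|f x| <= M.
Proof.
move=> cA cf; have := continuous_compact cf cA.
move=> /compact_bounded[M [_ fM]]; exists (M + 1) => x Ax.
by apply: fM; [rewrite ltrDl|exists x].
Qed.

Lemma compact_bounded_measurable {R : realType} A (f : T -> R) :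
  compact A -> measurable (A : set (borel p)) -> {within A, continuous f} ->
  bounded_measurable (A : set (borel p)) f.
Proof.
move=> cA mA cf; split; first exact: within_continuous_measurable.
exact: compact_within_bounded.
Qed.

End borel_measurability.

Section borel_measure_unique.
Context {R : realType} {T : pseudoMetricType R} {p : T}.

(** The indicator of a closed set is a limit of continuous functions: Urysohn
    functions separating it from the complements of its shrinking
    neighbourhoods. *)
Lemma closed_indic_limit (F : set T) : closed F ->
  exists f_ : nat -> T -> R, [/\ forall n, continuous (f_ n),
    forall n x, 0 <= f_ n x <= 1 &
    forall x, f_ n x @[n --> \oo] --> (\1_F x : R)].
Proof.
move=> cF.
pose G n := ~` [set x | exists2 a, F a & ball a n.+1%:R^-1 x].
have FG n : uniform_separator F (G n).
  apply: uniform_separatorW.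
  have n0 : 0 < n.+1%:R^-1 :> R by rewrite invr_gt0.
  exists [set xy | ball xy.1 n.+1%:R^-1 xy.2].
    by rewrite -entourage_ballE; exists n.+1%:R^-1.
  rewrite -subset0 => -[x y] [[/= Fx Gy] xy].
  by apply: Gy; exists x.
pose f_ n x : R := 1 - Urysohn F (G n) x.
exists f_; split.
- move=> n x; apply: cvgB; first exact: cvg_cst.
  exact: Urysohn_continuous.
- move=> n x; have : range (Urysohn F (G n) : T -> R) (Urysohn F (G n) x).
    by exists x.
  by move=> /Urysohn_range; rewrite /f_ /= in_itv/= subr_ge0 gerBl andbC.
move=> x; rewrite indicE.
case: (boolP (x \in F)) => [|/negP]; rewrite inE => Fx.
  apply: cvg_near_cst; apply: nearW => n; rewrite /f_.
  have : (Urysohn F (G n) @` F : set R) (Urysohn F (G n) x) by exists x.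
  by move=> /(Urysohn_sub0 (FG n)) /= ->; rewrite subr0.
apply: cvg_near_cst.
have : nbhs x (~` F) by apply: open_nbhs_nbhs; split => //; exact: closed_openC.
move=> /nbhs_ballP[e /= e0 eF].
near=> n; rewrite /f_.
have Gx : G n x.
  move=> [a Fa ax]; apply: (eF a) => //.
  apply: (@le_ball _ _ _ n.+1%:R^-1); last exact: ball_sym.
  by near: n; have := near_infty_natSinv_lt (PosNum e0); apply: filterS => n /ltW.
have : (Urysohn F (G n) @` (G n) : set R) (Urysohn F (G n) x) by exists x.
by move=> /(Urysohn_sub1 (FG n)) /= ->; rewrite subrr.
Unshelve. all: by end_near. Qed.

(** Closed sets form a pi-system that generates the Borel sets, and the measure of
    a closed set is a limit of integrals of continuous functions. *)
Lemma borel_measure_unique (m1 m2 : {finite_measure set (borel p) -> \bar R}) :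
  (forall f : T -> R, continuous f -> (forall x, 0 <= f x <= 1) ->
    \int[m1]_x f x = \int[m2]_x f x) ->
  forall A : set (borel p), measurable A -> m1 A = m2 A.
Proof.
move=> m12.
pose cl := [set F : set (borel p) | closed (F : set T)].
have clE : (measurable : set (set (borel p))) = <<s cl >>.
  apply/seteqP; split; apply: smallest_sub.
  - exact: smallest_sigma_algebra.
  - move=> A oA; rewrite -[A]setCK; apply: sigma_algebraC.
    by apply: sub_sigma_algebra; exact: open_closedC.
  - exact: sigma_algebra_measurable.
  - by move=> A cA; exact: closed_borel.
have mcst (m : {finite_measure set (borel p) -> \bar R}) (F : set T) :
    closed F -> \int[m]_x (\1_F x : R) = fine (m F).
  move=> cF; rewrite /Rintegral integral_indic ?setIT//.
  exact: closed_borel.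
have mF F : closed F -> m1 F = m2 F.
  move=> cF; have mF : measurable (F : set (borel p)) by exact: closed_borel.
  have [f_ [cf_ f01 fF]] := closed_indic_limit cF.
  rewrite -[LHS]fineK ?fin_num_measure// -[RHS]fineK ?fin_num_measure//.
  congr EFin; rewrite -!mcst//.
  have mf_ n : measurable_fun (setT : set (borel p)) (f_ n).
    by apply: within_continuous_measurable => //; exact: continuous_subspaceT.
  have f1 n x : [set: borel p] x -> `|f_ n x| <= 1.
    by move=> _; have /andP[f0 f1] := f01 n x; rewrite ger0_norm.
  have [_ h1] := bounded_cvg_Rintegral m1 measurableT mf_ f1 (fun x _ => fF x).
  have [_ h2] := bounded_cvg_Rintegral m2 measurableT mf_ f1 (fun x _ => fF x).
  move: h1; rewrite (_ : (fun n => _) = (fun n => \int[m2]_x f_ n x)).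
    by move=> h1; exact: (cvg_unique _ h1 h2).
  by apply/funext => n; exact: m12.
apply: (measure_unique cl (fun _ : nat => setT)) => //.
- by move=> A B cA cB; exact: closedI.
- by rewrite bigcup_const//; exists 0%N.
- by move=> k; rewrite -ge0_fin_numE// fin_num_measure.
Qed.

End borel_measure_unique.

(** * Limits of finite measures through binary codes *)

Lemma extract_subsequence (P : nat -> nat -> Prop) :
  (forall j N, exists n, (N < n)%N /\ P j n) ->
  exists psi : nat -> nat,
    (forall j, (psi j < psi j.+1)%N) /\ forall j, P j (psi j).
Proof.
move=> exP; have [f fP] : exists f : nat -> nat -> nat,
    forall j N, (N < f j N)%N /\ P j (f j N).
  have [f fP] := choice (fun jN : nat * nat => exP jN.1 jN.2).
  by exists (fun j N => f (j, N)) => j N; exact: (fP (j, N)).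
pose psi := fix psi j := if j is j'.+1 then f j (psi j') else f 0%N 0%N.
exists psi; split => [j|[|j]] /=; first exact: (fP _ _).1.
  exact: (fP _ _).2.
exact: (fP _ _).2.
Qed.

Lemma increasing_ge_id (psi : nat -> nat) :
  (forall j, (psi j < psi j.+1)%N) -> forall j, (j <= psi j)%N.
Proof.
by move=> inc; elim=> // j IH; exact: leq_ltn_trans IH (inc j).
Qed.

(** Sequential compactness of a countable product of compact intervals. *)
Lemma diagonal_subsequence (R : realType) (I : countType) (c : R)
    (p : nat -> I -> R) : (forall n i, 0 <= p n i <= c) ->
  exists psi : nat -> nat, (forall j, (psi j < psi j.+1)%N) /\
  exists q : I -> R, forall i, p (psi j) i @[j --> \oo] --> q i.
Proof.
move=> pc; pose K := fun _ : I => (R : topologicalType).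
have cK : compact [set f : prod_topology K | forall i, `[0, c]%classic (f i)].
  by apply: (tychonoff (A := fun=> `[0, c]%classic)) => i; exact: segment_compact.
pose p' : nat -> prod_topology K := p.
have pK : (p' @ \oo)
    [set f : prod_topology K | forall i, `[0, c]%classic (f i)].
  by exists 0%N => // n _ i; rewrite /= in_itv/= pc.
have [q [_ pq]] := cK _ _ pK.
suff [psi [psi_inc psiP]] : exists psi : nat -> nat,
    (forall j, (psi j < psi j.+1)%N) /\ forall j, forall i : I,
      (pickle i <= j)%N -> `|q i - p (psi j) i| < j.+1%:R^-1.
  exists psi; split => //; exists q => i.
  apply/cvgrPdist_lt => e e0; near=> j.
  have ij : (pickle i <= j)%N by near: j; exact: nbhs_infty_ge.
  apply: (lt_trans (psiP _ _ ij)).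
  by near: j; exact: (near_infty_natSinv_lt (PosNum e0)).
apply: (@extract_subsequence (fun j n => forall i : I,
  (pickle i <= j)%N -> `|q i - p n i| < j.+1%:R^-1)) => j N.
pose Q := [set f : prod_topology K | forall i : I, (pickle i <= j)%N ->
  `|q i - f i| < j.+1%:R^-1].
have Qq : nbhs (q : prod_topology K) Q.
  have Qi (m : nat) : nbhs (q : prod_topology K) [set f : prod_topology K |
      forall i : I, pickle i = m -> `|q i - f i| < j.+1%:R^-1].
    case: (pselect (exists i : I, pickle i = m)) => [[i im]|noi]; last first.
      by apply: filterS filterT => f _ i im; case: noi; exists i.
    have j0 : 0 < j.+1%:R^-1 :> R by rewrite invr_gt0.
    have bq : nbhs (q i : R) [set r : R | `|q i - r| < j.+1%:R^-1].
      exact: (nbhsx_ballx (q i : R) _ j0).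
    have qi := @proj_continuous I K i q _ bq.
    apply: (@filterS _ (nbhs (q : prod_topology K)) _ _ _ _ qi) => f qf i' i'm.
    by have -> : i' = i by apply: (pcan_inj pickleK); rewrite im.
  have := @filter_forall _ _ _ (nbhs (q : prod_topology K)) _
    (fun m : 'I_j.+1 => Qi m) => QI.
  apply: (@filterS _ (nbhs (q : prod_topology K)) _ _ _ _ (QI _)) => f Qf i ij.
  exact: (Qf (Ordinal (ij : (pickle i < j.+1)%N))).
have pN : (p' @ \oo)
    [set p' n | n in [set n | (N < n)%N]].
  by exists N.+1 => // n /= Nn; exists n.
have [_ [[n Nn <-] Qn]] := pq _ _ pN Qq.
by exists n.
Unshelve. all: by end_near. Qed.

Lemma mkseq_prefix (f g : nat -> bool) m n : (m <= n)%N ->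
  mkseq f n = mkseq g n -> mkseq f m = mkseq g m.
Proof.
move=> mn /(congr1 (take m)).
by rewrite /mkseq -!map_take !take_iota (minn_idPl mn).
Qed.

Definition cylinder {U : Type} (code : U -> nat -> bool) (w : seq bool) :
  set U := [set y | mkseq (code y) (size w) = w].

Section cylinder.
Context {U : Type}.
Variable code : U -> nat -> bool.

Lemma mkseq_rcons (f : nat -> bool) m : mkseq f m.+1 = rcons (mkseq f m) (f m).
Proof. by rewrite /mkseq -addn1 iotaD map_cat cats1. Qed.

Lemma cylinder_nil : cylinder code [::] = setT.
Proof. by apply/seteqP; split. Qed.

Lemma cylinder_rcons w b : cylinder code (rcons w b) =
  cylinder code w `&` [set y | code y (size w) = b].
Proof.
apply/seteqP; split=> y; rewrite /cylinder/= size_rcons mkseq_rcons.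
  by move/rcons_inj => [].
by move=> [-> ->].
Qed.

Lemma cylinder_split w : cylinder code w =
  cylinder code (rcons w false) `|` cylinder code (rcons w true).
Proof.
rewrite !cylinder_rcons -setIUr; apply/esym/setIidPl => y _ /=.
by case: (code y _); [right|left].
Qed.

Lemma cylinder_splitI w :
  cylinder code (rcons w false) `&` cylinder code (rcons w true) = set0.
Proof.
by rewrite !cylinder_rcons -subset0 => y [[_ /= ->] [_ //]].
Qed.

Lemma cylinder_mkseq y m : cylinder code (mkseq (code y) m) y.
Proof. by rewrite /cylinder/= size_mkseq. Qed.

End cylinder.

(** A consistent family of weights on the nodes of the binary tree is the family
    of lengths of nested intervals: each interval is cut in two, in proportion
    to the weights of its children, and a point of the base interval is coded
    by the branch of intervals that contain it. *)
Section interval_tree.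
Context {R : realType}.
Variables (c : R) (q : seq bool -> R).
Hypotheses (c0 : 0 < c) (q0 : forall w, 0 <= q w) (qc : q [::] = c).
Hypothesis qS : forall w, q w = q (rcons w false) + q (rcons w true).

Let left_end (w : seq bool) : R :=
  \sum_(i < size w) (if nth false w i then q (rcons (take i w) false) else 0).

Let itv w : set R := `[left_end w, left_end w + q w[%classic.

Let left_end_rcons w b :
  left_end (rcons w b) = left_end w + (if b then q (rcons w false) else 0).
Proof.
rewrite /left_end size_rcons big_ord_recr/= nth_rcons ltnn eqxx.
rewrite -cats1 take_size_cat//; congr (_ + _); apply: eq_bigr => i _.
by rewrite nth_cat ltn_ord take_cat ltn_ord.
Qed.

Let itv_rcons w b t : itv (rcons w b) t <->
  itv w t /\ (left_end w + q (rcons w false) <= t) = b.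
Proof.
rewrite /itv /= !in_itv/= left_end_rcons.
have q1 := q0 (rcons w true); have q2 := q0 (rcons w false); have q3 := qS w.
case: b; split.
- move=> /andP[h1 h2]; split; last exact: h1.
  by apply/andP; split; lra.
- move=> [/andP[h1 h2] h3]; apply/andP; split; first exact: h3.
  by lra.
- move=> /andP[h1 h2]; split; first by apply/andP; split; lra.
  by apply/negbTE; rewrite -ltNge; lra.
- move=> [/andP[h1 h2] /negbT]; rewrite -ltNge => h3.
  by apply/andP; split; lra.
Qed.

Let branch t := fix branch m := if m is m'.+1 then
  rcons (branch m') (left_end (branch m') + q (rcons (branch m') false) <= t)
  else [::].

Let digit t i : bool := left_end (branch t i) + q (rcons (branch t i) false) <= t.

Let branchE t m : branch t m = mkseq (digit t) m.
Proof. by elim: m => // m IH; rewrite mkseq_rcons -IH. Qed.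

Let itv_branch w t : itv w t -> branch t (size w) = w.
Proof.
elim/last_ind: w => // w b IH /itv_rcons[/IH wE <-].
by rewrite size_rcons /= wE.
Qed.

Let itv_nil : itv [::] = `[0, c[%classic.
Proof. by rewrite /itv /left_end big_ord0 add0r qc. Qed.

Let branch_itv t m : itv [::] t -> itv (branch t m) t.
Proof. by move=> t0; elim: m => // m IH /=; apply/itv_rcons. Qed.

Let itv_sub w : itv w `<=` itv [::].
Proof. by elim/last_ind: w => // w b IH t /itv_rcons[/IH]. Qed.

Lemma interval_tree :
  exists (d' : measure_display) (S : measurableType d')
    (P : {finite_measure set S -> \bar R}) (code : S -> nat -> bool),
  [/\ P setT = c%:E, forall w, measurable (cylinder code w),
    forall w, P (cylinder code w) = (q w)%:E
  & forall t m, 0 < q (mkseq (code t) m)].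
Proof.
have m0 : measurable (`[0, c[%classic : set (measurableTypeR R)).
  exact: measurable_itv.
pose B0 : set (measurableTypeR R) := `[0, c[%classic.
have leb0 : (lebesgue_measure B0 < +oo)%E.
  by rewrite lebesgue_measure_itv/= lte_fin c0 oppr0 adde0 ltry.
pose P : {finite_measure set (measurableTypeR R) -> \bar R} := mfrestr m0 leb0.
(* The measure lives on the base interval. Elsewhere the code is that of [0], so
   that the prefixes of every code have positive weight. *)
pose code' (t : R) := if t \in `[0, c[ then digit t else digit 0.
have in0 : itv [::] 0 by rewrite itv_nil /= in_itv/= lexx.
have codeP t m : exists2 t', itv [::] t' & mkseq (code' t) m = branch t' m.
  rewrite /code'; case: ifPn => tc; first exists t => //; rewrite ?branchE//.
    by rewrite itv_nil.
  by exists 0 => //; rewrite branchE.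
have cyl0 w : `[0, c[%classic `&` cylinder code' w = itv w.
  apply/seteqP; split => t /=.
    move=> [tc]; rewrite /cylinder/= /code' tc -branchE => <-.
    by apply: branch_itv; rewrite itv_nil.
  move=> wt; have := itv_sub wt; rewrite itv_nil /= => tc; split => //.
  by rewrite /cylinder/= /code' tc -branchE itv_branch.
have cyl1 w : ~` `[0, c[%classic `&` cylinder code' w = ~` `[0, c[%classic \/
    ~` `[0, c[%classic `&` cylinder code' w = set0.
  case: (pselect (mkseq (digit 0) (size w) = w)) => wE; [left|right].
    apply/setIidPl => t /negP/negbTE; rewrite /cylinder/= /code' => ->.
    exact: wE.
  rewrite -subset0 => t [/negP/negbTE]; rewrite /cylinder/= /code' => ->.
  exact: wE.
have mcyl w : measurable (cylinder code' w : set (measurableTypeR R)).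
  rewrite -[X in measurable X]setTI -(setUv `[0, c[%classic) setIUl.
  apply: measurableU.
    by rewrite cyl0; exact: measurable_itv.
  by case: (cyl1 w) => ->; [exact: measurableC|exact: measurable0].
exists _, (measurableTypeR R), P, code'; split => //.
- rewrite /P /= /mfrestr /mrestr setTI lebesgue_measure_itv/= lte_fin c0.
  by rewrite oppr0 adde0.
- move=> w; rewrite /P /= /mfrestr /mrestr setIC cyl0.
  rewrite /itv lebesgue_measure_itv/= lte_fin ltrDl.
  case: ltgtP (q0 w) => // [qw _|<- _ //].
  by rewrite -EFinB addrAC subrr add0r.
- move=> t m; have [t' t'0 ->] := codeP t m.
  have := branch_itv m t'0; rewrite /itv /= in_itv/= => /andP[h1 h2].
  by lra.
Qed.

End interval_tree.

Section coding_limit.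
Context d (T : measurableType d) (R : realType).
Variables (mu : nat -> {finite_measure set T -> \bar R}) (c : R).
Variable code : nat -> T -> nat -> bool.
Hypotheses (c0 : 0 < c) (muc : forall n, mu n setT = c%:E).
Hypothesis mcode : forall n i, measurable [set y | code n y i].

Lemma measurable_cylinder n w : measurable (cylinder (code n) w).
Proof.
elim/last_ind: w => [|w b IH]; first by rewrite cylinder_nil.
rewrite cylinder_rcons; apply: measurableI => //.
case: b; first exact: mcode.
rewrite (_ : [set _ | _] = ~` [set y | code n y (size w)]).
  exact/measurableC/mcode.
by apply/seteqP; split => y /=; case: (code n y _) => //; case.
Qed.

(** Along a diagonal subsequence the masses of all cylinders converge, and the
    limits are consistent weights on the binary tree. A prefix of a code in
    the limit space has positive mass, hence positive mass for [mu (psi j)] for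
    all large [j]. *)
Lemma coding_limit : exists psi : nat -> nat,
  (forall j, (psi j < psi j.+1)%N) /\
  exists (d' : measure_display) (S : measurableType d')
    (P : {finite_measure set S -> \bar R}) (lcode : S -> nat -> bool),
  [/\ P setT = c%:E, forall w, measurable (cylinder lcode w),
    forall w, fine (mu (psi j) (cylinder (code (psi j)) w)) @[j --> \oo] -->
      fine (P (cylinder lcode w))
  & forall t m, 0 < fine (P (cylinder lcode (mkseq (lcode t) m)))].
Proof.
pose p n w := fine (mu n (cylinder (code n) w)).
have p0 n w : 0 <= p n w by rewrite fine_ge0.
have pS n w : p n w = p n (rcons w false) + p n (rcons w true).
  rewrite /p cylinder_split measureU//; try exact: measurable_cylinder.
    rewrite fineD// ?fin_num_measure//; exact: measurable_cylinder.
  exact: cylinder_splitI.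
have pc n : p n [::] = c by rewrite /p cylinder_nil muc.
have pb n w : 0 <= p n w <= c.
  rewrite p0/=; elim/last_ind: w => [|w b IH]; first by rewrite pc.
  apply: le_trans IH; rewrite (pS n w).
  by case: b; rewrite ?lerDl ?lerDr p0.
have [psi [psi_inc [q pq]]] := diagonal_subsequence pb.
exists psi; split => //.
have q0 w : 0 <= q w.
  by rewrite -(cvg_lim _ (pq w))//; apply: limr_ge;
    [apply/cvg_ex; eexists; exact: pq|exact: nearW].
have qc : q [::] = c.
  apply: (cvg_unique _ (pq [::])) => //.
  by apply: cvg_near_cst; apply: nearW => j; rewrite pc.
have qS w : q w = q (rcons w false) + q (rcons w true).
  apply: (cvg_unique _ (pq w)) => //.
  have -> : (fun j => p (psi j) w) =
      (fun j => p (psi j) (rcons w false) + p (psi j) (rcons w true)).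
    by apply/funext => j; exact: pS.
  by apply: cvgD; exact: pq.
have [d' [S [P [lcode [PT mc Pq q_gt0]]]]] := interval_tree c0 q0 qc qS.
exists d', S, P, lcode; split => //.
- by move=> w; rewrite Pq /=; exact: pq.
- by move=> t m; rewrite Pq /=; exact: q_gt0.
Qed.

End coding_limit.

Lemma finite_prefixes (S : choiceType) (code : S -> nat -> bool) m :
  exists ts : seq S, forall t, exists2 t', t' \in ts &
    mkseq (code t') m = mkseq (code t) m.
Proof.
pose r (w : m.-tuple bool) : option S :=
  if pselect (exists t, mkseq (code t) m = w) is left ex
  then Some (projT1 (cid ex)) else None.
exists (pmap r (enum {: m.-tuple bool})) => t.
have szt : size (mkseq (code t) m) == m by rewrite size_mkseq.
case rE : (r (Tuple szt)) => [z|]; last first.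
  by move: rE; rewrite /r; case: pselect => // nex; case: nex; exists t.
exists z; first by rewrite mem_pmap -rE map_f// mem_enum.
move: rE; rewrite /r; case: pselect => // ex [<-].
by case: (cid ex).
Qed.

Lemma cvgn_sum (R : realType) (I : Type) (r : seq I) (Q : pred I)
    (f : I -> nat -> R) (l : I -> R) :
  (forall i, Q i -> f i n @[n --> \oo] --> l i) ->
  \sum_(i <- r | Q i) f i n @[n --> \oo] --> \sum_(i <- r | Q i) l i.
Proof.
move=> fl; elim: r => [|i r IH].
  by rewrite big_nil; under eq_fun do rewrite big_nil; exact: cvg_cst.
rewrite big_cons; under eq_fun do rewrite big_cons.
by case: ifPn => // Qi; apply: cvgD => //; exact: fl.
Qed.

Section coded_integrals.
Context d (T : measurableType d) (R : realType).
Variables (mu : nat -> {finite_measure set T -> \bar R}) (c : R).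
Variables (code : nat -> T -> nat -> bool) (F : nat -> set T).
Hypotheses (muc : forall n, mu n setT = c%:E).
Hypothesis mcode : forall n i, measurable [set y | code n y i].
Hypotheses (mF : forall n, measurable (F n)) (muF : forall n, mu n (~` F n) = 0%E).
Context d' (S : measurableType d').
Variables (P : {finite_measure set S -> \bar R}) (lcode : S -> nat -> bool).
Hypotheses (PT : P setT = c%:E) (mlcode : forall w, measurable (cylinder lcode w)).
Hypothesis cvg_cylinder : forall w,
  fine (mu n (cylinder (code n) w)) @[n --> \oo] -->
  fine (P (cylinder lcode w)).
Hypothesis lcode_gt0 : forall t m,
  0 < fine (P (cylinder lcode (mkseq (lcode t) m))).

Lemma coded_support t m N : exists n, (N <= n)%N /\
  exists2 y, F n y & mkseq (code n y) m = mkseq (lcode t) m.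
Proof.
have := cvg_cylinder (w := mkseq (lcode t) m).
move=> /cvgr_gt/(_ _ (lcode_gt0 t m)) [N' _ N'P]; exists (maxn N N'); split; first exact: leq_maxl.
have /= {N'P} := N'P (maxn N N') (leq_maxr _ _); move: (maxn N N') => n mun.
have mcyl := measurable_cylinder mcode n (mkseq (lcode t) m).
have [y [Fy cy]] : F n `&` cylinder (code n) (mkseq (lcode t) m) !=set0.
  apply/set0P/negP => /eqP F0; move: mun; apply/negP; rewrite -leNgt.
  have : cylinder (code n) (mkseq (lcode t) m) `<=` ~` F n.
    by move=> y cy Fy; have : set0 y by rewrite -F0.
  move=> /(subset_measure0 mcyl (measurableC (mF n)) (mu := mu n)).
  by move=> /(_ (muF n)) ->.
by exists y => //; move: cy; rewrite /cylinder/= size_mkseq.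
Qed.

(** Functions on the successive spaces that follow, up to any precision, a
    function of the limit code: they are the test functions for the
    convergence of the measures. *)
Definition tracks (g : nat -> T -> R) (h : S -> R) :=
  forall e : R, 0 < e -> exists m N, forall n y t, (N <= n)%N -> F n y ->
    mkseq (code n y) m = mkseq (lcode t) m -> `|g n y - h t| <= e.

Section tracked.
Variables (g : nat -> T -> R) (h : S -> R) (M : R).
Hypotheses (mg : forall n, measurable_fun (F n) (g n)).
Hypothesis gM : exists N, forall n y, (N <= n)%N -> F n y -> `|g n y| <= M.
Hypothesis gh : tracks g h.

Lemma tracks_bounded t : `|h t| <= M.
Proof.
apply/ler_addgt0Pl => e e0; have [N gN] := gM; have [m [N' mN]] := gh e0.
have [n [Nn [y Fy yt]]] := coded_support t m (maxn N N').
have := mN n y t (leq_trans (leq_maxr _ _) Nn) Fy yt.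
have := gN n y (leq_trans (leq_maxl _ _) Nn) Fy.
move=> h1 h2; have : `|h t| <= `|g n y| + `|g n y - h t|.
  rewrite -[X in `|X| <= _](_ : g n y - (g n y - h t) = h t).
    exact: ler_normB.
  by rewrite opprB addrC subrK.
by move=> /le_trans; apply; lra.
Qed.

Let node m := m.-tuple bool.

(* A node that no limit code visits has no representative; its mass tends to
   zero. *)
Let rep m (w : node m) : option S :=
  if pselect (exists t, cylinder lcode w t) is left ex then Some (projT1 (cid ex))
  else None.

Let val_rep m (w : node m) : R := if rep w is Some t then h t else 0.

Let stepS m t : R := \sum_(w : node m) val_rep w * \1_(cylinder lcode w) t.

Let stepT m n y : R := \sum_(w : node m) val_rep w * \1_(cylinder (code n) w) y.

Let empty_part m n y : R :=
  \sum_(w : node m | rep w == None) \1_(cylinder (code n) w) y.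

Let mkseqP U (f : U -> nat -> bool) m (y : U) : size (mkseq (f y) m) == m.
Proof. by rewrite size_mkseq. Qed.

Let indic_node U (f : U -> nat -> bool) m (w : node m) y :
  \1_(cylinder f w) y = (w == Tuple (mkseqP f m y))%:R :> R.
Proof.
rewrite indicE; congr (_ %:R); congr nat_of_bool.
apply/idP/eqP; rewrite inE /cylinder/= size_tuple.
  by move=> yw; apply: val_inj.
by move=> ->.
Qed.

Let sum_node U (f : U -> nat -> bool) m (v : node m -> R) y :
  \sum_(w : node m) v w * \1_(cylinder f w) y = v (Tuple (mkseqP f m y)).
Proof.
rewrite (bigD1 (Tuple (mkseqP f m y)))// indic_node eqxx mulr1 /= big1 ?addr0//.
by move=> w /negbTE wy; rewrite indic_node wy mulr0.
Qed.

Let rep_some m (w : node m) t : rep w = Some t -> mkseq (lcode t) m = w.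
Proof.
rewrite /rep; case: pselect => // ex [<-].
by case: (cid ex) => t' /=; rewrite /cylinder/= size_tuple.
Qed.

Let rep_none m (w : node m) : rep w = None -> P (cylinder lcode w) = 0%E.
Proof.
rewrite /rep; case: pselect => // nex _.
rewrite (_ : cylinder _ _ = set0) ?measure0// -subset0 => t wt.
by apply: nex; exists t.
Qed.

Let rep_lcode m t : exists2 t', rep (Tuple (mkseqP lcode m t)) = Some t' &
  mkseq (lcode t') m = mkseq (lcode t) m.
Proof.
case E : (rep (Tuple (mkseqP lcode m t))) => [t'|].
  by exists t' => //; rewrite (rep_some E).
have := rep_none E; have := lcode_gt0 t m => /= + P0.
by rewrite P0 ltxx.
Qed.

Let bstepS m : bounded_measurable setT (stepS m).
Proof.
apply: (bmRintegral_sum (P) _ _ _).1 => // w _.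
apply: bounded_measurableZ.
exact: bounded_measurable_indic.
Qed.

Let bstepT m n : bounded_measurable (F n) (stepT m n).
Proof.
apply: (bmRintegral_sum (mu n) _ _ _).1 => // w _.
apply: bounded_measurableZ.
exact/bounded_measurable_indic/measurable_cylinder.
Qed.

Let bempty m n : bounded_measurable (F n) (empty_part m n).
Proof.
apply: (bmRintegral_sum (mu n) _ _ _).1 => // w _.
exact/bounded_measurable_indic/measurable_cylinder.
Qed.

(* Freezing [h] at one representative of each node gives a step function of the
   first [m] digits on either side; on the approximating spaces the error is
   large only at nodes without representative. *)
Let stepS_near e : 0 < e -> exists m N, (forall t, `|h t - stepS m t| <= e) /\
  forall n y, (N <= n)%N -> F n y ->
    `|g n y - stepT m n y| <= e + M * empty_part m n y.
Proof.
move=> e0; have e2 : 0 < e / 2 by rewrite divr_gt0.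
have [m [N mN]] := gh e2; have [N' gN'] := gM.
exists m, (maxn N N'); split.
  move=> t; rewrite /stepS sum_node /val_rep.
  have [t' -> tt'] := rep_lcode m t.
  have [n [Nn [y Fy yt]]] := coded_support t m N.
  have h1 := mN _ _ _ Nn Fy yt.
  have h2 : `|g n y - h t'| <= e / 2 by apply: mN => //; rewrite yt tt'.
  have : `|h t - h t'| <= `|g n y - h t'| + `|g n y - h t|.
    rewrite -[X in `|X| <= _](_ : (g n y - h t') - (g n y - h t) = h t - h t').
      exact: ler_normB.
    by rewrite opprB addrC addrA subrK.
  by move=> /le_trans; apply; lra.
move=> n y Nn Fy; rewrite /stepT sum_node /val_rep.
have emptyE : empty_part m n y = (rep (Tuple (mkseqP (code n) m y)) == None)%:R.
  rewrite /empty_part; under eq_bigr do rewrite indic_node.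
  case: eqP => [E|E].
    rewrite (bigD1 (Tuple (mkseqP (code n) m y)))/=; last exact/eqP.
    by rewrite eqxx big1 ?addr0// => w /andP[_ /negbTE ->].
  rewrite big1// => w /eqP wN; case: eqP => // wE.
  by case: E; rewrite -wE.
rewrite emptyE; case E : (rep _) => [t|].
  rewrite mulr0 addr0.
  apply: (le_trans (mN n y t _ Fy _)); last by lra.
    exact: leq_trans (leq_maxl _ _) Nn.
  by rewrite (rep_some E).
rewrite subr0 mulr1 (le_trans (gN' n y _ Fy))//.
  exact: leq_trans (leq_maxr _ _) Nn.
by rewrite lerDr ltW.
Qed.

Lemma tracks_measurable : bounded_measurable setT h.
Proof.
split; last by exists M => t _; exact: tracks_bounded.
have /choice[m mP] : forall k : nat, exists m,
    forall t, `|h t - stepS m t| <= k.+1%:R^-1.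
  move=> k; have k0 : 0 < k.+1%:R^-1 :> R by rewrite invr_gt0.
  by have [m [N [hm _]]] := stepS_near k0; exists m.
apply: (@measurable_fun_cvg _ _ _ _ (fun k => stepS (m k))).
  by move=> k; exact: (bstepS (m k)).1.
move=> t _; apply/cvgrPdist_lt => e e0; near=> k.
apply: (le_lt_trans (mP k t)); near: k.
exact: (near_infty_natSinv_lt (PosNum e0)).
Unshelve. all: by end_near. Qed.

Let mu_cylinder n w :
  \int[mu n]_(y in F n) (\1_(cylinder (code n) w) y) =
  fine (mu n (cylinder (code n) w)).
Proof.
have mcyl := measurable_cylinder mcode n w.
have := @bmRintegral_setC0 _ _ _ (mu n) setT (~` F n)
  (\1_(cylinder (code n) w)) measurableT (measurableC (mF n)) (muF n).
rewrite setTD setCK => ->; last exact: bounded_measurable_indic.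
by rewrite /Rintegral integral_indic ?setIT.
Qed.

(** The integral of a step function of the first digits is a finite combination
    of masses of cylinders, which converge; the nodes without representative
    carry no mass in the limit. *)
Lemma tracks_integral :
  \int[mu n]_(y in F n) g n y @[n --> \oo] --> \int[P]_t h t.
Proof.
apply/cvgrPdist_le => e e0.
have c_ge0 : 0 <= c by rewrite -lee_fin -PT.
have d0 : 0 < e / (2 * c + 2).
  by rewrite divr_gt0//; lra.
have [m [N [hS gT]]] := stepS_near d0.
set de := e / _ in d0 hS gT.
have IS : `|\int[P]_t h t - \int[P]_t stepS m t| <= de * c.
  rewrite -bmRintegralB//; last exact: tracks_measurable.
  rewrite (_ : c = fine (P setT)); last by rewrite PT.
  apply: le_norm_bmRintegral_cst => //.
  have [mh _] := tracks_measurable; have [ms _] := bstepS m.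
  exact: measurable_funB.
have ISE : \int[P]_t stepS m t =
    \sum_(w : node m) val_rep w * fine (P (cylinder lcode w)).
  rewrite (bmRintegral_sum (P) _ _ _).2 => // [|w _].
    apply: eq_bigr => w _; rewrite bmRintegralZl//.
      by rewrite /Rintegral integral_indic ?setIT.
    exact: bounded_measurable_indic.
  apply: bounded_measurableZ.
  exact: bounded_measurable_indic.
have ITE n : \int[mu n]_(y in F n) stepT m n y =
    \sum_(w : node m) val_rep w * fine (mu n (cylinder (code n) w)).
  have mcyl w := measurable_cylinder mcode n w.
  rewrite (bmRintegral_sum (mu n) _ _ _).2 => // [|w _].
    apply: eq_bigr => w _; rewrite bmRintegralZl// ?mu_cylinder//.
    exact: bounded_measurable_indic.
  apply: bounded_measurableZ.
  exact: bounded_measurable_indic.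
have IEE n : \int[mu n]_(y in F n) empty_part m n y =
    \sum_(w : node m | rep w == None) fine (mu n (cylinder (code n) w)).
  rewrite (bmRintegral_sum (mu n) _ _ _).2 => // [|w _].
    by apply: eq_bigr => w _; rewrite mu_cylinder.
  exact/bounded_measurable_indic/measurable_cylinder.
have cE : \int[mu n]_(y in F n) empty_part m n y @[n --> \oo] --> 0.
  rewrite (_ : 0 = \sum_(w : node m | rep w == None) fine (P (cylinder lcode w))).
    under eq_cvg do rewrite IEE.
    by apply: cvgn_sum => w _; exact: cvg_cylinder.
  by rewrite big1// => w /eqP wN; rewrite rep_none.
have cT : \int[mu n]_(y in F n) stepT m n y @[n --> \oo] --> \int[P]_t stepS m t.
  rewrite ISE; under eq_cvg do rewrite ITE.
  by apply: cvgn_sum => w _; apply: cvgM; [exact: cvg_cst|exact: cvg_cylinder].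
have [N' gN'] := gM.
have cME : M * \int[mu n]_(y in F n) empty_part m n y @[n --> \oo] --> 0.
  by rewrite -[X in _ --> X](mulr0 M); apply: cvgM => //; exact: cvg_cst.
near=> n.
have Nn : (N <= n)%N by near: n; exact: nbhs_infty_ge.
have N'n : (N' <= n)%N by near: n; exact: nbhs_infty_ge.
have bg : bounded_measurable (F n) (g n).
  by split => //; exists M => y Fy; exact: gN'.
have IT : `|\int[mu n]_(y in F n) g n y - \int[mu n]_(y in F n) stepT m n y| <=
    de * c + M * \int[mu n]_(y in F n) empty_part m n y.
  rewrite -bmRintegralB//.
  apply: (@le_trans _ _ (\int[mu n]_(y in F n) (de + M * empty_part m n y))).
    apply: le_norm_bmRintegral => //.
    - exact: bounded_measurableB.
    - apply: bounded_measurableD; first exact: bounded_measurable_cst.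
      exact: bounded_measurableZ.
    - by move=> y Fy; exact: gT.
  rewrite bmRintegralD//; last 2 first.
  - exact: bounded_measurable_cst.
  - exact: bounded_measurableZ.
  rewrite bmRintegralZl// Rintegral_cst// lerD2r ler_wpM2l//; first exact: ltW.
  rewrite -lee_fin fineK ?fin_num_measure// -(muc n) le_measure// inE//.
have T1 : `|\int[P]_t stepS m t - \int[mu n]_(y in F n) stepT m n y| <= de / 2.
  by near: n; move/cvgrPdist_le : cT; apply; rewrite divr_gt0.
have T2 : `|0 - M * \int[mu n]_(y in F n) empty_part m n y| <= de / 2.
  by near: n; move/cvgrPdist_le : cME; apply; rewrite divr_gt0.
have {}T2 : M * \int[mu n]_(y in F n) empty_part m n y <= de / 2.
  by apply: le_trans T2; rewrite sub0r normrN ler_norm.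
have -> : e = de * c + de + de * c + de.
  by rewrite /de; field; lra.
rewrite ler_norml; move: IS IT T1; rewrite !ler_norml.
move=> /andP[? ?] /andP[? ?] /andP[? ?]; apply/andP; split; lra.
Unshelve. all: by end_near. Qed.

End tracked.
End coded_integrals.

(** * Functions of two variables *)

Section product_measurability.
Context d1 d2 (T1 : measurableType d1) (T2 : measurableType d2) (R : realType).
Implicit Types (A : set T1) (B : set T2) (F : T1 -> T2 -> R).

Lemma piecewise_approximation A B F (s : seq T1) (V : T1 -> set T1) (e : R) :
  measurable A -> measurable B -> (forall z, measurable (V z)) ->
  (forall x, A x -> exists2 z, z \in s & V z x) ->
  (forall z, z \in s -> measurable_fun B (F z)) ->
  (forall z x y, z \in s -> A x -> V z x -> B y -> `|F x y - F z y| <= e) ->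
  exists G : T1 * T2 -> R, measurable_fun (A `*` B) G /\
    forall x y, A x -> B y -> `|F x y - G (x, y)| <= e.
Proof.
move=> + mB mV; elim: s A => [|z s IH] A mA As mF Fe.
  exists (fun=> 0); split; first exact: measurable_cst.
  by move=> x y /As[].
have mAV : measurable (A `\` V z) by exact: measurableD.
have [] := IH (A `\` V z) mAV.
- move=> x [Ax zx]; have [z'] := As x Ax.
  by rewrite in_cons => /predU1P[-> //|z's] z'x; exists z'.
- by move=> z' z's; apply: mF; rewrite in_cons z's orbT.
- by move=> z' x y z's [Ax _]; apply: Fe => //; rewrite in_cons z's orbT.
move=> G [mG GE].
exists (fun xy => if xy.1 \in V z then F z xy.2 else G xy); split; last first.
  move=> x y Ax By /=; case: ifPn => [|/negP]; rewrite inE => zx.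
    by apply: Fe => //; rewrite mem_head.
  exact: GE.
have -> : A `*` B = ((A `&` V z) `*` B) `|` ((A `\` V z) `*` B).
  apply/seteqP; split => -[x y] /=; last by move=> [[[? ?]]|[[? ?]]].
  by move=> [Ax By]; case: (pselect (V z x)); [left|right].
have mAV' : measurable (A `&` V z) by exact: measurableI.
apply/measurable_funU; try exact: measurableX.
split.
  apply: (@eq_measurable_fun _ _ _ _ _ (fun xy => F z xy.2)).
    by move=> -[x y]; rewrite inE/= => -[[_ /mem_set ->]].
  apply: (measurable_comp mB _ (mF z (mem_head _ _))).
    by move=> _ [[x y] [_ By] <-].
  exact: measurable_funTS.
apply: (@eq_measurable_fun _ _ _ _ _ G) => //.
by move=> -[x y]; rewrite inE/= => -[[_ zx] _]; rewrite memNset.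
Qed.

(** An open subset of a product need not belong to the product of the Borel
    sigma-algebras, so continuity does not give joint measurability. Uniform
    approximation by functions that take finitely many forms in the first
    variable does. *)
Lemma piecewise_measurable A B F : measurable A -> measurable B ->
  (forall e : R, 0 < e -> exists (s : seq T1) (V : T1 -> set T1),
    [/\ forall z, measurable (V z),
      forall x, A x -> exists2 z, z \in s & V z x,
      forall z, z \in s -> measurable_fun B (F z) &
      forall z x y, z \in s -> A x -> V z x -> B y -> `|F x y - F z y| <= e]) ->
  measurable_fun (A `*` B) (fun xy => F xy.1 xy.2).
Proof.
move=> mA mB FP.
have /choice[G GP] : forall k : nat, exists G : T1 * T2 -> R,
    measurable_fun (A `*` B) G /\
    forall x y, A x -> B y -> `|F x y - G (x, y)| <= k.+1%:R^-1.
  move=> k; have k0 : 0 < k.+1%:R^-1 :> R by rewrite invr_gt0.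
  have [s [V [mV As mF Fe]]] := FP _ k0.
  exact: (piecewise_approximation mA mB mV As mF Fe).
apply: (@measurable_fun_cvg _ _ _ _ G); first by move=> k; exact: (GP k).1.
move=> [x y] [/= Ax By]; apply/cvgrPdist_lt => e e0; near=> k.
apply: (le_lt_trans ((GP k).2 x y Ax By)); near: k.
exact: (near_infty_natSinv_lt (PosNum e0)).
Unshelve. all: by end_near. Qed.

End product_measurability.

Section joint_continuity.
Context {R : realType} {X Y : topologicalType}.
Implicit Types (A : set X) (B : set Y) (F : X -> Y -> R).

Definition jointly_continuous_on A B F :=
  {within A `*` B, continuous (fun z : X * Y => F z.1 z.2)}.

Lemma jointly_continuousl A B F y : jointly_continuous_on A B F -> B y ->
  {within A, continuous (F ^~ y)}.
Proof.
move=> /subspace_continuousP cF By; apply/subspace_continuousP => x Ax.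
move=> W /(cF (x, y) (conj Ax By)) [[P Q] [/= Px Qy] PQ].
apply: filterS Px => x' Px' Ax'.
exact: (PQ (x', y) (conj Px' (nbhs_singleton Qy)) (conj Ax' By)).
Qed.

Lemma jointly_continuousr A B F x : jointly_continuous_on A B F -> A x ->
  {within B, continuous (F x)}.
Proof.
move=> /subspace_continuousP cF Ax; apply/subspace_continuousP => y By.
move=> W /(cF (x, y) (conj Ax By)) [[P Q] [/= Px Qy] PQ].
apply: filterS Qy => y' Qy' By'.
exact: (PQ (x, y') (conj (nbhs_singleton Px) Qy') (conj Ax By')).
Qed.

Lemma jointly_continuousS A A' B B' F : A' `<=` A -> B' `<=` B ->
  jointly_continuous_on A B F -> jointly_continuous_on A' B' F.
Proof.
by move=> AA BB; apply: continuous_subspaceW => -[x y] [/AA ? /BB].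
Qed.

(** The tube lemma: compactness of [B] makes the continuity in the first variable
    uniform in the second. *)
Lemma jointly_uniform A B F x : jointly_continuous_on A B F -> compact B ->
  A x -> forall e, 0 < e -> \forall x' \near x, A x' ->
    forall y, B y -> `|F x' y - F x y| < e.
Proof.
move=> /subspace_continuousP cF /compact_near_coveringP.
move=> /near_covering_withinP cB Ax e e0.
apply: filterS (cB X (nbhs x) (fun x' y => A x' -> `|F x' y - F x y| < e) _ _).
  by move=> x' Bx' Ax' y By; exact: Bx'.
move=> y By; have e2 : 0 < e / 2 by rewrite divr_gt0.
have /cvgrPdist_lt/(_ _ e2) [[P Q] [/= Px Qy] PQ] := cF (x, y) (conj Ax By).
exists (Q, P) => // -[y' x'] [/= Qy' Px'] By' Ax'.
have /= h1 := PQ (x', y') (conj Px' Qy') (conj Ax' By').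
have /= h2 := PQ (x, y') (conj (nbhs_singleton Px) Qy') (conj Ax By').
have := ler_distD (F x y) (F x' y') (F x y').
by rewrite [X in _ <= X + _]distrC; move: h1 h2; lra.
Qed.

End joint_continuity.

Lemma compact_finite_subcover {X : topologicalType} (K : set X)
    (V : X -> set X) : compact K -> (forall x, K x -> nbhs x (V x)) ->
  exists s : seq X, (forall z, z \in s -> K z) /\
    forall x, K x -> exists2 z, z \in s & V z x.
Proof.
move=> /compact_near_coveringP cK KV.
(* Lists of points directed by inclusion: the neighbourhood of each point of [K]
   is eventually among those of the list. *)
pose G := filter_from [set: seq X] (fun s0 => [set s : seq X | {subset s0 <= s}]).
have FG : Filter G.
  apply: filter_from_filter; first by exists [::].
  move=> s1 s2 _ _; exists (s1 ++ s2) => // s s12.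
  by split=> z zs; apply: s12; rewrite mem_cat zs ?orbT.
have Gcov x : K x -> \forall x' \near x & s \near G,
    exists2 z, z \in s /\ K z & V z x'.
  move=> Kx; exists (V x, [set s : seq X | x \in s]); last first.
    by move=> [x' s] [/= xx' xs]; exists x.
  split=> /=; first exact: KV.
  by exists [:: x] => // s; apply; exact: mem_head.
have [s0 _ /(_ s0) Ks0] := cK _ G
    (fun (s : seq X) x => exists2 z, z \in s /\ K z & V z x) FG Gcov.
exists [seq z <- s0 | z \in K]; split.
  by move=> z; rewrite mem_filter => /andP[/set_mem].
move=> x Kx; have [//|z [zs Kz] zx] := Ks0 _ x Kx.
by exists z => //; rewrite mem_filter zs mem_set.
Qed.

Section joint_continuity_compact.
Context {R : realType} {X Y : topologicalType}.
Implicit Types (A K : set X) (B : set Y) (F : X -> Y -> R).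

Lemma jointly_continuous_swap A B F : jointly_continuous_on A B F ->
  jointly_continuous_on B A (fun y x => F x y).
Proof.
move=> /subspace_continuousP cF; apply/subspace_continuousP => -[y x] [/= By Ax].
move=> W /(cF (x, y) (conj Ax By)) [[P Q] [/= Px Qy] PQ].
exists (Q, P) => // -[y' x'] [/= Qy' Px'] [/= By' Ax'].
exact: (PQ (x', y') (conj Px' Qy') (conj Ax' By')).
Qed.

Lemma compact_net A B F K : jointly_continuous_on A B F -> compact B ->
  compact K -> K `<=` A -> forall e, 0 < e ->
  exists (s : seq X) (V : X -> set X), [/\ forall z, z \in s -> K z,
    forall z, open (V z), forall x, K x -> exists2 z, z \in s & V z x &
    forall z x y, z \in s -> A x -> V z x -> B y -> `|F x y - F z y| <= e].
Proof.
move=> cF cB cK KA e e0.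
pose V z := [set x | A x -> forall y, B y -> `|F x y - F z y| < e]°.
have oV z : open (V z) by exact: open_interior.
have KV z : K z -> nbhs z (V z).
  by move=> Kz; apply: nbhs_interior; apply: (jointly_uniform cF cB) => //; exact: KA.
have [s [sK Ks]] := compact_finite_subcover cK KV.
exists s, V; split => // z x y zs Ax /interior_subset zx By; exact/ltW/zx.
Qed.

Lemma jointly_continuous_measurable {p : X} {q : Y} A B F K :
  jointly_continuous_on A B F ->
  compact B -> measurable (B : set (borel q)) ->
  compact K -> measurable (K : set (borel p)) -> K `<=` A ->
  bounded_measurable ((K : set (borel p)) `*` (B : set (borel q)))
    (fun z => F z.1 z.2).
Proof.
move=> cF cB mB cK mK KA; split; last first.
  have cKB : compact (K `*` B) by exact: compact_setX.
  apply: (compact_within_bounded cKB).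
  exact: jointly_continuousS cF.
apply: (@piecewise_measurable _ _ (borel p) (borel q) R K B F) => // e e0.
have [s [V [sK oV KV Fe]]] := compact_net cF cB cK KA e0.
exists s, V; split => //.
- by move=> z; exact: open_borel.
- move=> z zs; apply: within_continuous_measurable => //.
  exact: (jointly_continuousr cF (KA _ (sK _ zs))).
- by move=> z x y zs Kx zx By; apply: Fe => //; exact: KA.
Qed.

End joint_continuity_compact.

(** * Relative kernels *)

Section boundary.
Context {T : topologicalType}.
Implicit Types U : set T.

Lemma closed_boundary U : closed (boundary U).
Proof.
by apply: closedI; [exact: closed_closure|exact/open_closedC/open_interior].
Qed.

Lemma compact_boundary U : compact (closure U) -> compact (boundary U).
Proof.
move=> cU; have sub : boundary U `<=` closure U by move=> x [].
exact (subclosed_compact (@closed_boundary U) cU sub).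
Qed.

Lemma boundary_sub U W : closure U `<=` W -> boundary U `<=` W.
Proof. by move=> UW x [/UW]. Qed.

End boundary.

Section kernel.
Context {R : realType} {X : metricType R} {p : X}.
Variables (DD : set (set X)) (omega : set X -> X -> probability (borel p) R).
Hypothesis hDD : harmonic_framework DD omega.

Lemma measurable_boundary (U : set X) : measurable (boundary U : set (borel p)).
Proof. by apply: closed_borel; exact: closed_boundary. Qed.
#[local] Hint Resolve measurable_boundary : core.

Section relative_kernel.
Variables (U : set X) (x0 : X) (k : X -> X -> R).
Hypotheses (DU : DD U) (rU : regular U (omega U)) (cU : compact (closure U)).
Hypotheses (Ux0 : U x0) (rk : relative_kernel omega U x0 k).
Hypothesis jk : jointly_continuous U k.

Let hU : harmonic_measure U (omega U).
Proof. by have [] := framework_measure hDD DU. Qed.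

Let cbU : compact (boundary U). Proof. exact: compact_boundary. Qed.

Lemma kernel_bounded_borel x : U x -> bounded_borel (p := p) (boundary U) (k x).
Proof.
by move=> Ux; apply: compact_bounded_measurable => //;
  exact: (jointly_continuousr jk).
Qed.

Lemma kernel_integral x f : U x -> bounded_borel (p := p) (boundary U) f ->
  \int[omega U x]_(y in boundary U) f y =
  \int[omega U x0]_(y in boundary U) (f y * k x y).
Proof.
move=> Ux bf; have xx0 : omega U x `<< omega U x0 by exact: hU.2.
rewrite /Rintegral; congr fine.
rewrite -(Radon_Nikodym_change_of_variables xx0)//; last first.
  exact: bounded_measurable_integrable.
apply: ae_eq_integral => //.
- apply: emeasurable_funM; first by apply/measurable_EFinP; case: bf.
  exact: measurable_funTS.
- by apply/measurable_EFinP;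
    exact: (bounded_measurableM bf (kernel_bounded_borel Ux)).1.
- under [X in ae_eq _ _ _ X]eq_fun do rewrite EFinM.
  exact/ae_eqe_mul2l/ae_eq_sym/(rk Ux).
Qed.

(** The harmonic measure of a regular domain charges every neighbourhood of
    every boundary point: seen from nearby points its mass tends to one. *)
Lemma regular_full_support zeta (W : set X) : boundary U zeta ->
  open W -> W zeta -> (0 < omega U x0 (boundary U `&` W))%E.
Proof.
move=> Uz oW Wz; rewrite lt0e measure_ge0 andbT; apply/negP => /eqP W0.
have mW : measurable (W : set (borel p)) by exact: open_borel.
have bW : bounded_borel (p := p) (boundary U) (\1_W : X -> R).
  exact: bounded_measurable_indic.
have cW : (\1_W y : R) @[y --> within (boundary U) (nbhs zeta)] --> (\1_W zeta : R).
  apply: cvg_near_cst; apply: filterS (open_nbhs_nbhs (conj oW Wz)) => y Wy _.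
  by rewrite !indicE !mem_set.
have zero x : U x -> \int[omega U x]_(y in boundary U) (\1_W y) = 0.
  move=> Ux; have /null_content_dominatesP xx0 : omega U x `<< omega U x0.
    exact: hU.2.
  have := xx0 _ (measurableI _ _ (measurable_boundary U) mW) W0.
  by rewrite /Rintegral integral_indic// setIC => W0'; exact: (congr1 fine W0').
have := rU Uz bW cW; rewrite indicE mem_set//= => c1.
have wU : ProperFilter (within U (nbhs zeta)).
  by apply: within_nbhs_proper; have [] := Uz.
have c0 : \int[omega U x]_(y in boundary U) (\1_W y)
    @[x --> within U (nbhs zeta)] --> (0 : R).
  by apply: cvg_near_cst; rewrite near_withinE; apply: nearW => x /zero.
have : (1 : R) = 0 by apply: (cvg_unique _ c1 c0).
by move/eqP; rewrite oner_eq0.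
Qed.

(** A continuous function that is negative at a boundary point is negative on a
    neighbourhood, which the harmonic measure charges. Together with
    [kernel_integral], this turns identities between harmonic measures into
    identities between kernels that hold at every boundary point. *)
Lemma integrals_ge0 (a : X -> R) : {within boundary U, continuous a} ->
  (forall B : set (borel p), measurable B ->
    0 <= \int[omega U x0]_(y in boundary U) (\1_B y * a y)) ->
  forall y, boundary U y -> 0 <= a y.
Proof.
move=> ca aB y Uy; rewrite leNgt; apply/negP => ay.
have [W oW Wa] : exists2 W, open W &
    boundary U `&` a @^-1` [set r | r < a y / 2] = boundary U `&` W.
  by apply: within_continuous_preimage => //; exact: open_lt.
have Wy : W y.
  have : (boundary U `&` a @^-1` [set r | r < a y / 2]) y.
    by split => //=; lra.
  by rewrite Wa => -[].
have mW : measurable (W : set (borel p)) by exact: open_borel.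
have ba : bounded_measurable (boundary U : set (borel p)) a.
  exact: compact_bounded_measurable.
have := aB _ mW; apply/negP; rewrite -ltNge.
apply: (@le_lt_trans _ _
    (\int[omega U x0]_(z in boundary U) (a y / 2 * \1_W z))).
  apply: le_bmRintegral => //.
  - by apply: bounded_measurableM => //; exact: bounded_measurable_indic.
  - apply: bounded_measurableZ.
    exact: bounded_measurable_indic.
  move=> z Uz; rewrite indicE.
  case: (boolP (z \in W)) => [|_]; last by rewrite mul0r mulr0.
  rewrite inE mul1r mulr1 => Wz.
  have : (boundary U `&` W) z by [].
  by rewrite -Wa => -[_ /= /ltW].
rewrite bmRintegralZl//; last exact: bounded_measurable_indic.
rewrite nmulr_rlt0; last by lra.
rewrite /Rintegral integral_indic// setIC fine_gt0//.
rewrite (regular_full_support Uy)//=.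
by rewrite -ge0_fin_numE// fin_num_measure//; exact: measurableI.
Qed.

Lemma eq_integrals (a b : X -> R) : {within boundary U, continuous a} ->
  {within boundary U, continuous b} ->
  (forall B : set (borel p), measurable B ->
    \int[omega U x0]_(y in boundary U) (\1_B y * a y) =
    \int[omega U x0]_(y in boundary U) (\1_B y * b y)) ->
  forall y, boundary U y -> a y = b y.
Proof.
move=> ca cb ab y Uy.
suff ge (a' b' : X -> R) : {within boundary U, continuous a'} ->
    {within boundary U, continuous b'} ->
    (forall B : set (borel p), measurable B ->
      \int[omega U x0]_(y in boundary U) (\1_B y * a' y) =
      \int[omega U x0]_(y in boundary U) (\1_B y * b' y)) -> b' y <= a' y.
  apply/eqP; rewrite eq_le !ge// => B mB.
  by rewrite ab.
move=> ca' cb' ab'; rewrite -subr_ge0.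
apply: (@integrals_ge0 (fun y => a' y - b' y)) => //.
  by move=> z; apply: cvgB; [exact: ca'|exact: cb'].
move=> B mB; under eq_Rintegral do rewrite mulrBr.
have b1 : bounded_measurable (boundary U : set (borel p)) (\1_B : X -> R).
  exact: bounded_measurable_indic.
rewrite bmRintegralB//; last 2 first.
- by apply: bounded_measurableM => //; exact: compact_bounded_measurable.
- by apply: bounded_measurableM => //; exact: compact_bounded_measurable.
by rewrite ab'// subrr.
Qed.

Lemma kernel_ge0 x y : U x -> boundary U y -> 0 <= k x y.
Proof.
move=> Ux; apply: integrals_ge0; first exact: (jointly_continuousr jk).
move=> B mB; rewrite -kernel_integral//; last exact: bounded_measurable_indic.
by apply: Rintegral_ge0 => z _; rewrite indicE.
Qed.

Lemma kernel_base y : boundary U y -> k x0 y = 1.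
Proof.
apply: (@eq_integrals _ (fun=> 1)).
- exact: (jointly_continuousr jk).
- by move=> z; exact: cvg_cst.
move=> B mB; rewrite -kernel_integral//; last exact: bounded_measurable_indic.
by apply: eq_Rintegral => z _; rewrite mulr1.
Qed.

Lemma harmonic_measure_boundary x (W : set X) : DD W -> W x ->
  omega W x (boundary W) = 1%E.
Proof. by move=> DW Wx; have [[h _] _ _] := framework_measure hDD DW; exact: h. Qed.

(** Testing against functions of the boundary point, the mean value property of
    the kernel is the consistency of the harmonic measures of the two domains;
    the two sides are continuous, and the harmonic measure has full support. *)
Lemma kernel_harmonic y : boundary U y -> harmonic_on DD omega U (k^~ y).
Proof.
move=> Uy; split; first exact: (jointly_continuousl jk).
move=> V DV rV [cV VU] x Vx.
have Ux : U x by apply: VU; exact: subset_closure.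
have VU' : boundary V `<=` U by exact: boundary_sub.
have cbV : compact (boundary V) by exact: compact_boundary.
have bk : bounded_measurable ((boundary V : set (borel p)) `*`
    (boundary U : set (borel p))) (fun z => k z.1 z.2).
  exact: (jointly_continuous_measurable (jk : jointly_continuous_on _ _ _)).
move: y Uy; apply: eq_integrals; first exact: (jointly_continuousr jk).
  apply/subspace_continuousP => y Uy; apply/cvgrPdist_le => e e0.
  have jk' : jointly_continuous_on (boundary U) U (fun y x => k x y).
    exact: jointly_continuous_swap.
  have jkV : jointly_continuous_on (boundary U) (boundary V) (fun y x => k x y).
    exact: jointly_continuousS jk'.
  have := jointly_uniform jkV cbV Uy e0.
  rewrite near_withinE; apply: filterS => y' hy' Uy'.
  have bk' z : boundary U z ->
      bounded_measurable (boundary V : set (borel p)) (k^~ z).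
    move=> Uz; apply: compact_bounded_measurable => //.
    exact: (jointly_continuousr jkV).
  rewrite -bmRintegralB//; [|exact: bk'|exact: bk'].
  rewrite -[e]mulr1 -[X in _ <= _ * X](congr1 fine
    (harmonic_measure_boundary DV Vx)).
  apply: le_norm_bmRintegral_cst => //.
    exact: (bounded_measurableB (bk' _ Uy) (bk' _ Uy')).1.
  by move=> z Vz; rewrite distrC ltW// hy'.
move=> B mB.
have bB : bounded_borel (p := p) (boundary U) (\1_B : X -> R).
  exact: bounded_measurable_indic.
rewrite -kernel_integral//.
rewrite (framework_consistent hDD DU DV)//.
transitivity (\int[omega V x]_(z in boundary V)
    \int[omega U x0]_(y in boundary U) (\1_B y * k z y)).
  by apply: eq_Rintegral => z; rewrite inE => Vz; rewrite kernel_integral//; exact: VU'.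
have bBk : bounded_measurable ((boundary V : set (borel p)) `*`
    (boundary U : set (borel p))) (fun z => \1_B z.2 * k z.1 z.2).
  apply: bounded_measurableM => //; split.
    apply: measurable_funTS.
    by apply: (measurableT_comp (measurable_indic mB)).
  by exists 1 => z _; rewrite indicE; case: (_ \in _); rewrite ?normr1 ?normr0.
have [_ ->] := @bounded_Fubini _ _ (borel p) (borel p) R (omega V x)
  (omega U x0) _ _ (fun z y => \1_B y * k z y) (measurable_boundary V)
  (measurable_boundary U) bBk.
apply: eq_Rintegral => y; rewrite inE => Uy.
rewrite bmRintegralZl//; apply: compact_bounded_measurable => //.
apply: (jointly_continuousl (B := boundary U)) => //.
exact: (jointly_continuousS VU' _ (jk : jointly_continuous_on _ _ _)).
Qed.

(** Harnack estimates: a harmonic function near the closure of [U] is the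
    average of the kernel against its own boundary values. *)
Section harnack.
Variables (W : set X) (v : X -> R).
Hypotheses (UW : closure U `<=` W) (hv : harmonic_on DD omega W v).

Lemma harmonic_boundary_bounded : bounded_borel (p := p) (boundary U) v.
Proof.
apply: compact_bounded_measurable => //.
by apply: continuous_subspaceW hv.1; exact: boundary_sub.
Qed.

Lemma harmonic_representation x : U x ->
  v x = \int[omega U x0]_(y in boundary U) (v y * k x y).
Proof.
move=> Ux; rewrite -kernel_integral//; last exact: harmonic_boundary_bounded.
exact: hv.2.
Qed.

Lemma harmonic_base : v x0 = \int[omega U x0]_(y in boundary U) v y.
Proof. exact: hv.2. Qed.

Hypothesis v0 : forall x, W x -> 0 <= v x.

Lemma harnack_bound x M : U x -> (forall y, boundary U y -> k x y <= M) ->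
  v x <= M * v x0.
Proof.
move=> Ux kM; rewrite (harmonic_representation Ux) harmonic_base.
have bv := harmonic_boundary_bounded.
rewrite -bmRintegralZl//; apply: le_bmRintegral => //.
- by apply: bounded_measurableM => //; exact: kernel_bounded_borel.
- exact: bounded_measurableZ.
- move=> y Uy; rewrite mulrC ler_wpM2r ?kM// v0//.
  exact: (boundary_sub UW).
Qed.

Lemma harnack_modulus x x' e : U x -> U x' ->
  (forall y, boundary U y -> `|k x y - k x' y| <= e) ->
  `|v x - v x'| <= e * v x0.
Proof.
move=> Ux Ux' ke; rewrite !harmonic_representation//.
have bv := harmonic_boundary_bounded.
have bvk z : U z -> bounded_measurable (boundary U : set (borel p))
    (fun y => v y * k z y).
  by move=> Uz; apply: bounded_measurableM => //; exact: kernel_bounded_borel.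
rewrite -bmRintegralB//; [|exact: bvk|exact: bvk].
rewrite -[\int[_]_(_ in _) (v _ * k x0 _)]harmonic_representation//.
rewrite harmonic_base -bmRintegralZl//; apply: le_norm_bmRintegral => //.
- by apply: bounded_measurableB; exact: bvk.
- exact: bounded_measurableZ.
- move=> y Uy; have vy : 0 <= v y by apply: v0; exact: (boundary_sub UW).
  by rewrite -mulrBr normrM (ger0_norm vy) mulrC ler_wpM2r// ke.
Qed.

End harnack.
End relative_kernel.
End kernel.

(** * Exhaustions and normal families of positive harmonic functions *)

(** Exhausting sequences of regular domains with their kernels are stable under
    passing to subsequences, see [exhaustion_subsequence]. *)
Record kernel_exhaustion {R : realType} {X : metricType R} {p : X}
    (DD : set (set X)) (omega : set X -> X -> probability (borel p) R) (x0 : X)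
    (D : set X) (E : nat -> set X) (kk : nat -> X -> X -> R) : Prop :=
    KernelExhaustion {
  exhaustion_union : \bigcup_n E n = D ;
  exhaustion_member : forall n, DD (E n) ;
  exhaustion_regular : forall n, regular (E n) (omega (E n)) ;
  exhaustion_step : forall n, compactly_contained (E n) (E n.+1) ;
  exhaustion_base : forall n, E n x0 ;
  exhaustion_kernel : forall n, relative_kernel omega (E n) x0 (kk n) ;
  exhaustion_continuous : forall n, jointly_continuous (E n) (kk n)
}.

Section exhaustion.
Context {R : realType} {X : metricType R} {p : X}.
Variables (DD : set (set X)) (omega : set X -> X -> probability (borel p) R).
Hypothesis hDD : harmonic_framework DD omega.
Variables (D : set X) (E : nat -> set X) (x0 : X) (kk : nat -> X -> X -> R).
Hypothesis hE : kernel_exhaustion DD omega x0 D E kk.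

Let DE := exhaustion_member hE.
Let rE := exhaustion_regular hE.
Let EE := exhaustion_step hE.
Let Ex0 := exhaustion_base hE.
Let rk := exhaustion_kernel hE.
Let jk := exhaustion_continuous hE.

Lemma inD x : D x <-> exists n, E n x.
Proof. by rewrite -(exhaustion_union hE); split => [[n _ nx]|[n nx]]; exists n. Qed.

Lemma exhaustion_open n : open (E n).
Proof. by have [[]] := framework_domain hDD (DE n). Qed.

Lemma exhaustion_closure m n : (m < n)%N -> closure (E m) `<=` E n.
Proof.
elim: n => // n IH; rewrite ltnS leq_eqVlt => /predU1P[->|mn].
  exact: (EE n).2.
move=> x /(IH mn) nx; apply: (EE n).2; exact: subset_closure.
Qed.

Lemma exhaustion_sub m n : (m <= n)%N -> E m `<=` E n.
Proof.
rewrite leq_eqVlt => /predU1P[->//|mn] x mx.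
by apply: (exhaustion_closure mn); exact: subset_closure.
Qed.

Lemma exhaustion_boundary m n : (m < n)%N -> boundary (E m) `<=` E n.
Proof. by move=> mn; apply: boundary_sub; exact: exhaustion_closure. Qed.

Lemma exhaustion_compact (K : set X) : compact K -> K `<=` D ->
  exists m, K `<=` E m.
Proof.
move=> cK KD.
have /choice[m mP] : forall x, exists m, K x -> E m x.
  move=> x; case: (pselect (K x)) => [/KD/inD[m mx]|nK]; first by exists m.
  by exists 0%N.
have [x Kx|s [_ Ks]] := compact_finite_subcover (V := fun x => E (m x)) cK.
  by apply: open_nbhs_nbhs; split; [exact: exhaustion_open|exact: mP].
exists (\max_(z <- s) m z)%N => x /Ks[z zs zx].
exact: (exhaustion_sub (leq_bigmax_seq _ zs isT)) zx.
Qed.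

Lemma harmonic_onS (W W' : set X) v : W' `<=` W -> harmonic_on DD omega W v ->
  harmonic_on DD omega W' v.
Proof.
move=> WW [cv hv]; split; first exact: continuous_subspaceW cv.
move=> V DV rV [cV VW]; apply: hv => //; split=> //.
exact: subset_trans VW WW.
Qed.

(** These properties are shared by the kernels [kk n ^~ y] and by the normalized
    positive harmonic functions on [D], which are all compared through
    Harnack estimates on the inner domains. *)
Definition admissible n (v : X -> R) :=
  [/\ harmonic_on DD omega (E n) v, forall x, E n x -> 0 <= v x & v x0 = 1].

Lemma kernel_admissible n y : boundary (E n) y -> admissible n (kk n ^~ y).
Proof.
move=> ny; split.
- exact (kernel_harmonic hDD (DE n) (@rE n) (EE n).1 (Ex0 n) (@rk n) (@jk n) ny).
- move=> x nx.
  exact: (kernel_ge0 hDD (DE n) (@rE n) (EE n).1 (Ex0 n) (@rk n) (@jk n) nx ny).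
- exact: (kernel_base hDD (DE n) (@rE n) (EE n).1 (Ex0 n) (@rk n) (@jk n) ny).
Qed.

Lemma positive_harmonic_admissible h n : positive_harmonic DD omega D h ->
  h x0 = 1 -> admissible n h.
Proof.
move=> [hh h0] h1; have ED : E n `<=` D by move=> x nx; apply/inD; exists n.
split => //; first exact: harmonic_onS hh.
by move=> x /ED /h0 /ltW.
Qed.

Lemma harmonic_mean v m n : (m < n)%N -> harmonic_on DD omega (E n) v ->
  forall x, E m x -> bounded_borel (p := p) (boundary (E m)) v /\
    v x = \int[omega (E m) x0]_(y in boundary (E m)) (v y * kk m x y).
Proof.
move=> mn hv x mx; split.
  exact: (harmonic_boundary_bounded (EE m).1 (exhaustion_closure mn) hv).
exact: (harmonic_representation hDD (DE m) (@rE m) (EE m).1 (Ex0 m) (@rk m)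
  (@jk m) (exhaustion_closure mn) hv).
Qed.

Lemma harmonic_mass n v : harmonic_on DD omega (E n.+1) v ->
  \int[omega (E n) x0]_(y in boundary (E n)) v y = v x0.
Proof.
move=> hv; apply/esym; exact: (harmonic_base (DE n) (@rE n) (EE n).1 (Ex0 n)
  (exhaustion_closure (ltnSn n)) hv).
Qed.

(** When [v] is admissible, [v y] times the harmonic measure at [x0] is a
    probability on the boundary of [E n], and [v z] is the mean of the kernel
    at [z] under it. *)
Definition kernel_variance n z (v : X -> R) :=
  \int[omega (E n) x0]_(y in boundary (E n)) ((kk n z y - v z) ^+ 2 * v y).

Lemma kernel_varianceE n z v : admissible n.+1 v -> E n z ->
  kernel_variance n z v =
  \int[omega (E n) x0]_(y in boundary (E n)) (kk n z y ^+ 2 * v y) - v z ^+ 2.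
Proof.
move=> [hv _ v1] nz; have mb := @measurable_boundary _ _ p (E n).
have [bv vz] := harmonic_mean (ltnSn n) hv nz; have mass := harmonic_mass hv.
have bk : bounded_measurable (boundary (E n) : set (borel p)) (kk n z).
  exact: (kernel_bounded_borel (EE n).1 (@jk n) nz).
have bvk : bounded_measurable (boundary (E n) : set (borel p))
    (fun y => v y * kk n z y) by exact: bounded_measurableM.
have bkkv : bounded_measurable (boundary (E n) : set (borel p))
    (fun y => kk n z y ^+ 2 * v y).
  by apply: bounded_measurableM => //; exact: bounded_measurable_sqr.
rewrite /kernel_variance.
transitivity (\int[omega (E n) x0]_(y in boundary (E n)) ((kk n z y ^+ 2 * v y -
    (2 * v z) * (v y * kk n z y)) + v z ^+ 2 * v y)).
  by apply: eq_Rintegral => y _; ring.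
rewrite bmRintegralD ?bmRintegralB ?bmRintegralZl//; try exact: bounded_measurableZ.
  by rewrite -vz mass v1; ring.
by apply: bounded_measurableB => //; exact: bounded_measurableZ.
Qed.

Lemma kernel_variance_ge0 n z v : admissible n.+1 v -> 0 <= kernel_variance n z v.
Proof.
move=> [_ v0 _]; apply: Rintegral_ge0 => y ny; rewrite mulr_ge0 ?sqr_ge0// v0//.
exact: (exhaustion_boundary (ltnSn n)).
Qed.

(** Representing [v] by the kernel of [E m] transfers the modulus of continuity
    of that kernel to all admissible functions at once. *)
Lemma admissible_modulus m n v x x' e : (m < n)%N -> admissible n v ->
  E m x -> E m x' ->
  (forall y, boundary (E m) y -> `|kk m x y - kk m x' y| <= e) ->
  `|v x - v x'| <= e.
Proof.
move=> mn [hv v0 v1] mx mx' ke; rewrite -[e]mulr1 -v1.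
exact: (harnack_modulus hDD (DE m) (@rE m) (EE m).1 (Ex0 m) (@rk m) (@jk m)
  (exhaustion_closure mn) hv v0).
Qed.

Lemma admissible_bound m : exists M, forall n v x, (m.+1 < n)%N ->
  admissible n v -> E m x -> `|v x| <= M.
Proof.
have cK : compact (closure (E m) `*` boundary (E m.+1)).
  by apply: compact_setX; [exact: (EE m).1|exact: (compact_boundary (EE m.+1).1)].
have jK : jointly_continuous_on (closure (E m)) (boundary (E m.+1)) (kk m.+1).
  apply: (jointly_continuousS _ _ (@jk m.+1 : jointly_continuous_on _ _ _)) => //.
  exact: (EE m).2.
have [M MP] := compact_within_bounded cK jK.
exists M => n v x mn av mx; have [hv v0 v1] := av.
have m1x : E m.+1 x by exact: (exhaustion_sub (leqnSn m)).
rewrite ger0_norm; last by apply: v0; exact: (exhaustion_sub (ltnW mn)).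
rewrite -[M]mulr1 -v1.
apply: (harnack_bound hDD (DE m.+1) (@rE m.+1) (EE m.+1).1 (Ex0 m.+1)
  (@rk m.+1) (@jk m.+1) (exhaustion_closure mn) hv v0) => // y my.
apply: le_trans (ler_norm _) _; apply: (MP (x, y)).
by split => //; exact: subset_closure.
Qed.

Lemma admissible_net m e : 0 < e -> exists s : seq X,
  (forall z, z \in s -> E m.+1 z) /\
  forall x, E m x -> exists2 z, z \in s &
    forall n v, (m.+1 < n)%N -> admissible n v -> `|v x - v z| <= e.
Proof.
move=> e0.
have [s [V [sK _ KV Ve]]] := compact_net (@jk m.+1 : jointly_continuous_on _ _ _)
  (compact_boundary (EE m.+1).1) (EE m).1 (EE m).2 e0.
exists s; split; first by move=> z /sK; exact: (EE m).2.
move=> x mx; have [z zs zx] := KV x (subset_closure mx).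
have m1x : E m.+1 x by exact: (exhaustion_sub (leqnSn m)).
exists z => // n v mn av; apply: (admissible_modulus mn av) => //.
  by apply: (EE m).2; exact: sK.
by move=> y my; exact: Ve.
Qed.

Lemma exhaustion_open_union : open D.
Proof.
rewrite -(exhaustion_union hE); apply: bigcup_open => n _; exact: exhaustion_open.
Qed.

(** The limit has no zero: otherwise it would vanish almost everywhere on the
    boundary of an inner domain, hence at the base point, where it is 1. *)
Lemma admissible_limit (n_ : nat -> nat) (v_ : nat -> X -> R) (h : X -> R) :
  (forall j, (j <= n_ j)%N) -> (forall j, admissible (n_ j) (v_ j)) ->
  (forall m e, 0 < e -> exists J, forall j x, (J <= j)%N -> E m x ->
    `|v_ j x - h x| <= e) ->
  positive_harmonic DD omega D h /\ h x0 = 1.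
Proof.
move=> n_ge av vh.
have vhx m x : E m x -> v_ j x @[j --> \oo] --> h x.
  move=> mx; apply/cvgrPdist_le => e e0; have [J JP] := vh m e e0.
  by exists J => // j Jj; rewrite distrC; apply: JP mx.
have h1 : h x0 = 1.
  apply: (cvg_unique _ (vhx 0%N x0 (Ex0 0%N))) => //.
  by apply: cvg_near_cst; apply: nearW => j; have [] := av j.
have h0 x : D x -> 0 <= h x.
  move=> /inD[m mx]; rewrite -(cvg_lim _ (vhx m x mx))//; apply: limr_ge.
    by apply/cvg_ex; eexists; exact: (vhx m x mx).
  exists m => // j mj; have [_ v0 _] := av j; apply: v0.
  exact: (exhaustion_sub (leq_trans mj (n_ge j))).
have ch m : {within E m, continuous h}.
  apply/subspace_continuousP => x mx; apply/cvgrPdist_le => e e0.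
  have := jointly_uniform (@jk m : jointly_continuous_on _ _ _)
    (compact_boundary (EE m).1) mx e0.
  rewrite near_withinE; apply: filterS => x' ke mx'.
  have : `|v_ j x - v_ j x'| @[j --> \oo] --> `|h x - h x'|.
    by apply: cvg_norm; apply: cvgB; apply: vhx; eassumption.
  move=> vv; rewrite -(cvg_lim _ vv)//; apply: limr_le.
    by apply/cvg_ex; eexists; exact: vv.
  exists m.+1 => // j mj.
  apply: (admissible_modulus (leq_trans mj (n_ge j)) (av j) mx mx') => y my.
  by rewrite distrC ltW// ke.
have hh : harmonic_on DD omega D h.
  split.
    rewrite continuous_open_subspace; last exact: exhaustion_open_union.
    move=> x; rewrite inE => /inD[m mx].
    have := ch m; rewrite continuous_open_subspace; last exact: exhaustion_open.
    by apply; rewrite inE.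
  move=> V DV rV [cV VD] x Vx.
  have [m Vm] := exhaustion_compact cV VD.
  have mx : E m x by apply: Vm; exact: subset_closure.
  apply/eqP; rewrite -subr_eq0 -normr_le0; apply/ler_addgt0Pr => e e0.
  have e2 : 0 < e / 2 by rewrite divr_gt0.
  have [J JP] := vh m _ e2; pose j := maxn J m.
  have [[cv hv] _ _] := av j.
  have mj : E m `<=` E (n_ j).
    by apply: exhaustion_sub; exact: leq_trans (leq_maxr _ _) (n_ge j).
  have Vj : compactly_contained V (E (n_ j)).
    by split => //; exact: subset_trans Vm mj.
  have VE : boundary V `<=` E m by exact: boundary_sub.
  have cbV : compact (boundary V) by exact: compact_boundary.
  have mbV : measurable (boundary V : set (borel p)) by exact: measurable_boundary.
  have bh : bounded_measurable (boundary V : set (borel p)) h.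
    by apply: compact_bounded_measurable => //; exact: continuous_subspaceW (ch m).
  have bv : bounded_measurable (boundary V : set (borel p)) (v_ j).
    apply: compact_bounded_measurable => //.
    by apply: continuous_subspaceW cv; exact: subset_trans VE mj.
  have T1 := JP j x (leq_maxl _ _) mx.
  have T2 : `|\int[omega V x]_(y in boundary V) v_ j y -
      \int[omega V x]_(y in boundary V) h y| <= e / 2.
    rewrite -bmRintegralB// -[leRHS]mulr1 -[X in _ <= _ * X](congr1 fine
      (harmonic_measure_boundary hDD DV Vx)).
    apply: le_norm_bmRintegral_cst => //.
      exact: (bounded_measurableB bv bh).1.
    by move=> y Vy; apply: JP; [exact: leq_maxl|exact: VE].
  move: T2; rewrite -hv// add0r; move: T1; rewrite !ler_norml.
  by move=> /andP[? ?] /andP[? ?]; apply/andP; split; lra.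
split; last exact: h1.
split=> // x Dx; rewrite lt_neqAle h0// andbT; apply/eqP => /esym hx0.
have /inD[m mx] := Dx.
have EmD : closure (E m) `<=` D.
  by move=> z mz; apply/inD; exists m.+1; exact: (EE m).2.
have mb := @measurable_boundary _ _ p (E m).
have bh : bounded_measurable (boundary (E m) : set (borel p)) h.
  apply: compact_bounded_measurable => //; first exact/compact_boundary/(EE m).1.
  by apply: continuous_subspaceW hh.1; exact: boundary_sub.
have hm z : E m z -> h z = \int[omega (E m) z]_(y in boundary (E m)) h y.
  by apply: hh.2; [exact: DE|exact: rE|split => //; exact: (EE m).1].
have : (\int[omega (E m) x]_(y in boundary (E m)) `|(h y)%:E| = 0)%E.
  rewrite -[RHS](congr1 EFin hx0) (hm x mx) Rintegral_EFin//.
  apply: eq_integral => y; rewrite inE => my; rewrite gee0_abs// lee_fin.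
  by apply: h0; apply: EmD; case: my.
move=> /ae_eq_integral_abs; rewrite -/mb => /(_ mb) ae0.
have {ae0} : ae_eq (omega (E m) x) (boundary (E m)) (EFin \o h) (cst 0%E).
  by apply/ae0/measurable_EFinP; case: bh.
move=> [N [mN N0 hN]].
have N0' : omega (E m) x0 N = 0%E.
  have [[_ hd] _ _] := framework_measure hDD (DE m).
  have /null_content_dominatesP := hd _ _ (Ex0 m) mx.
  exact.
have : h x0 = 0.
  rewrite (hm x0 (Ex0 m)).
  rewrite -(@bmRintegral_setC0 _ _ _ (omega (E m) x0) _ N)//.
  rewrite -[RHS](Rintegral_set0 (omega (E m) x0) h).
  rewrite [RHS]Rintegral_mkcond [LHS]Rintegral_mkcond.
  apply: eq_Rintegral => y _; rewrite !patchE in_set0.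
  case: ifPn => //; rewrite inE => -[my Ny].
  apply/eqP; apply: contrapT => hy; apply: Ny; apply: hN => /(_ my) /=.
  by move=> [/eqP].
by rewrite h1 => /eqP; rewrite oner_eq0.
Qed.

(** Finite nets that are fine enough for all admissible functions
    simultaneously: such functions are compared through their values at
    countably many points. *)
Lemma exists_nets : exists net : nat -> nat -> seq X,
  (forall m l z, z \in net m l -> E m.+1 z) /\
  forall m l x, E m x -> exists2 z, z \in net m l &
    forall n v, (m.+1 < n)%N -> admissible n v -> `|v x - v z| <= l.+1%:R^-1.
Proof.
have /choice[f fP] : forall ml : nat * nat, exists s : seq X,
    (forall z, z \in s -> E ml.1.+1 z) /\
    forall x, E ml.1 x -> exists2 z, z \in s & forall n v, (ml.1.+1 < n)%N ->
      admissible n v -> `|v x - v z| <= ml.2.+1%:R^-1.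
  by move=> [m l]; apply: admissible_net; rewrite invr_gt0.
exists (fun m l => f (m, l)); split=> m l; first exact: (fP (m, l)).1.
exact: (fP (m, l)).2.
Qed.

Section nets.
Variable net : nat -> nat -> seq X.
Hypothesis net_sub : forall m l z, z \in net m l -> E m.+1 z.
Hypothesis netP : forall m l x, E m x -> exists2 z, z \in net m l &
  forall n v, (m.+1 < n)%N -> admissible n v -> `|v x - v z| <= l.+1%:R^-1.

Lemma net_close m l n n' v v' (e : R) : (m.+1 < n)%N -> (m.+1 < n')%N ->
  admissible n v -> admissible n' v' ->
  (forall z, z \in net m l -> `|v z - v' z| <= e) ->
  forall x, E m x -> `|v x - v' x| <= l.+1%:R^-1 + l.+1%:R^-1 + e.
Proof.
move=> mn mn' av av' ve x mx; have [z zs zx] := netP l mx.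
have h1 := zx _ _ mn av; have h2 := zx _ _ mn' av'; have h3 := ve z zs.
move: (l.+1%:R^-1) h1 h2 h3 => a; rewrite !ler_norml.
by move=> /andP[? ?] /andP[? ?] /andP[? ?]; apply/andP; split; lra.
Qed.

Lemma net_determines h h' : (forall n, admissible n h) ->
  (forall n, admissible n h') ->
  (forall m l z, z \in net m l -> h z = h' z) -> forall x, D x -> h x = h' x.
Proof.
move=> ah ah' hh' x /inD[m mx]; apply/eqP; rewrite -subr_eq0 -normr_le0.
apply/ler_addgt0Pr => e e0; rewrite add0r.
have e2 : 0 < e / 2 by rewrite divr_gt0.
have [l _ lP] := near_infty_natSinv_lt (PosNum e2).
have hz z : z \in net m l -> `|h z - h' z| <= 0.
  by move=> zs; rewrite (hh' m l z zs) subrr normr0.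
have := net_close (ltnSn _) (ltnSn _) (ah _) (ah' _) hz mx; rewrite addr0.
have /= := lP l (leqnn l); move: (l.+1%:R^-1) => a.
by move=> ae ha; apply: (le_trans ha); lra.
Qed.

(** If [h] is a proper convex combination of [f] and [g], these differ at some
    point [z] of the nets. The second moment of the kernel at [z] is linear in the
    harmonic function, and the square of the mean is strictly convex: the
    variance of [h] at [z] is at least [t (1 - t) (f z - g z) ^ 2] on every
    inner domain. *)
Lemma extreme_of_no_variance h : positive_harmonic DD omega D h -> h x0 = 1 ->
  (forall m l z, z \in net m l -> forall (e : R) N, 0 < e ->
    exists n, (N <= n)%N /\ kernel_variance n z h <= e) ->
  extreme_harmonic DD omega (D := D) x0 (sigL D h).
Proof.
move=> hh h1 no_var; split; first by exists h.
move=> _ _ t [f [hf f1] <-] [g [hg g1] <-] /andP[t0 t1] hE'.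
have hfg x : D x -> h x = t * f x + (1 - t) * g x.
  by move=> Dx; have := congr1 (fun F => F (SigSub (mem_set Dx))) hE'.
suff fg x : D x -> f x = g x.
  by split; apply/funext => -[x /= xD]; have Dx := set_mem xD;
    rewrite /sigL/= hfg// fg//; ring.
have adm := positive_harmonic_admissible.
apply: net_determines => [n|n|m l z zs]; [exact: adm|exact: adm|].
have Dz : D z by apply/inD; exists m.+1; exact: net_sub zs.
apply/eqP; rewrite -subr_eq0; apply: contrapT => /negP fgz.
have gap0 : 0 < t * (1 - t) * (f z - g z) ^+ 2.
  apply: mulr_gt0; first by apply: mulr_gt0 => //; rewrite subr_gt0.
  by rewrite exprn_even_gt0//= fgz.
have e0 : 0 < t * (1 - t) * (f z - g z) ^+ 2 / 2 by rewrite divr_gt0.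
have [n [mn]] := no_var m l z zs _ m.+2 e0; apply/negP; rewrite -ltNge.
have nz : E n z by exact: (exhaustion_sub (ltnW mn)) (net_sub zs).
have mb := @measurable_boundary _ _ p (E n).
have bkkv v : positive_harmonic DD omega D v -> v x0 = 1 ->
    bounded_measurable (boundary (E n) : set (borel p))
      (fun y => kk n z y ^+ 2 * v y).
  move=> hv v1; have [av _ _] := adm v n.+1 hv v1.
  apply: bounded_measurableM; last exact: (harmonic_mean (ltnSn n) av nz).1.
  apply: bounded_measurable_sqr.
  exact: (kernel_bounded_borel (EE n).1 (@jk n) nz).
have var v (hv : positive_harmonic DD omega D v) (v1 : v x0 = 1) :=
  kernel_varianceE (adm v n.+1 hv v1) nz.
have vf := kernel_variance_ge0 z (adm f n.+1 hf f1).
have vg := kernel_variance_ge0 z (adm g n.+1 hg g1).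
move: vf vg; rewrite !var//.
have -> : \int[omega (E n) x0]_(y in boundary (E n)) (kk n z y ^+ 2 * h y) =
  t * \int[omega (E n) x0]_(y in boundary (E n)) (kk n z y ^+ 2 * f y) +
  (1 - t) * \int[omega (E n) x0]_(y in boundary (E n)) (kk n z y ^+ 2 * g y).
  rewrite -!bmRintegralZl//; try exact: bkkv.
  rewrite -bmRintegralD//; [|exact/bounded_measurableZ/bkkv..].
  apply: eq_Rintegral => y; rewrite inE => ny; rewrite hfg; first by ring.
  by apply/inD; exists n.+1; exact: (exhaustion_boundary (ltnSn n)).
move: (\int[_]_(_ in _) _) (\int[_]_(_ in _) _) => G F vf vg; rewrite hfg//.
have T1 : 0 <= t * (F - f z ^+ 2) by rewrite mulr_ge0// ltW.
have T2 : 0 <= (1 - t) * (G - g z ^+ 2) by rewrite mulr_ge0// subr_ge0 ltW.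
have -> : t * F + (1 - t) * G - (t * f z + (1 - t) * g z) ^+ 2 =
  t * (F - f z ^+ 2) + (1 - t) * (G - g z ^+ 2) +
  t * (1 - t) * (f z - g z) ^+ 2 by ring.
by move: T1 T2 gap0; lra.
Qed.

End nets.

End exhaustion.

(** * Coding boundary points by their position and their kernel *)

Lemma rational_grid (R : realType) (M e : R) : 0 < e ->
  exists Q : seq rat, forall a b : R, 0 <= a <= M -> 0 <= b <= M ->
    (forall q, q \in Q -> (ratr q < a) = (ratr q < b)) -> `|a - b| <= e.
Proof.
move=> e0; have [n _ nP] := near_infty_natSinv_lt (PosNum e0).
have /= ne := nP n (leqnn n).
pose Q := [seq i%:R / n.+1%:R : rat | i <- iota 0 (Num.truncn (M * n.+1%:R)).+2].
have n0 : 0 < n.+1%:R :> R by [].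
exists Q; suff le a b : 0 <= a <= M -> 0 <= b <= M ->
    (forall q, q \in Q -> (ratr q < a) = (ratr q < b)) -> b - a <= e.
  move=> a b aM bM ab; rewrite ler_norml; apply/andP; split; last first.
    by apply: le => // q /ab.
  by rewrite lerNl opprB; exact: le.
move=> /andP[a0 aM] _ ab; rewrite leNgt; apply/negP => ba.
pose t := Num.truncn (a * n.+1%:R).
have an0 : 0 <= a * n.+1%:R by rewrite mulr_ge0.
have /andP[ta at1] := truncn_itv an0.
have qE : ratr (t.+1%:R / n.+1%:R) = t.+1%:R / n.+1%:R :> R.
  by rewrite rmorphM/= fmorphV/= !ratr_nat.
have qQ : (t.+1%:R / n.+1%:R : rat) \in Q.
  apply/mapP; exists t.+1 => //; rewrite mem_iota add0n ltnS ltnS /=.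
  by apply: le_truncn; rewrite ler_wpM2r.
have := ab _ qQ; rewrite qE.
have -> : (t.+1%:R / n.+1%:R < a) = false.
  by apply/negbTE; rewrite -leNgt ler_pdivlMr// ltW.
move/esym/negbT; rewrite -leNgt => bt.
have : t.+1%:R / n.+1%:R <= a + n.+1%:R^-1.
  rewrite ler_pdivrMr// mulrDl mulVf ?lt0r_neq0//.
  by rewrite -[t.+1%:R]natr1 lerD2r.
move=> /(le_trans bt) bn; have := lt_le_trans ba (lerB bn (lexx a)).
by rewrite addrAC subrr add0r ltNge (ltW ne).
Qed.

Lemma cauchy_seq_cvg (R : realType) (u : nat -> R) :
  (forall e, 0 < e -> exists J, forall i j, (J <= i)%N -> (J <= j)%N ->
    `|u i - u j| <= e) -> cvgn u.
Proof.
move=> uC; apply/cauchy_cvgP/cauchy_exP => e e0.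
have e2 : 0 < e / 2 by rewrite divr_gt0.
have [J JP] := uC _ e2; exists (u J); exists J => // i /= Ji.
rewrite /ball/=; apply: (le_lt_trans (JP _ _ (leqnn J) Ji)).
by rewrite ltr_pdivrMr// ltr_pMr// ltr1n.
Qed.

Section code.
Context {R : realType} {X : metricType R} {p : X}.
Variables (DD : set (set X)) (omega : set X -> X -> probability (borel p) R).
Hypothesis hDD : harmonic_framework DD omega.
Variables (D : set X) (E : nat -> set X) (x0 : X) (kk : nat -> X -> X -> R).
Hypothesis hE : kernel_exhaustion DD omega x0 D E kk.
Variable net : nat -> nat -> seq X.
Hypothesis net_sub : forall m l z, z \in net m l -> E m.+1 z.
Hypothesis netP : forall m l x, E m x -> exists2 z, z \in net m l &
  forall n v, (m.+1 < n)%N -> admissible DD omega E x0 n v ->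
    `|v x - v z| <= l.+1%:R^-1.
Context {Z : pseudoMetricType R} {z0 : Z}.
Hypothesis cZ : compact [set: Z].
Variable j : X -> Z.
Hypothesis mj : measurable_fun setT (j : borel p -> borel z0).
Variable cover : nat -> seq Z.
Hypothesis coverP : forall l z, exists2 c, c \in cover l &
  (ball c l.+1%:R^-1)° z.

(** Countably many questions about a boundary point [y]: finitely many answers
    of the first kind determine the position [j y], and finitely many of the
    second kind the kernel at [y], up to any precision. The conditions on
    [E n] restrict the second kind to arguments at which the kernel is
    meaningful and measurable. *)
Definition test (n : nat) (y : X)
    (t : (nat * nat) + (nat * nat * nat * rat)) : bool :=
  match t with
  | inl (l, i) => `[< (ball (nth z0 (cover l) i) l.+1%:R^-1)° (j y) >]
  | inr (m, l, i, q) => `[< [/\ boundary (E n) y, E n (nth x0 (net m l) i) &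
      ratr q < kk n (nth x0 (net m l) i) y] >]
  end.

Definition position_code (n : nat) (y : X) (i : nat) : bool :=
  if unpickle i is Some t then test n y t else false.

Lemma measurable_position_code n i :
  measurable ([set y | position_code n y i] : set (borel p)).
Proof.
rewrite /position_code; case: unpickle => [[[l k]|[[[m l] k] q]]|] /=.
- rewrite (_ : [set _ | _] = j @^-1` (ball (nth z0 (cover l) k) l.+1%:R^-1)°).
    rewrite -[X in measurable X]setTI; apply: mj => //.
    by apply: open_borel; exact: open_interior.
  by apply/seteqP; split => y /asboolP.
- case: (pselect (E n (nth x0 (net m l) k))) => [nz|nz]; last first.
    rewrite (_ : [set _ | _] = set0); first exact: measurable0.
    by rewrite -subset0 => y /asboolP[].
  rewrite (_ : [set _ | _] = boundary (E n) `&`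
      kk n (nth x0 (net m l) k) @^-1` `]ratr q, +oo[).
    have [mk _] := kernel_bounded_borel (p := p) (exhaustion_step hE n).1
      (@exhaustion_continuous _ _ _ _ _ _ _ _ _ hE n) nz.
    by apply: mk; [exact: measurable_boundary|exact: measurable_itv].
  apply/seteqP; split => y /=; rewrite in_itv/= andbT; first by move/asboolP => [].
  by move=> [ny qy]; apply/asboolP.
- by rewrite (_ : [set _ | _] = set0)//; apply/seteqP; split.
Qed.

Let agree_test m n y n' y' t :
  mkseq (position_code n y) m = mkseq (position_code n' y') m ->
  (pickle t < m)%N -> test n y t = test n' y' t.
Proof.
move=> mm tm; have := congr1 (fun s => nth false s (pickle t)) mm.
by rewrite !nth_mkseq// /position_code pickleK.
Qed.

Let agree_tests (ts : seq _) : exists m, forall n y n' y',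
  mkseq (position_code n y) m = mkseq (position_code n' y') m ->
  forall t, t \in ts -> test n y t = test n' y' t.
Proof.
exists (\max_(t <- ts) pickle t).+1 => n y n' y' mm t tts.
by apply: (agree_test mm); rewrite ltnS; exact: leq_bigmax_seq.
Qed.

Lemma code_near_position e : 0 < e -> exists m, forall n y n' y',
  mkseq (position_code n y) m = mkseq (position_code n' y') m ->
  ball (j y) e (j y').
Proof.
move=> e0; have e2 : 0 < e / 2 by rewrite divr_gt0.
have [l _ lP] := near_infty_natSinv_lt (PosNum e2).
have /= le := lP l (leqnn l).
have [m mP] := agree_tests
  [seq inl (l, i) : (nat * nat) + (nat * nat * nat * rat) | i <- iota 0 (size (cover l))].
exists m => n y n' y' /mP mm.
have [c ccov cy] := coverP l (j y).
have tin : (inl (l, index c (cover l)) : (nat * nat) + (nat * nat * nat * rat)) \in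
    [seq inl (l, i) : (nat * nat) + (nat * nat * nat * rat) |
      i <- iota 0 (size (cover l))].
  by apply: map_f; rewrite mem_iota add0n index_mem.
have := mm _ tin; rewrite /= nth_index//.
have -> : `[< (ball c l.+1%:R^-1)° (j y) >] = true by apply/asboolP.
move=> /esym/asboolP /interior_subset cy'.
have {}cy := interior_subset cy.
by apply: (@ball_split _ _ c); [apply/ball_sym|];
  apply: (le_ball (ltW le)).
Qed.

(** Agreement of the kernels at the points of one net extends to [E m'], since
    kernels are admissible. *)
Lemma code_near_kernel m' e : 0 < e -> exists m N, forall n y n' y',
  (N <= n)%N -> (N <= n')%N -> boundary (E n) y -> boundary (E n') y' ->
  mkseq (position_code n y) m = mkseq (position_code n' y') m ->
  forall x, E m' x -> `|kk n x y - kk n' x y'| <= e.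
Proof.
move=> e0; have e4 : 0 < e / 4 by rewrite divr_gt0.
have [l _ lP] := near_infty_natSinv_lt (PosNum e4).
have /= le := lP l (leqnn l).
have [M MP] := admissible_bound hDD hE m'.+1.
have [Q QP] := @rational_grid R M (e / 4) e4.
have [m mP] := agree_tests
  [seq inr (m', l, i, q) : (nat * nat) + (nat * nat * nat * rat) |
    i <- iota 0 (size (net m' l)), q <- Q].
exists m, m'.+3 => n y n' y' Nn Nn' ny ny' /mP mm x mx.
have an := kernel_admissible hDD hE ny; have an' := kernel_admissible hDD hE ny'.
have hz z : z \in net m' l -> `|kk n z y - kk n' z y'| <= e / 4.
  move=> zs; have m1z := net_sub zs.
  have nz : E n z by apply: (exhaustion_sub hE _ m1z); exact: ltnW (ltnW Nn).
  have nz' : E n' z by apply: (exhaustion_sub hE _ m1z); exact: ltnW (ltnW Nn').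
  have [_ v0 _] := an; have [_ v0' _] := an'.
  apply: QP.
  - by rewrite v0//= (le_trans (ler_norm _))// (MP n (kk n ^~ y)).
  - by rewrite v0'//= (le_trans (ler_norm _))// (MP n' (kk n' ^~ y')).
  move=> q qQ.
  have tin : (inr (m', l, index z (net m' l), q) : (nat * nat) + (nat * nat * nat * rat))
      \in [seq inr (m', l, i, q) : (nat * nat) + (nat * nat * nat * rat) |
    i <- iota 0 (size (net m' l)), q <- Q].
    by apply: allpairs_f => //; rewrite mem_iota add0n index_mem.
  have := mm _ tin; rewrite /= nth_index// => tt.
  by apply/idP/idP => qz; [have : `[< [/\ boundary (E n) y, E n z & ratr q < kk n z y] >]
    by [apply/asboolP]; rewrite tt => /asboolP[]|
    have : `[< [/\ boundary (E n') y', E n' z & ratr q < kk n' z y'] >]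
    by [apply/asboolP]; rewrite -tt => /asboolP[]].
have := net_close netP (ltnW Nn) (ltnW Nn') an an' hz mx.
by move: (l.+1%:R^-1) le => a ae h; apply: (le_trans h); lra.
Qed.

Section tracking.
Variables (psi : nat -> nat) (S : Type) (lcode : S -> nat -> bool).
Hypothesis psi_inc : forall i, (psi i < psi i.+1)%N.
Hypothesis supp : forall t m N, exists n, (N <= n)%N /\
  exists2 y, boundary (E (psi n)) y &
    mkseq (position_code (psi n) y) m = mkseq (lcode t) m.

(** The positions of points with longer and longer prefixes of the code of [t]
    have a cluster point in the compact space [Z]. *)
Lemma exists_limit_position : exists e : S -> Z, forall r, 0 < r ->
  exists m, forall t n y,
    mkseq (position_code (psi n) y) m = mkseq (lcode t) m -> ball (e t) r (j y).
Proof.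
have /choice[e eP] : forall t, exists e : Z, forall r, 0 < r -> forall m,
    exists n y, (boundary (E (psi n)) y /\
      mkseq (position_code (psi n) y) m = mkseq (lcode t) m) /\ ball e r (j y).
  move=> t.
  have /choice[ny nyP] : forall m, exists ny : nat * X,
      boundary (E (psi ny.1)) ny.2 /\
      mkseq (position_code (psi ny.1) ny.2) m = mkseq (lcode t) m.
    by move=> m; have [n [_ [y ny yt]]] := supp t m 0; exists (n, y).
  have FT : ((fun m => j (ny m).2) @ \oo) [set: Z] by exact: filterT.
  have [e [_ eC]] := cZ _ FT.
  exists e => r r0 m.
  have A : ((fun m => j (ny m).2) @ \oo)
      [set j (ny m').2 | m' in [set m' | (m <= m')%N]].
    by exists m => // m' mm' /=; exists m'.
  have [_ [[m' /= mm' <-] em']] := eC _ _ A (nbhsx_ballx e r r0).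
  exists (ny m').1, (ny m').2; split => //.
  by split; [exact: (nyP m').1|exact: mkseq_prefix mm' (nyP m').2].
exists e => r r0; have r2 : 0 < r / 2 by rewrite divr_gt0.
have [m mP] := code_near_position r2; exists m => t n y yt.
have [n' [y' [[_ y't] ey']]] := eP t _ r2 m.
by apply: (ball_split ey'); apply: (mP (psi n') y' (psi n) y); rewrite y't yt.
Qed.

(** The kernels at points with longer and longer prefixes of the code of [t] form
    a Cauchy sequence, uniformly on each [E m']. *)
Lemma exists_limit_kernel : exists h : S -> X -> R,
  (forall m' e, 0 < e -> exists m N, forall t n y, (N <= n)%N ->
    boundary (E (psi n)) y ->
    mkseq (position_code (psi n) y) m = mkseq (lcode t) m ->
    forall x, E m' x -> `|kk (psi n) x y - h t x| <= e) /\
  forall t, positive_harmonic DD omega D (h t) /\ h t x0 = 1.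
Proof.
have /choice[ny nyP] : forall t, exists ny : nat -> nat * X, forall m,
    [/\ (m <= (ny m).1)%N, boundary (E (psi (ny m).1)) (ny m).2 &
    mkseq (position_code (psi (ny m).1) (ny m).2) m = mkseq (lcode t) m].
  move=> t; suff /choice[f fP] : forall m, exists q : nat * X,
      [/\ (m <= q.1)%N, boundary (E (psi q.1)) q.2 &
      mkseq (position_code (psi q.1) q.2) m = mkseq (lcode t) m] by exists f.
  move=> m; by have [n [mn [y nny yt]]] := supp t m m; exists (n, y).
pose v t m x := kk (psi (ny t m).1) x (ny t m).2.
have psi_ge := increasing_ge_id psi_inc.
have vC m' e : 0 < e -> exists J, forall t i i' x, (J <= i)%N -> (J <= i')%N ->
    E m' x -> `|v t i x - v t i' x| <= e.
  move=> e0; have [m [N mN]] := code_near_kernel m' e0.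
  exists (maxn m N) => t i i' x; rewrite !geq_max => /andP[mi Ni] /andP[mi' Ni'] mx.
  have [in_ iy it] := nyP t i; have [i'n i'y i't] := nyP t i'.
  apply: mN => //; [exact: leq_trans (leq_trans Ni in_) (psi_ge _)|
    exact: leq_trans (leq_trans Ni' i'n) (psi_ge _)|].
  by rewrite (mkseq_prefix mi it) (mkseq_prefix mi' i't).
pose h t x := limn (fun i => v t i x).
have vh t m' x : E m' x -> v t i x @[i --> \oo] --> h t x.
  move=> mx; apply: cauchy_seq_cvg => e e0; have [J JP] := vC m' e e0.
  by exists J => i i' Ji Ji'; exact: JP mx.
have vU m' e : 0 < e -> exists J, forall t i x, (J <= i)%N -> E m' x ->
    `|v t i x - h t x| <= e.
  move=> e0; have [J JP] := vC m' e e0; exists J => t i x Ji mx.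
  have vv : `|v t i x - v t i' x| @[i' --> \oo] --> `|v t i x - h t x|.
    by apply: cvg_norm; apply: cvgB; [exact: cvg_cst|exact: vh mx].
  rewrite -(cvg_lim _ vv)//; apply: limr_le.
    by apply/cvg_ex; eexists; exact: vv.
  by exists J => // i' Ji'; exact: JP mx.
exists h; split; last first.
  move=> t; apply: (admissible_limit hDD hE
    (n_ := fun i => psi (ny t i).1) (v_ := v t)).
  - by move=> i; have [iy _ _] := nyP t i; exact: leq_trans iy (psi_ge _).
  - by move=> i; have [_ iy _] := nyP t i; exact: (kernel_admissible hDD hE iy).
  - by move=> m' e e0; have [J JP] := vU m' e e0; exists J => i x; exact: JP.
move=> m' e e0; have e2 : 0 < e / 2 by rewrite divr_gt0.
have [m [N mN]] := code_near_kernel m' e2; have [J JP] := vU m' _ e2.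
exists m, N => t n y Nn nny yt x mx.
pose i := maxn (maxn m N) J.
have mi : (m <= i)%N by rewrite /i !leq_max leqnn.
have Ni : (N <= i)%N by rewrite /i !leq_max leqnn orbT.
have [iny iy it] := nyP t i.
have h1 : `|kk (psi n) x y - v t i x| <= e / 2.
  apply: mN => //; [exact: leq_trans Nn (psi_ge _)|
    exact: leq_trans (leq_trans Ni iny) (psi_ge _)|].
  by rewrite yt (mkseq_prefix mi it).
have h2 := JP t i x (leq_maxr _ _) mx.
by have := ler_distD (v t i x) (kk (psi n) x y) (h t x); lra.
Qed.

End tracking.
End code.

(** * The limit of the kernel measures lives on the extreme points *)

(** The indicator of a closed set is a pointwise limit of continuous functions
    with values between 0 and 1. *)
Lemma measurable_of_continuous_tests (R : realType) d (S : measurableType d)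
    (Z : pseudoMetricType R) (z0 : Z) (e : S -> Z) :
  (forall f : Z -> R, continuous f -> (forall z, 0 <= f z <= 1) ->
    measurable_fun setT (f \o e)) ->
  measurable_fun setT (e : S -> borel z0).
Proof.
move=> fe; apply: (@measurability _ _ S (borel z0) setT e open) => //.
move=> _ [V oV <-]; rewrite setTI.
have cF : closed (~` V) by exact: open_closedC.
have [f_ [cf_ f01 fF]] := closed_indic_limit cF.
have mF : measurable_fun setT (fun t => \1_(~` V) (e t) : R).
  apply: (@measurable_fun_cvg _ _ _ _ (fun n t => f_ n (e t))).
    by move=> n; apply: fe.
  by move=> t _; exact: fF.
have -> : e @^-1` V = setT `&` (fun t => \1_(~` V) (e t) : R) @^-1` [set 0].
  rewrite setTI; apply/seteqP; split => t /=; rewrite indicE.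
    by move=> Vt; rewrite memNset//; exact.
  case: (boolP (e t \in ~` V)) => [_ /eqP|/negP nV _]; first by rewrite oner_eq0.
  by apply: contrapT => Vt; apply: nV; rewrite inE.
exact: mF.
Qed.

Lemma Rintegral_eq0 (R : realType) d (S : measurableType d)
    (P : {finite_measure set S -> \bar R}) (f : S -> R) :
  bounded_measurable setT f -> (forall t, 0 <= f t) ->
  \int[P]_t f t = 0 -> exists N, [/\ measurable N, P N = 0%E &
    forall t, ~ N t -> f t = 0].
Proof.
move=> bf f0 If.
have : (\int[P]_(t in setT) `|(f t)%:E| = 0)%E.
  rewrite -[RHS](congr1 EFin If) Rintegral_EFin//.
  by apply: eq_integral => t _; rewrite gee0_abs// lee_fin.
move=> If'; have mf : measurable_fun setT (EFin \o f).
  by apply/measurable_EFinP; case: bf.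
have [N [mN N0 hN]] := (ae_eq_integral_abs P measurableT mf).1 If'.
exists N; split => // t Nt; apply/eqP; apply: contrapT => ft; apply: Nt.
by apply: hN => /(_ I) /= [/eqP].
Qed.

Lemma null_bigcup (R : realType) d (S : measurableType d)
    (P : {measure set S -> \bar R}) (A : nat -> set S) :
  (forall k, measurable (A k)) -> (forall k, P (A k) = 0%E) ->
  P (\bigcup_k A k) = 0%E.
Proof.
move=> mA A0; apply: measure_negligible; first exact: bigcup_measurable.
by apply: negligible_bigcup => k; exists (A k); split.
Qed.

(** Markov's inequality for a sequence of functions whose integrals vanish in the
    limit. *)
Lemma liminf_null (R : realType) d (S : measurableType d)
    (P : {finite_measure set S -> \bar R}) (f : nat -> S -> R) (N0 : nat) :
  (forall n, (N0 <= n)%N -> bounded_measurable setT (f n)) ->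
  (forall n t, (N0 <= n)%N -> 0 <= f n t) ->
  \int[P]_t f n t @[n --> \oo] --> 0 ->
  exists N, [/\ measurable N, P N = 0%E & forall t, ~ N t ->
    forall (e : R) m, 0 < e -> exists n, (m <= n)%N /\ f n t <= e].
Proof.
move=> bf f0 If.
pose B (k m : nat) := \bigcap_(n in [set n | (maxn N0 m <= n)%N])
  [set t | k.+1%:R^-1 <= f n t].
have mB k m : measurable (B k m).
  apply: bigcap_measurable; first by exists (maxn N0 m) => /=.
  move=> n /=; rewrite geq_max => /andP[N0n _].
  have [mf _] := bf n N0n.
  have -> : [set t | k.+1%:R^-1 <= f n t] =
      setT `&` f n @^-1` `[k.+1%:R^-1, +oo[.
    by rewrite setTI; apply/seteqP; split => t /=; rewrite in_itv/= andbT.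
  exact: mf.
have B0 k m : P (B k m) = 0%E.
  have k0 : 0 < k.+1%:R^-1 :> R by rewrite invr_gt0.
  apply/eqP; rewrite eq_le measure_ge0 andbT.
  rewrite -[P _]fineK ?fin_num_measure// lee_fin.
  apply/ler_addgt0Pr => e e0; rewrite add0r.
  have ek : 0 < e * k.+1%:R^-1 by rewrite mulr_gt0.
  move/cvgrPdist_le : If => /(_ _ ek) [n1 _ n1P].
  pose n := maxn (maxn N0 m) n1.
  have N0n : (N0 <= n)%N by rewrite /n !leq_max leqnn.
  have := n1P n (leq_maxr _ _); rewrite /= sub0r normrN => /(le_trans (ler_norm _)).
  have bB : bounded_measurable setT (\1_(B k m) : S -> R).
    exact: bounded_measurable_indic.
  have le : k.+1%:R^-1 * fine (P (B k m)) <= \int[P]_t f n t.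
    have -> : fine (P (B k m)) = \int[P]_t \1_(B k m) t.
      by rewrite /Rintegral integral_indic ?setIT.
    rewrite -bmRintegralZl//; apply: le_bmRintegral => //.
    - exact: bounded_measurableZ.
    - exact: bf.
    move=> t _; rewrite indicE; case: (boolP (t \in B k m)) => [|_].
      by rewrite inE mulr1 => /(_ n); apply; exact: leq_maxl.
    by rewrite mulr0 f0.
  move=> /(le_trans le); rewrite mulrC ler_pM2r//.
exists (\bigcup_k \bigcup_m B k m); split.
- by apply: bigcup_measurable => k _; exact: bigcup_measurable.
- apply: null_bigcup => k; first exact: bigcup_measurable.
  by apply: null_bigcup => m; [exact: mB|exact: B0].
move=> t Nt e m e0; have [k _ kP] := near_infty_natSinv_lt (PosNum e0).
have /= ke := kP k (leqnn k).
apply: contrapT => nex; apply: Nt; exists k => //; exists m => // n /=.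
rewrite geq_max => /andP[_ mn]; rewrite leNgt; apply/negP => fk.
by apply: nex; exists n; split => //; exact/ltW/(lt_trans fk ke).
Qed.

Lemma tracksM (R : realType) d (T : measurableType d)
    (code : nat -> T -> nat -> bool) (F : nat -> set T) d' (S : measurableType d')
    (lcode : S -> nat -> bool) (g g' : nat -> T -> R) (f f' : S -> R) (M M' : R) :
  (exists N, forall n y, (N <= n)%N -> F n y -> `|g n y| <= M) ->
  (forall t, `|f' t| <= M') ->
  tracks code F lcode g f -> tracks code F lcode g' f' ->
  tracks code F lcode (fun n y => g n y * g' n y) (fun t => f t * f' t).
Proof.
move=> [N gM] fM gf gf' e e0.
have B0 : 0 < `|M| + `|M'| + 1 by rewrite ltr_wpDl// addr_ge0.
have e0' : 0 < e / (`|M| + `|M'| + 1) by rewrite divr_gt0.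
have [m1 [N1 P1]] := gf _ e0'; have [m2 [N2 P2]] := gf' _ e0'.
exists (maxn m1 m2), (maxn N (maxn N1 N2)) => n y t.
rewrite !geq_max => /and3P[Nn N1n N2n] ny yt.
have h1 := P1 n y t N1n ny (mkseq_prefix (leq_maxl _ _) yt).
have h2 := P2 n y t N2n ny (mkseq_prefix (leq_maxr _ _) yt).
have h3 := le_trans (gM n y Nn ny) (ler_norm M).
have h4 := le_trans (fM t) (ler_norm M').
have -> : g n y * g' n y - f t * f' t =
    g n y * (g' n y - f' t) + (g n y - f t) * f' t by ring.
apply: (le_trans (ler_normD _ _)); rewrite !normrM.
have le1 := ler_pM (normr_ge0 _) (normr_ge0 _) h3 h2.
have le2 := ler_pM (normr_ge0 _) (normr_ge0 _) h1 h4.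
apply: (le_trans (lerD le1 le2)).
rewrite -[leRHS](divfK (lt0r_neq0 B0)) [X in X + _]mulrC -mulrDr.
by apply: ler_wpM2l; [exact: ltW|rewrite lerDl].
Qed.

Lemma ae_bounded_cvg_Rintegral (R : realType) d (S : measurableType d)
    (P : {finite_measure set S -> \bar R}) (N : set S) (f_ : nat -> S -> R)
    (f : S -> R) (M : R) :
  measurable N -> P N = 0%E -> (forall n, bounded_measurable setT (f_ n)) ->
  (forall n t, `|f_ n t| <= M) -> bounded_measurable setT f ->
  (forall t, ~ N t -> f_ n t @[n --> \oo] --> f t) ->
  \int[P]_t f_ n t @[n --> \oo] --> \int[P]_t f t.
Proof.
move=> mN N0 bf_ fM bf ff.
have mC : measurable (setT `\` N) by exact: measurableD.
rewrite -(bmRintegral_setC0 measurableT mN N0 bf).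
under eq_fun do rewrite -(bmRintegral_setC0 measurableT mN N0 (bf_ _)).
apply: (bounded_cvg_Rintegral (M := M) P mC _ _ _).2.
- by move=> n; apply: measurable_funTS; case: (bf_ n).
- by move=> n t _; exact: fM.
- by move=> t [_ Nt]; exact: ff.
Qed.

(** [S] is the limit space of the codes, under the measures [u dW_n] on the
    boundaries. The function [h t] is the limit of the kernels at boundary points
    with longer and longer prefixes of the code of [t]. *)
Section limit_model.
Context {R : realType} {X : metricType R} {p : X}.
Variables (DD : set (set X)) (omega : set X -> X -> probability (borel p) R).
Hypothesis hDD : harmonic_framework DD omega.
Variables (D : set X) (E : nat -> set X) (x0 : X) (kk : nat -> X -> X -> R).
Hypothesis hE : kernel_exhaustion DD omega x0 D E kk.
Variable net : nat -> nat -> seq X.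
Hypothesis net_sub : forall m l z, z \in net m l -> E m.+1 z.
Hypothesis netP : forall m l x, E m x -> exists2 z, z \in net m l &
  forall n v, (m.+1 < n)%N -> admissible DD omega E x0 n v ->
    `|v x - v z| <= l.+1%:R^-1.
Variable u : X -> R.
Hypothesis hu : positive_harmonic DD omega D u.
Let W n : probability (borel p) R := omega (E n) x0.
Let bE n : set (borel p) := boundary (E n).
Variable mu : nat -> {finite_measure set (borel p) -> \bar R}.
Hypothesis mu_mass : forall n, mu n setT = (u x0)%:E.
Hypothesis mu_boundary : forall n, mu n (~` bE n) = 0%E.
Hypothesis mu_integral : forall n f, bounded_measurable (bE n) f ->
  \int[mu n]_(y in bE n) f y = \int[W n]_(y in bE n) (f y * u y).
Variable code : nat -> X -> nat -> bool.
Hypothesis mcode : forall n i, measurable ([set y | code n y i] : set (borel p)).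
Context d (S : measurableType d).
Variables (P : {finite_measure set S -> \bar R}) (lcode : S -> nat -> bool).
Hypotheses (PT : P setT = (u x0)%:E)
  (mlcode : forall w, measurable (cylinder lcode w)).
Hypothesis cvg_cylinder : forall w,
  fine (mu n (cylinder (code n) w)) @[n --> \oo] -->
  fine (P (cylinder lcode w)).
Hypothesis lcode_gt0 : forall t m,
  0 < fine (P (cylinder lcode (mkseq (lcode t) m))).
Variable h : S -> X -> R.
Hypothesis h_track : forall m' e, 0 < e -> exists m N, forall t n y,
  (N <= n)%N -> boundary (E n) y -> mkseq (code n y) m = mkseq (lcode t) m ->
  forall x, E m' x -> `|kk n x y - h t x| <= e.
Hypothesis h_pos : forall t, positive_harmonic DD omega D (h t).
Hypothesis h_base : forall t, h t x0 = 1.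

Let mbE n : measurable (bE n). Proof. exact: measurable_boundary. Qed.
Let tr := @tracks _ (borel p) R code bE _ S lcode.
Let inD := inD hE.

Let h_adm t n : admissible DD omega E x0 n (h t).
Proof. exact: (positive_harmonic_admissible hE n (h_pos t) (h_base t)). Qed.

Let h_ge0 t x : D x -> 0 <= h t x.
Proof. by move=> Dx; apply/ltW/(h_pos t).2. Qed.

Let bED n : bE n `<=` D.
Proof.
by move=> y ny; apply/inD; exists n.+1; exact: (exhaustion_boundary hE (ltnSn n)).
Qed.

Lemma normalized_bound x : D x -> exists M, forall v,
  positive_harmonic DD omega D v -> v x0 = 1 -> `|v x| <= M.
Proof.
move=> /inD[m mx]; have [M MP] := admissible_bound hDD hE m.
exists M => v hv v1; apply: (MP _ _ _ (ltnSn m.+1)) => //.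
exact: (positive_harmonic_admissible hE).
Qed.

(* The kernel at [x] is meaningful only if [E n] contains [x]. *)
Let kx x n y := if `[< E n x >] then kk n x y else 0.

Let kxE x n y : E n x -> kx x n y = kk n x y.
Proof. by rewrite /kx => /asboolP ->. Qed.

Let bkk n x : E n x -> bounded_measurable (bE n) (kk n x).
Proof.
move=> nx; exact: (kernel_bounded_borel (exhaustion_step hE n).1
  (@exhaustion_continuous _ _ _ _ _ _ _ _ _ hE n) nx).
Qed.

Let bkk2 n x : E n x ->
  bounded_measurable (bE n) (fun y => kk n x y ^+ 2).
Proof. by move=> nx; apply: bounded_measurable_sqr; exact: bkk. Qed.

Let bkx x n : bounded_measurable (bE n) (kx x n).
Proof.
case: (pselect (E n x)) => nx; last first.
  apply: (eq_bounded_measurable _ (bounded_measurable_cst _ 0)) => y _.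
  by rewrite /kx asboolF.
apply: (@eq_bounded_measurable _ (borel p) R (bE n) (kk n x : borel p -> R)).
  by move=> y _; rewrite kxE.
exact: bkk.
Qed.

Let kx_bounded x : D x -> exists M N, 0 <= M /\ forall n y, (N <= n)%N ->
  bE n y -> `|kx x n y| <= M.
Proof.
move=> /inD[m mx]; have [M MP] := admissible_bound hDD hE m.
exists (Num.max M 0), m.+2; split; first by rewrite le_max lexx orbT.
move=> n y mn ny.
have nx : E n x by apply: (exhaustion_sub hE _ mx); exact: ltnW (ltnW mn).
rewrite kxE// le_max (MP n (kk n ^~ y))//.
exact: (kernel_admissible hDD hE ny).
Qed.

Let kx_tracks x : D x -> tr (kx x) (fun t => h t x).
Proof.
move=> /inD[m' mx] e e0; have [m [N mN]] := h_track m' e0.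
exists m, (maxn N m') => n y t; rewrite geq_max => /andP[Nn mn] ny yt.
by rewrite kxE; [exact: (mN t n y)|exact: (exhaustion_sub hE mn)].
Qed.

Lemma h_bounded_measurable x : D x -> bounded_measurable setT (h ^~ x).
Proof.
move=> Dx; have [M [N [_ kM]]] := kx_bounded Dx.
exact: (tracks_measurable mcode mbE mu_boundary mlcode cvg_cylinder lcode_gt0
  (ex_intro _ N kM) (kx_tracks Dx)).
Qed.

Let u_bounded n : bounded_measurable (bE n) u.
Proof.
apply: compact_bounded_measurable => //.
  exact: (compact_boundary (exhaustion_step hE n).1).
by apply: continuous_subspaceW hu.1.1; exact: bED.
Qed.

(** The integral of the kernel at [x] against [u dW_n] is [u x] for every [n], and
    its limit is the integral of [h t x]. *)
Lemma barycenter x : D x -> \int[P]_t h t x = u x.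
Proof.
move=> Dx; have [M [N [_ kM]]] := kx_bounded Dx.
have := tracks_integral mu_mass mcode mbE mu_boundary PT mlcode cvg_cylinder
  lcode_gt0 (fun n => (bkx x n).1) (ex_intro _ N kM) (kx_tracks Dx).
move=> /(cvg_unique _); apply => //; apply: cvg_near_cst.
have /inD[m mx] := Dx; exists m => // n /= mn.
have nx : E n x by exact: (exhaustion_sub hE mn).
rewrite mu_integral//.
have hun : harmonic_on DD omega (E n.+1) u.
  by apply: harmonic_onS hu.1 => z nz; apply/inD; exists n.+1.
have [_ ->] := harmonic_mean hDD hE (ltnSn n) hun nx.
by apply: eq_Rintegral => y _; rewrite kxE// mulrC.
Qed.

Let h_code m' e : 0 < e -> exists m, forall t t',
  mkseq (lcode t) m = mkseq (lcode t') m ->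
  forall x, E m' x -> `|h t x - h t' x| <= e.
Proof.
move=> e0; have e2 : 0 < e / 2 by rewrite divr_gt0.
have [m [N mN]] := h_track m' e2; exists m => t t' tt' x mx.
have [n [Nn [y ny yt]]] :=
  coded_support mcode mbE mu_boundary cvg_cylinder lcode_gt0 t m N.
have h1 := mN t n y Nn ny yt x mx.
have h2 := mN t' n y Nn ny (etrans yt tt') x mx.
have := ler_distD (kk n x y) (h t x) (h t' x).
by rewrite distrC in h1; lra.
Qed.

Let h_joint n : bounded_measurable (setT `*` bE n : set (S * borel p))
  (fun z => h z.1 z.2).
Proof.
split; last first.
  have [M MP] := admissible_bound hDD hE n.+1.
  exists M => -[t y] [_ ny]; apply: (MP _ _ _ (ltnSn n.+2)) => //.
  exact: (exhaustion_boundary hE (ltnSn n)).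
apply: piecewise_measurable => // e e0.
have [m mP] := h_code n.+1 e0.
have [ts tsP] := finite_prefixes lcode m.
exists ts, (fun z => cylinder lcode (mkseq (lcode z) m)); split.
- by move=> z; exact: mlcode.
- move=> t _; have [z zs zt] := tsP t; exists z => //=.
  by rewrite zt; exact: cylinder_mkseq.
- move=> z _; apply: within_continuous_measurable => //.
  by apply: continuous_subspaceW (h_pos z).1.1; exact: bED.
- move=> z t y _ _; rewrite /cylinder/= size_mkseq => tz ny.
  by apply: mP => //; exact: (exhaustion_boundary hE (ltnSn n)).
Qed.

Let h_section n t : bounded_measurable (bE n) (h t).
Proof.
apply: compact_bounded_measurable => //.
  exact: (compact_boundary (exhaustion_step hE n).1).
by apply: continuous_subspaceW (h_pos t).1.1; exact: bED.
Qed.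

Let bounded_snd n (f : X -> R) : bounded_measurable (bE n) f ->
  bounded_measurable (setT `*` bE n : set (S * borel p)) (fun z => f z.2).
Proof.
move=> [mf [M fM]]; split; last by exists M => -[t y] [_ /fM].
apply: (measurable_comp (mbE n) _ mf); first by move=> _ [[t y] [_ ny] <-].
exact: measurable_funTS.
Qed.

Lemma coupling n (f : X -> R) : bounded_measurable (bE n) f ->
  bounded_measurable setT (fun t => \int[W n]_(y in bE n) (f y * h t y)).
Proof.
move=> bf; have bFh := bounded_measurableM (bounded_snd bf) (h_joint n).
exact: (@bounded_Fubini _ _ S (borel p) R P (W n) setT (bE n)
  (fun t y => f y * h t y) measurableT (mbE n) bFh).1.
Qed.

(** The coupling [h t y dW_n(y) dP(t)] of [P] with [u dW_n]: the second marginal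
    is computed by exchanging the integrals and averaging [h t y] over [t]. *)
Lemma coupling_integral n (f : X -> R) : bounded_measurable (bE n) f ->
  \int[P]_t (\int[W n]_(y in bE n) (f y * h t y)) =
  \int[W n]_(y in bE n) (f y * u y).
Proof.
move=> bf; have bFh := bounded_measurableM (bounded_snd bf) (h_joint n).
have [_ ->] := @bounded_Fubini _ _ S (borel p) R P (W n) setT (bE n)
  (fun t y => f y * h t y) measurableT (mbE n) bFh.
apply: eq_Rintegral => y; rewrite inE => ny.
rewrite bmRintegralZl//; last exact: h_bounded_measurable (bED ny).
by rewrite barycenter//; exact: bED ny.
Qed.

Let h_mass n t : \int[W n]_(y in bE n) h t y = 1.
Proof. by have [ht _ _] := h_adm t n.+1; rewrite (harmonic_mass hE ht). Qed.

Let variance x n t := kernel_variance omega E x0 kk n x (h t).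

Let variance_bounded x n : E n x -> bounded_measurable setT (variance x n).
Proof.
move=> nx; have Dx : D x by apply/inD; exists n.
apply: (@eq_bounded_measurable _ _ _ _ (fun t =>
  \int[W n]_(y in bE n) (kk n x y ^+ 2 * h t y) - h t x ^+ 2)).
  by move=> t _; rewrite /variance (kernel_varianceE hDD hE).
apply: bounded_measurableB; first exact: coupling (bkk2 nx).
exact/bounded_measurable_sqr/h_bounded_measurable.
Qed.

(** The variance integrates to the difference of [\int[W n] (kk n x)^2 u] and
    [\int[P] (h x)^2], and the first converges to the second. *)
Lemma variance_cvg x : D x ->
  \int[P]_t kernel_variance omega E x0 kk n x (h t) @[n --> \oo] --> 0.
Proof.
move=> Dx; have [M [N [M0 kM]]] := kx_bounded Dx.
have kM2 : exists N, forall n y, (N <= n)%N -> bE n y -> `|kx x n y ^+ 2| <= M ^+ 2.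
  exists N => n y Nn ny; rewrite normrX ler_sqr ?nnegrE//; exact: kM.
have [Mh hM] := normalized_bound Dx.
have tr2 : tr (fun n y => kx x n y ^+ 2) (fun t => h t x ^+ 2).
  have hb t : `|h t x| <= Mh by exact: hM.
  exact (tracksM (ex_intro _ N kM) hb (kx_tracks Dx) (kx_tracks Dx)).
have := tracks_integral mu_mass mcode mbE mu_boundary PT mlcode cvg_cylinder
  lcode_gt0 (fun n => (bounded_measurable_sqr (bkx x n)).1) kM2 tr2.
move=> c1; have : \int[mu n]_(y in bE n) kx x n y ^+ 2 - \int[P]_t h t x ^+ 2
    @[n --> \oo] --> \int[P]_t h t x ^+ 2 - \int[P]_t h t x ^+ 2.
  by apply: cvgB => //; exact: cvg_cst.
rewrite subrr; apply: cvg_trans; apply: near_eq_cvg.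
have /inD[m mx] := Dx; exists m => // n /= mn.
have nx : E n x by exact: (exhaustion_sub hE mn).
have bk : bounded_measurable (bE n) (kk n x).
  exact: bkk.
have bk2 := bkk2 nx.
rewrite mu_integral; last exact: bounded_measurable_sqr (bkx x n).
have -> : \int[W n]_(y in bE n) (kx x n y ^+ 2 * u y) =
    \int[W n]_(y in bE n) (kk n x y ^+ 2 * u y).
  by apply: eq_Rintegral => y _; rewrite kxE.
rewrite -coupling_integral// -bmRintegralB//; last 2 first.
- exact: coupling bk2.
- exact/bounded_measurable_sqr/h_bounded_measurable.
by apply: eq_Rintegral => t _; rewrite (kernel_varianceE hDD hE).
Qed.

Lemma ae_on_nets (Q : X -> S -> Prop) :
  (forall x, D x -> exists N, [/\ measurable N, P N = 0%E &
    forall t, ~ N t -> Q x t]) ->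
  exists N, [/\ measurable N, P N = 0%E &
    forall t, ~ N t -> forall m l y, y \in net m l -> Q y t].
Proof.
pose z w : X := let: (m, l, i) := w : nat * nat * nat in nth x0 (net m l) i.
have zD w : D (z w).
  move: w => [[m l] i] /=; apply/inD.
  case: (ltnP i (size (net m l))) => il.
    by exists m.+1; apply: (net_sub (l := l)); exact: mem_nth.
  by exists 0%N; rewrite nth_default//; exact: exhaustion_base hE 0%N.
move=> QP; have /choice[B BP] := fun w => QP (z w) (zD w).
pose C i := if unpickle i is Some w then B w else set0.
have mC i : measurable (C i).
  by rewrite /C; case: unpickle => // w; have [] := BP w.
have C0 i : P (C i) = 0%E.
  by rewrite /C; case: unpickle => [w|]; [have [] := BP w|rewrite measure0].
exists (\bigcup_i C i); split.
- exact: bigcup_measurable.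
- by apply: null_bigcup => i; [exact: mC|exact: C0].
move=> t Nt m l y ys; pose w := (m, l, index y (net m l)).
have wy : z w = y by rewrite /z /w nth_index.
have [_ _ /(_ t)] := BP w; rewrite wy; apply => Bwt.
by apply: Nt; exists (pickle w) => //; rewrite /C pickleK.
Qed.

(** The variances are nonnegative and vanish in the mean, so that for almost
    every [t] they come arbitrarily close to zero at every point of the nets. *)
Lemma ae_extreme : exists N, [/\ measurable N, P N = 0%E &
  forall t, ~ N t -> extreme_harmonic DD omega (D := D) x0 (sigL D (h t))].
Proof.
have [|N [mN N0 NP]] := @ae_on_nets (fun y t => forall (e : R) m, 0 < e ->
    exists n, (m <= n)%N /\ variance y n t <= e).
  move=> x Dx; have /inD[n nx] := Dx.
  apply: (@liminf_null _ _ _ _ _ n) => [n' nn'|n' t nn'|].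
  - by apply: variance_bounded; exact: (exhaustion_sub hE nn').
  - exact (kernel_variance_ge0 hE x (h_adm t n'.+1)).
  - exact: variance_cvg.
exists N; split => // t Nt.
apply: (extreme_of_no_variance hDD hE net_sub netP) => // m l y ys e n0 e0.
exact (NP t Nt m l y ys e n0 e0).
Qed.

Section parameter.
Context {Y : pseudoMetricType R} {q : Y}.
Variables (jK : X -> Y) (eK : S -> Y) (kappa : Y -> X -> R) (bK : set (borel q)).
Hypothesis mjK : forall a : Y -> R, continuous a ->
  measurable_fun setT (a \o jK : borel p -> R).
Hypothesis eK_tracks : forall a : Y -> R, continuous a ->
  (forall z, 0 <= a z <= 1) -> tr (fun _ y => a (jK y)) (a \o eK).
Hypothesis mbK : measurable bK.
Hypothesis mkappa : forall x, D x ->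
  measurable_fun bK (fun eta => kappa eta x : R).
Hypothesis kappa_extreme : forall eta, bK eta ->
  extreme_harmonic DD omega (D := D) x0 (sigL D (kappa eta)).
Hypothesis kappa_onto : forall f, extreme_harmonic DD omega (D := D) x0 f ->
  exists eta, bK eta /\ sigL D (kappa eta) = f.
Hypothesis kappa_concentrates : forall eta (a : Y -> R), bK eta ->
  continuous a -> (forall z, 0 <= a z <= 1) ->
  \int[W n]_(y in bE n) (a (jK y) * kappa eta y) @[n --> \oo] --> a eta.

(** The value [q] on the exceptional set makes [eta] measurable. *)
Lemma exists_parameter : exists N (eta : S -> Y), [/\ measurable N, P N = 0%E,
  forall t, N t -> eta t = q & forall t, ~ N t ->
  bK (eta t) /\ forall x, D x -> kappa (eta t) x = h t x].
Proof.
have [N [mN N0 Nh]] := ae_extreme.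
have /choice[eta etaP] : forall t, exists eta, (N t -> eta = q) /\ (~ N t ->
    bK eta /\ forall x, D x -> kappa eta x = h t x).
  move=> t; have [Nt|Nt] := pselect (N t); first by exists q; split.
  have [eta [bKeta etah]] := kappa_onto (Nh t Nt).
  exists eta; split => // _; split => // x Dx.
  exact: (congr1 (fun f => f (SigSub (mem_set Dx))) etah).
by exists N, eta; split => // t Nt; have [h1 h2] := etaP t; [exact: h1|exact: h2].
Qed.

Section given_parameter.
Variables (N0 : set S) (eta : S -> Y).
Hypotheses (mN0 : measurable N0) (PN0 : P N0 = 0%E).
Hypothesis eta_default : forall t, N0 t -> eta t = q.
Hypothesis etaP : forall t, ~ N0 t ->
  bK (eta t) /\ forall x, D x -> kappa (eta t) x = h t x.

Let btest (a : Y -> R) n : continuous a -> (forall z, 0 <= a z <= 1) ->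
  bounded_measurable (bE n) (fun y => a (jK y)).
Proof.
move=> ca a01; split; first by apply: measurable_funTS; exact: mjK.
by exists 1 => y _; have /andP[a0 a1] := a01 (jK y); rewrite ger0_norm.
Qed.

Let kernel_test_cvg t (a : Y -> R) : ~ N0 t -> continuous a ->
  (forall z, 0 <= a z <= 1) ->
  \int[W n]_(y in bE n) (a (jK y) * h t y) @[n --> \oo] --> a (eta t).
Proof.
move=> Nt ca a01; have [bt kh] := etaP Nt.
have eI n : \int[W n]_(y in bE n) (a (jK y) * h t y) =
    \int[W n]_(y in bE n) (a (jK y) * kappa (eta t) y).
  by apply: eq_Rintegral => y; rewrite inE => /bED Dy; rewrite kh.
under eq_fun do rewrite eI.
exact: kappa_concentrates.
Qed.

Let test_mass t n (a : Y -> R) : continuous a -> (forall z, 0 <= a z <= 1) ->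
  `|\int[W n]_(y in bE n) (a (jK y) * h t y)| <= 1.
Proof.
move=> ca a01; rewrite -[leRHS](h_mass n t); apply: le_norm_bmRintegral => //.
  by apply: bounded_measurableM => //; exact: btest.
move=> y /bED Dy; have /andP[a0 a1] := a01 (jK y).
by rewrite normrM !ger0_norm ?h_ge0// ler_piMl// h_ge0.
Qed.

Let beta (a : Y -> R) : continuous a -> (forall z, 0 <= a z <= 1) ->
  bounded_measurable setT (a \o eta).
Proof.
move=> ca a01; split; last first.
  by exists 1 => t _ /=; have /andP[a0 a1] := a01 (eta t); rewrite ger0_norm.
have -> : setT = N0 `|` ~` N0 by rewrite setUv.
apply/measurable_funU => //; first exact: measurableC.
split.
  apply: (@eq_measurable_fun _ _ _ _ _ (cst (a q))); last exact: measurable_cst.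
  by move=> t; rewrite inE /= => /eta_default ->.
apply: (bounded_cvg_Rintegral (M := 1) P (measurableC mN0) _ _ _).1.1.
- move=> n; apply: measurable_funTS.
  exact: (coupling (btest n ca a01)).1.
- by move=> n t _; exact: test_mass.
- by move=> t Nt; exact: kernel_test_cvg.
Qed.

Let beK (a : Y -> R) : continuous a -> (forall z, 0 <= a z <= 1) ->
  bounded_measurable setT (a \o eK).
Proof.
move=> ca a01; apply: (tracks_measurable (M := 1) mcode mbE mu_boundary mlcode
  cvg_cylinder lcode_gt0 _ (eK_tracks ca a01)).
exists 0%N => n y _ _.
by have /andP[a0 a1] := a01 (jK y); rewrite ger0_norm.
Qed.

Let meta : measurable_fun setT (eta : S -> borel q).
Proof.
by apply: measurable_of_continuous_tests => a ca a01; case: (beta ca a01).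
Qed.

Let meK : measurable_fun setT (eK : S -> borel q).
Proof.
by apply: measurable_of_continuous_tests => a ca a01; case: (beK ca a01).
Qed.

Let young (r z : R) : 0 < r -> `|z| <= r + r^-1 * z ^+ 2.
Proof.
move=> r0; rewrite -(ler_pM2l r0) mulrDr mulrA divff ?lt0r_neq0// mul1r.
by have := sqr_ge0 (r - `|z|); have := real_normK (num_real z);
  rewrite sqrrB => ->; have := sqr_ge0 z; have := mulr_ge0 (ltW r0) (normr_ge0 z);
  rewrite mulr2n; lra.
Qed.

(** By Young's inequality, the variance controls the error of replacing the kernel
    [kk n x y] by [h t x] under the coupling. *)
Lemma coupling_test_le x n (a : Y -> R) r : continuous a ->
  (forall z, 0 <= a z <= 1) -> E n x -> 0 < r ->
  `|\int[mu n]_(y in bE n) (kx x n y * a (jK y)) -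
    \int[P]_t (h t x * \int[W n]_(y in bE n) (a (jK y) * h t y))| <=
  r * u x0 + r^-1 * \int[P]_t variance x n t.
Proof.
move=> ca a01 nx r0; have Dx : D x by apply/inD; exists n.
have ba := btest n ca a01.
have bka : bounded_measurable (bE n) (fun y => kk n x y * a (jK y)).
  by apply: bounded_measurableM => //; exact: bkk.
have bkah t : bounded_measurable (bE n) (fun y => kk n x y * a (jK y) * h t y).
  exact: bounded_measurableM.
have bah t : bounded_measurable (bE n) (fun y => a (jK y) * h t y).
  exact: bounded_measurableM.
rewrite mu_integral; last by apply: bounded_measurableM => //; exact: bkx.
have -> : \int[W n]_(y in bE n) (kx x n y * a (jK y) * u y) =
    \int[W n]_(y in bE n) (kk n x y * a (jK y) * u y).
  by apply: eq_Rintegral => y _; rewrite kxE.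
rewrite -coupling_integral//.
have b1 := coupling bka.
have b2 : bounded_measurable setT
    (fun t => h t x * \int[W n]_(y in bE n) (a (jK y) * h t y)).
  apply: bounded_measurableM; first exact: h_bounded_measurable.
  exact: coupling.
rewrite -bmRintegralB//.
have bv := variance_bounded nx.
have bdv : bounded_measurable setT (fun t => r^-1 * variance x n t).
  exact: bounded_measurableZ.
have bd : bounded_measurable setT (fun _ : S => r).
  exact: bounded_measurable_cst.
have -> : r * u x0 + r^-1 * \int[P]_t variance x n t =
    \int[P]_t (r + r^-1 * variance x n t).
  by rewrite bmRintegralD// bmRintegralZl// Rintegral_cst// (congr1 fine PT).
apply: le_norm_bmRintegral => //; first exact: bounded_measurableB.
  exact: bounded_measurableD.
move=> t _; rewrite -bmRintegralZl//.
have bc : bounded_measurable (bE n) (fun _ : borel p => h t x).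
  exact: bounded_measurable_cst.
rewrite -bmRintegralB//; last exact: bounded_measurableM.
have bh := h_section n t.
have bsq : bounded_measurable (bE n) (fun y => (kk n x y - h t x) ^+ 2 * h t y).
  apply: bounded_measurableM => //; apply: bounded_measurable_sqr.
  by apply: bounded_measurableB => //; exact: bkk.
have -> : r + r^-1 * variance x n t =
    \int[W n]_(y in bE n) (r * h t y + r^-1 * ((kk n x y - h t x) ^+ 2 * h t y)).
  rewrite bmRintegralD//; [|exact: bounded_measurableZ..].
  by rewrite !bmRintegralZl// h_mass mulr1.
apply: le_norm_bmRintegral => //.
- by apply: bounded_measurableB => //; exact: bounded_measurableM.
- by apply: bounded_measurableD; exact: bounded_measurableZ.
move=> y /bED Dy; have /andP[a0 a1] := a01 (jK y).
have -> : kk n x y * a (jK y) * h t y - h t x * (a (jK y) * h t y) =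
    (kk n x y - h t x) * (a (jK y) * h t y) by ring.
rewrite normrM mulrA -mulrDl; apply: ler_pM => //; first exact: young.
by rewrite ger0_norm ?mulr_ge0 ?ler_piMl ?h_ge0.
Qed.

(** The limit position and the parameter of the limit kernel have the same
    integrals: both are limits of the position under the coupling, since the
    harmonic measure [h t y dW_n(y)] concentrates at the parameter of [h t]. *)
Lemma position_parameter_test x (a : Y -> R) : D x -> continuous a ->
  (forall z, 0 <= a z <= 1) ->
  \int[P]_t (h t x * a (eK t)) = \int[P]_t (h t x * a (eta t)).
Proof.
move=> Dx ca a01; have [M [N [M0 kM]]] := kx_bounded Dx.
have aj y : `|a (jK y)| <= 1.
  by have /andP[a0 a1] := a01 (jK y); rewrite ger0_norm.
have aeK t : `|(a \o eK) t| <= 1.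
  by have /andP[a0 a1] := a01 (eK t); rewrite ger0_norm.
have tr2 : tr (fun n y => kx x n y * a (jK y)) (fun t => h t x * a (eK t)).
  exact (tracksM (ex_intro _ N kM) aeK (kx_tracks Dx) (eK_tracks ca a01)).
have kM2 : exists N, forall n y, (N <= n)%N -> bE n y ->
    `|kx x n y * a (jK y)| <= M.
  exists N => n y Nn ny; rewrite normrM -[leRHS]mulr1; apply: ler_pM => //.
  exact: kM.
have bka n : bounded_measurable (bE n) (fun y => kx x n y * a (jK y)).
  by apply: bounded_measurableM; [exact: bkx|exact: btest].
have cA := tracks_integral mu_mass mcode mbE mu_boundary PT mlcode cvg_cylinder
  lcode_gt0 (fun n => (bka n).1) kM2 tr2.
have [Mh hM] := normalized_bound Dx.
have bh := h_bounded_measurable Dx.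
have cB : \int[P]_t (h t x * \int[W n]_(y in bE n) (a (jK y) * h t y))
    @[n --> \oo] --> \int[P]_t (h t x * a (eta t)).
  apply: (ae_bounded_cvg_Rintegral (M := Mh) mN0 PN0).
  - move=> n; apply: bounded_measurableM => //.
    exact: (coupling (btest n ca a01)).
  - move=> n t; rewrite normrM -[leRHS]mulr1; apply: ler_pM => //.
      exact: hM.
    exact: test_mass.
  - by apply: bounded_measurableM => //; exact: beta.
  - by move=> t Nt; apply: cvgM; [exact: cvg_cst|exact: kernel_test_cvg].
suff : \int[mu n]_(y in bE n) (kx x n y * a (jK y)) -
    \int[P]_t (h t x * \int[W n]_(y in bE n) (a (jK y) * h t y))
    @[n --> \oo] --> 0.
  move=> c0; apply/eqP; rewrite -subr_eq0; apply/eqP.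
  exact: (cvg_unique _ (cvgB cA cB) c0).
apply/cvgrPdist_le => e e0.
have u0 : 0 <= u x0 by apply/ltW/hu.2/inD; exists 0%N; exact: exhaustion_base hE 0%N.
pose r := e / (2 * (u x0 + 1)).
have r0 : 0 < r by rewrite divr_gt0// mulr_gt0// ltr_wpDl.
have ru : r * u x0 <= e / 2.
  rewrite /r invfM mulrA mulrAC ler_pdivrMr ?ltr_wpDl// mulrDr mulr1.
  by rewrite lerDl divr_ge0// ltW.
have re : 0 < r * (e / 2) by rewrite mulr_gt0// divr_gt0.
have /cvgrPdist_le/(_ _ re)[n1 _ n1P] := variance_cvg Dx.
have /inD[m mx] := Dx; exists (maxn n1 m) => // n /=; rewrite geq_max => /andP[n1n mn].
rewrite sub0r normrN.
apply: (le_trans (coupling_test_le ca a01 (exhaustion_sub hE mn mx) r0)).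
have := n1P n n1n; rewrite sub0r normrN => /(le_trans (ler_norm _)) vn.
rewrite [leRHS]splitr lerD// -(ler_pM2l r0) mulrA divff ?lt0r_neq0// mul1r//.
Qed.

Let law_at x (Dx : D x) (e : S -> borel q) (me : measurable_fun setT e) :=
  image_measure (density P (h_bounded_measurable Dx) (fun t => h_ge0 t Dx)) me.

Let law_at_integral x (Dx : D x) (e : S -> borel q) (me : measurable_fun setT e)
    (g : Y -> R) : bounded_measurable (setT : set (borel q)) g ->
  \int[law_at Dx me]_y g y = \int[P]_t (h t x * g (e t)).
Proof.
move=> bg; rewrite Rintegral_image_measure// Rintegral_density//; last first.
  have [mg [M gM]] := bg; split; first exact: measurableT_comp.
  by exists M => t _; exact: gM.
by apply: eq_Rintegral => t _; rewrite mulrC.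
Qed.

Lemma position_parameter_law x (g : Y -> R) : D x ->
  bounded_measurable (setT : set (borel q)) g ->
  \int[P]_t (h t x * g (eK t)) = \int[P]_t (h t x * g (eta t)).
Proof.
move=> Dx bg.
rewrite -(law_at_integral Dx meK)// -(law_at_integral Dx meta)//.
rewrite /Rintegral; congr fine; apply: eq_measure_integral => A mA _.
apply: borel_measure_unique => // a ca a01.
have ba : bounded_measurable (setT : set (borel q)) a.
  split; last by exists 1 => y _; have /andP[a0 a1] := a01 y; rewrite ger0_norm.
  apply: within_continuous_measurable => //.
  exact: continuous_subspaceT.
by rewrite !law_at_integral// position_parameter_test.
Qed.

(** Expanding the square, the mean of [(h t x - kappa (eK t) x) ^ 2] only depends
    on the laws of the position [eK] under [P] and under [h x dP]. Hence it
    equals the mean of [(h t x - kappa (eta t) x) ^ 2], which is zero. *)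
Lemma parameter_position : exists N, [/\ measurable N, P N = 0%E &
  forall t, ~ N t -> bK (eK t) /\ forall x, D x -> kappa (eK t) x = h t x].
Proof.
have Dx0 : D x0 by apply/inD; exists 0%N; exact: exhaustion_base hE 0%N.
have law0 (g : Y -> R) : bounded_measurable (setT : set (borel q)) g ->
    \int[P]_t g (eK t) = \int[P]_t g (eta t).
  move=> bg; have := position_parameter_law Dx0 bg.
  under eq_Rintegral do rewrite h_base mul1r.
  by under [X in _ = X -> _]eq_Rintegral do rewrite h_base mul1r.
have bcomp (e : S -> borel q) (me : measurable_fun setT e) (g : Y -> R) :
    bounded_measurable (setT : set (borel q)) g ->
    bounded_measurable setT (fun t => g (e t)).
  move=> [mg [M gM]]; split; first exact: measurableT_comp.
  by exists M => t _; exact: gM.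
have ae0 (f : S -> R) : bounded_measurable setT f ->
    (forall t, ~ N0 t -> f t = 0) -> \int[P]_t f t = 0.
  move=> bf f0; rewrite -(bmRintegral_setC0 measurableT mN0 PN0 bf).
  rewrite (@eq_Rintegral _ _ _ _ _ (cst 0)) ?Rintegral_cst ?mul0r//.
    exact: measurableD.
  by move=> t; rewrite inE => -[_ /f0].
have bC : bounded_measurable (setT : set (borel q)) (\1_(~` bK) : Y -> R).
  by apply: bounded_measurable_indic; exact: measurableC.
have [|||NA [mNA NA0 NAP]] := @Rintegral_eq0 _ _ _ P (fun t => \1_(~` bK) (eK t)).
- exact: (bcomp eK meK).
- by move=> t; rewrite indicE.
- rewrite law0//; apply: ae0; first exact: (bcomp eta meta).
  by move=> t /etaP[bt _]; rewrite indicE memNset//; exact.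
have kappa_bound x : D x -> exists M, forall y, bK y -> `|kappa y x| <= M.
  move=> Dx; have [M hM] := normalized_bound Dx; exists M => y /kappa_extreme[].
  move=> [v [hv v1] vE] _.
  have <- : v x = kappa y x := congr1 (fun f => f (SigSub (mem_set Dx))) vE.
  exact: hM.
have [|NB [mNB NB0 NBP]] := @ae_on_nets (fun x t =>
    h t x = ((fun y => kappa y x) \_ bK) (eK t)).
  move=> x Dx; set g := (fun y => kappa y x) \_ bK.
  have bg : bounded_measurable (setT : set (borel q)) g.
    apply: bounded_measurable_patch => //; split; first exact: mkappa.
    exact: kappa_bound.
  have bg2 : bounded_measurable (setT : set (borel q)) (fun y => g y ^+ 2).
    exact: bounded_measurable_sqr.
  have bh := h_bounded_measurable Dx.
  have expand (e : S -> borel q) (me : measurable_fun setT e) :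
      \int[P]_t (h t x - g (e t)) ^+ 2 = \int[P]_t h t x ^+ 2 +
      (- 2) * \int[P]_t (h t x * g (e t)) + \int[P]_t g (e t) ^+ 2.
    have be := bcomp e me _ bg.
    have b1 : bounded_measurable setT (fun t => h t x ^+ 2).
      exact: bounded_measurable_sqr.
    have b2 : bounded_measurable setT (fun t => h t x * g (e t)).
      exact: bounded_measurableM.
    have b3 : bounded_measurable setT (fun t => - 2 * (h t x * g (e t))).
      exact: bounded_measurableZ.
    have b4 : bounded_measurable setT (fun t => g (e t) ^+ 2).
      exact: bounded_measurable_sqr.
    rewrite -bmRintegralZl// -!bmRintegralD//; last exact: bounded_measurableD.
    by apply: eq_Rintegral => t _; ring.
  have [|||N [mN PN NP]] := @Rintegral_eq0 _ _ _ P
      (fun t => (h t x - g (eK t)) ^+ 2).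
  - apply: bounded_measurable_sqr; apply: bounded_measurableB => //.
    exact: (bcomp eK meK).
  - by move=> t; exact: sqr_ge0.
  - rewrite (expand eK meK) position_parameter_law// (law0 _ bg2).
    rewrite -(expand eta meta); apply: ae0.
      apply: bounded_measurable_sqr; apply: bounded_measurableB => //.
      exact: (bcomp eta meta).
    move=> t /etaP[bt kh]; rewrite /g patchE mem_set// kh// subrr.
    by rewrite expr2 mul0r.
  by exists N; split => // t /NP/eqP; rewrite sqrf_eq0 subr_eq0 => /eqP.
exists (NA `|` NB); split; [exact: measurableU|by rewrite measureU0|].
move=> t /not_orP[NAt NBt].
have bt : bK (eK t).
  apply: contrapT => nb; have := NAP t NAt.
  by rewrite indicE mem_set// => /eqP; rewrite oner_eq0.
split => // x Dx.
have [[v [hv v1] vE] _] := kappa_extreme bt.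
have kv y : D y -> v y = kappa (eK t) y.
  by move=> Dy; exact: (congr1 (fun f => f (SigSub (mem_set Dy))) vE).
rewrite -kv//; apply: (net_determines hE netP _ _ _ Dx) => [n|n|m l y ys].
- exact: (positive_harmonic_admissible hE).
- exact: h_adm.
have Dy : D y by apply/inD; exists m.+1; exact: net_sub ys.
by rewrite kv// (NBP t NBt m l y ys) patchE mem_set.
Qed.

End given_parameter.

Lemma ae_kernel_at_position : exists N, [/\ measurable N, P N = 0%E &
  forall t, ~ N t -> bK (eK t) /\ forall x, D x -> kappa (eK t) x = h t x].
Proof.
have [N [eta [mN PN eta_q etaP]]] := exists_parameter.
exact: parameter_position mN PN eta_q etaP.
Qed.

End parameter.

End limit_model.

(** * Boundary measures and their images in a compact space *)

(** The Heine-Cantor theorem. *)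
Lemma compact_uniform_modulus {R : realType} {Z : pseudoMetricType R}
    (f : Z -> R) : compact [set: Z] -> continuous f ->
  forall e : R, 0 < e -> exists2 r : R, 0 < r &
    forall z z', ball z r z' -> `|f z - f z'| <= e.
Proof.
move=> /compact_near_coveringP cZ cf e e0; have e2 : 0 < e / 2 by rewrite divr_gt0.
have := cZ R (0 : R)^'+ (fun r z => forall z', ball z r z' -> `|f z - f z'| <= e).
move=> /(_ _ _)[z _|r /= r0 rP].
  have /cvgrPdist_lt/(_ _ e2)/nbhs_ballP[s /= s0 sP] := cf z.
  have s2 : 0 < s / 2 by rewrite divr_gt0.
  exists (ball z (s / 2), [set r | r < s / 2]).
    split; first exact: nbhsx_ballx.
    exact: nbhs_right_lt.
  move=> -[z1 r] [/= zz1 rs] z2 z12.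
  have h1 : `|f z - f z1| < e / 2.
    by apply: sP; apply: (le_ball _ zz1); rewrite ler_pdivrMr// ler_pMr// ler1n.
  have h2 : `|f z - f z2| < e / 2.
    by apply: sP; apply: (ball_split zz1); exact: (le_ball (ltW rs)).
  have := ler_distD (f z) (f z1) (f z2).
  by rewrite [X in _ <= X + _]distrC; lra.
have r2 : 0 < r / 2 by rewrite divr_gt0.
exists (r / 2) => // z z' zz'; apply: (rP (r / 2)) => //=.
by rewrite sub0r normrN gtr0_norm// ltr_pdivrMr// ltr_pMr// ltr1n.
Qed.

Lemma ball_interior {R : realType} {Z : pseudoMetricType R} (c z : Z) (r s : R) :
  r < s -> ball c r z -> (ball c s)° z.
Proof.
move=> rs cz; apply/nbhs_ballP; exists (s - r) => /=; first by rewrite subr_gt0.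
move=> z' zz'; have := ball_triangle cz zz'.
by rewrite addrC subrK.
Qed.

Lemma compact_covers {R : realType} {Z : pseudoMetricType R} :
  compact [set: Z] -> exists cover : nat -> seq Z, forall l z,
    exists2 c, c \in cover l & (ball c l.+1%:R^-1)° z.
Proof.
move=> cZ; suff /choice[cover coverP] : forall l, exists s : seq Z, forall z,
    exists2 c, c \in s & (ball c l.+1%:R^-1)° z by exists cover.
move=> l; have l0 : 0 < l.+1%:R^-1 :> R by rewrite invr_gt0.
have [z _|s [_ sP]] := compact_finite_subcover
  (V := fun z => (ball z l.+1%:R^-1)°) cZ.
  by apply: open_nbhs_nbhs; split; [exact: open_interior|
    exact: nbhsx_ballx].
by exists s => z; exact: sP.
Qed.

Section restricted_density.
Context d (T : measurableType d) (R : realType).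
Variables (mu : {finite_measure set T -> \bar R}) (F : set T) (v : T -> R).
Hypotheses (mF : measurable F) (bv : bounded_measurable F v).
Hypothesis v_ge0 : forall y, F y -> 0 <= v y.

Let patch_ge0 y : 0 <= (v \_ F) y.
Proof. by rewrite patchE; case: ifPn => // /set_mem; exact: v_ge0. Qed.

Definition restricted_density : {finite_measure set T -> \bar R} :=
  density mu (bounded_measurable_patch mF bv) patch_ge0.

Lemma Rintegral_restricted_density A f : measurable A ->
  bounded_measurable A f -> F `<=` A ->
  \int[restricted_density]_(y in A) f y = \int[mu]_(y in F) (f y * v y).
Proof.
move=> mA bf FA; rewrite Rintegral_density// -[in RHS](setIidr FA).
rewrite /Rintegral integral_mkcondr; congr fine.
apply: eq_integral => y _; rewrite !patchE.
by case: ifPn => // _; rewrite (_ : point = 0) ?mulr0.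
Qed.

Lemma restricted_density_setC : restricted_density (~` F) = 0%E.
Proof.
transitivity (\int[mu]_(y in ~` F) ((v \_ F) y)%:E)%E => //.
rewrite (@eq_integral _ _ _ _ _ (cst 0%E)); first exact: integral0.
by move=> y; rewrite inE => Fy; rewrite patchE memNset.
Qed.

Lemma restricted_density_setT :
  restricted_density setT = (\int[mu]_(y in F) v y)%:E.
Proof.
rewrite -[LHS]fineK ?fin_num_measure//; congr EFin.
transitivity (\int[restricted_density]_y (1 : R)).
  by rewrite Rintegral_cst// mul1r.
rewrite Rintegral_restricted_density//; last exact: bounded_measurable_cst.
by apply: eq_Rintegral => y _; rewrite mul1r.
Qed.

End restricted_density.

(** The map [j] extends [i] to the whole space, where it has an image measure. *)
Section weighted_images.
Context {R : realType} {X : topologicalType} {p : X} {D : set X}.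
Context {Y : topologicalType} {q : Y} (i : D -> Y) (j : X -> Y).
Hypothesis ij : forall x : D, j (set_val x) = i x.
Hypothesis mj : measurable_fun setT (j : borel p -> borel q).
Variables (mu : {finite_measure set (borel p) -> \bar R}) (F : set (borel p)).
Variable v : X -> R.
Hypotheses (mF : measurable F) (FD : F `<=` D) (bv : bounded_measurable F v).
Hypothesis v_ge0 : forall y, F y -> 0 <= v y.

Lemma weighted_imageE : weighted_image (q := q) i mu F v =
  image_measure (restricted_density mu mF bv v_ge0) mj.
Proof.
apply/funext => B; rewrite /weighted_image.
transitivity (\int[mu]_(y in j @^-1` B) ((v \_ F) y)%:E)%E => //.
have -> : F `&` set_val @` (i @^-1` B) = j @^-1` B `&` F.
  apply/seteqP; split => [y [Fy [z Bz zy]]|y [By Fy]]; split => //=.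
    by rewrite -zy ij.
  exists (SigSub (mem_set (FD Fy))) => //=.
  by rewrite -ij.
rewrite integral_mkcondr; apply: eq_integral => y _.
by rewrite !patchE; case: ifPn.
Qed.

Lemma weighted_image_integral (f : Y -> R) :
  bounded_measurable (setT : set (borel q)) f ->
  (\int[weighted_image (q := q) i mu F v]_y (f y)%:E)%E =
  (\int[mu]_(y in F) (f (j y) * v y))%:E.
Proof.
move=> bf; rewrite weighted_imageE -Rintegral_EFin//; congr EFin.
rewrite Rintegral_image_measure// Rintegral_restricted_density//.
have [mf [M fM]] := bf; split; first exact: (measurableT_comp mf mj).
by exists M => y _; exact: fM.
Qed.

End weighted_images.

Lemma exhaustion_subsequence {R : realType} {X : metricType R} {p : X}
    (DD : set (set X)) (omega : set X -> X -> probability (borel p) R)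
    (D : set X) (E : nat -> set X) (x0 : X) (kk : nat -> X -> X -> R)
    (psi : nat -> nat) :
  kernel_exhaustion DD omega x0 D E kk -> (forall i, (psi i < psi i.+1)%N) ->
  kernel_exhaustion DD omega x0 D (E \o psi) (kk \o psi).
Proof.
move=> hE psi_inc; split => /= [|n|n|n|n|n|n].
- apply/seteqP; split => x.
    by move=> [n _ nx]; apply/(inD hE); exists (psi n).
  move=> /(inD hE)[n nx]; exists n => //.
  exact: (exhaustion_sub hE (increasing_ge_id psi_inc n)).
- exact: (exhaustion_member hE).
- exact: (exhaustion_regular hE).
- split; first exact: (exhaustion_step hE (psi n)).1.
  exact: (exhaustion_closure hE (psi_inc n)).
- exact: (exhaustion_base hE).
- exact: (exhaustion_kernel hE).
- exact: (exhaustion_continuous hE).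
Qed.

(** * The limit measure and the approximating kernels *)

Section limit_positions.
Context {R : realType} {X : metricType R} {p : X}.
Variables (DD : set (set X)) (omega : set X -> X -> probability (borel p) R).
Variables (D : set X) (E : nat -> set X) (x0 : X) (kk : nat -> X -> X -> R).
Hypothesis hE : kernel_exhaustion DD omega x0 D E kk.
Variable net : nat -> nat -> seq X.
Hypothesis net_sub : forall m l z, z \in net m l -> E m.+1 z.
Hypothesis netP : forall m l x, E m x -> exists2 z, z \in net m l &
  forall n v, (m.+1 < n)%N -> admissible DD omega E x0 n v ->
    `|v x - v z| <= l.+1%:R^-1.
Context {Y : pseudoMetricType R} {q : Y} {Z : pseudoMetricType R} {z0 : Z}.
Variables (j : X -> Z) (pr : Z -> Y) (kappa : Y -> X -> R) (bK : set (borel q)).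
Hypothesis mbhat : measurable (pr @^-1` bK : set (borel z0)).
Hypothesis mkappa : forall x, D x -> measurable_fun
  (pr @^-1` bK : set (borel z0)) (fun z => kappa (pr z) x : R).
Hypothesis kappa_harmonic : forall y, bK y -> exists v,
  [/\ positive_harmonic DD omega D v, v x0 = 1 & forall x, D x -> v x = kappa y x].
Variables (code : nat -> X -> nat -> bool) (S : choiceType).
Variables (lcode : S -> nat -> bool) (e : S -> Z) (h : S -> X -> R).
Hypothesis supp : forall t m N, exists n, (N <= n)%N /\
  exists2 y, boundary (E n) y & mkseq (code n y) m = mkseq (lcode t) m.
Hypothesis e_track : forall r, 0 < r -> exists m, forall t n y,
  mkseq (code n y) m = mkseq (lcode t) m -> ball (e t) r (j y).
Hypothesis h_track : forall m' r, 0 < r -> exists m N, forall t n y,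
  (N <= n)%N -> boundary (E n) y -> mkseq (code n y) m = mkseq (lcode t) m ->
  forall x, E m' x -> `|kk n x y - h t x| <= r.
Hypothesis h_pos : forall t, positive_harmonic DD omega D (h t).
Hypothesis h_base : forall t, h t x0 = 1.

Let near_limit t k r (z : Z) := [/\ bK (pr z), (ball (e t) (4 * r))° z &
  forall l i, `|kappa (pr z) (nth x0 (net k l) i) - h t (nth x0 (net k l) i)|
    <= 2 * r].

(* Indices beyond the length of a net give the point [x0]. *)
Let net_D k l i : D (nth x0 (net k l) i).
Proof.
apply/(inD hE); case: (ltnP i (size (net k l))) => il.
  by exists k.+1; apply: (net_sub (l := l)); exact: mem_nth.
by exists 0%N; rewrite nth_default//; exact: exhaustion_base hE 0%N.
Qed.

Let measurable_near_limit t k r :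
  measurable (near_limit t k r : set (borel z0)).
Proof.
have -> : near_limit t k r = (ball (e t) (4 * r))° `&` \bigcap_l \bigcap_i
    (pr @^-1` bK `&` (fun z => kappa (pr z) (nth x0 (net k l) i)) @^-1`
      [set s | `|s - h t (nth x0 (net k l) i)| <= 2 * r]).
  apply/seteqP; split => [z [bz ez kz]|z [ez kz]].
    by split => // l _ i _; split => //; exact: kz.
  split => [||l i]; last by case: (kz l I i I).
    by case: (kz 0%N I 0%N I).
  exact: ez.
apply: measurableI; first exact (open_borel (open_interior _)).
apply: bigcapT_measurable => l; apply: bigcapT_measurable => i.
apply: mkappa => //.
rewrite (_ : [set s | _] = `[h t (nth x0 (net k l) i) - 2 * r,
  h t (nth x0 (net k l) i) + 2 * r]%classic); first exact: measurable_itv.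
by apply/seteqP; split => s /=; rewrite in_itv/= ler_distl.
Qed.

(** The points that are limits of boundary points whose kernels converge to the
    harmonic function they represent contain a Borel set carrying the limit
    positions: at each precision, finitely many limit codes describe all limit
    points, and each of them is realized on arbitrarily late boundaries. *)
Lemma approximable_set : exists G : set (borel z0), [/\ measurable G,
  forall t, bK (pr (e t)) -> (forall x, D x -> kappa (pr (e t)) x = h t x) ->
    G (e t) &
  forall z, G z -> forall k N, exists n, (N <= n)%N /\
    exists2 y, boundary (E n) y & ball z k.+1%:R^-1 (j y) /\
      forall x, E k x -> `|kk n x y - kappa (pr z) x| <= k.+1%:R^-1].
Proof.
(* Positions differ by at most [4 r] and [r]; kernels by [r], by [2 r], and by
   two net errors below [r]. *)
pose r k : R := k.+1%:R^-1 / 5.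
have r0 k : 0 < r k by rewrite divr_gt0// invr_gt0.
have /choice[m1 m1P] := fun k => e_track (r0 k).
have /choice[m2 m2P] := fun k => h_track k.+1 (r0 k).
pose M k := maxn (m1 k) (m2 k).
have /choice[ts tsP] := fun k => finite_prefixes lcode (M k).
have real k t N : exists n, (N <= n)%N /\ exists2 y, boundary (E n) y &
    mkseq (code n y) (M k) = mkseq (lcode t) (M k) /\
    (ball (e t) (r k) (j y) /\
    forall x, E k.+1 x -> `|kk n x y - h t x| <= r k).
  have [N' N'P] := m2P k.
  have [n [Nn [y ny yt]]] := supp t (M k) (maxn N N').
  move: Nn; rewrite geq_max => /andP[Nn N'n].
  exists n; split => //; exists y => //; split => //; split.
    by apply: (m1P k t n); exact: mkseq_prefix (leq_maxl _ _) yt.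
  by apply: (N'P t n y) => //; exact: mkseq_prefix (leq_maxr _ _) yt.
exists (\bigcap_k \bigcup_(t in [set` ts k]) near_limit t k (r k)); split.
- apply: bigcapT_measurable => k; apply: fin_bigcup_measurable.
    exact: finite_seq.
  by move=> t _; exact: measurable_near_limit.
- move=> t bt kt k _; have [t' t'k t't] := tsP k t; exists t' => //=.
  have [n [_ [y ny [yt' [e' h']]]]] := real k t' 0%N.
  have dist x : E k.+1 x -> `|h t x - h t' x| <= 2 * r k.
    have [N N'P] := m2P k.
    have [n1 [Nn1 [y1 n1y y1t]]] := supp t (M k) N.
    have h1 := N'P t n1 y1 Nn1 n1y (mkseq_prefix (leq_maxr _ _) y1t).
    have h2 := N'P t' n1 y1 Nn1 n1y
      (mkseq_prefix (leq_maxr _ _) (etrans y1t (esym t't))).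
    move=> kx; have := ler_distD (kk n1 x y1) (h t x) (h t' x).
    by rewrite [X in _ <= X + _]distrC; move: (h1 x kx) (h2 x kx); lra.
  split => //.
    apply: (@ball_interior _ _ _ _ (r k + r k)); first by have := r0 k; lra.
    apply: (ball_triangle e'); apply: ball_sym.
    by apply: (m1P k t n); exact: mkseq_prefix (leq_maxl _ _) (etrans yt' t't).
  move=> l i; rewrite kt; last exact: net_D.
  case: (ltnP i (size (net k l))) => il.
    by apply: dist; apply: (net_sub (l := l)); exact: mem_nth.
  by apply: dist; rewrite nth_default//; exact: exhaustion_base hE k.+1.
- move=> z Gz k N; have [t tk [bz ez kz]] := Gz k I.
  have [n [Nn [y ny [_ [ey hy]]]]] := real k t N.
  exists n; split => //; exists y => //.
  have k5 : k.+1%:R^-1 = 5 * r k by rewrite /r mulrC divfK.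
  rewrite k5; split.
    have -> : 5 * r k = 4 * r k + r k by ring.
    by apply: ball_triangle ey; apply: ball_sym; exact: nbhs_singleton ez.
  move=> x kx; have [v [hv v1 vE]] := kappa_harmonic bz.
  have near_h l : `|v x - h t x| <= l.+1%:R^-1 + l.+1%:R^-1 + 2 * r k.
    apply: (net_close netP (ltnSn k.+1) (ltnSn k.+1)) => //.
    - exact: (positive_harmonic_admissible hE).
    - exact: (positive_harmonic_admissible hE).
    move=> x' x'l; have := kz l (index x' (net k l)); rewrite nth_index// vE//.
    by apply/(inD hE); exists k.+1; exact: net_sub x'l.
  have [l _ lP] := near_infty_natSinv_lt (PosNum (r0 k)).
  have /= := lP l (leqnn l); have := near_h l; move: (l.+1%:R^-1) => s hs sr.
  have hk : `|kk n x y - h t x| <= r k.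
    by apply: hy; exact: (exhaustion_sub hE (leqnSn k)) kx.
  rewrite -vE; last by apply/(inD hE); exists k.
  have := ler_distD (h t x) (kk n x y) (v x); rewrite [X in _ <= _ + X]distrC.
  by have := r0 k; lra.
Qed.

End limit_positions.

Lemma increasing_cvg (psi : nat -> nat) : (forall j, (psi j < psi j.+1)%N) ->
  psi n @[n --> \oo] --> \oo.
Proof.
move=> psi_inc A [N _ NA]; exists N => // n /= Nn; apply: NA => /=.
exact: leq_trans Nn (increasing_ge_id psi_inc n).
Qed.

Section limit_measure.
Context {R : realType} {X : metricType R} {p : X}.
Variables (DD : set (set X)) (omega : set X -> X -> probability (borel p) R).
Hypothesis hDD : harmonic_framework DD omega.
Variables (D : set X) (E : nat -> set X) (x0 : X) (kk : nat -> X -> X -> R).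
Hypothesis hE : kernel_exhaustion DD omega x0 D E kk.
Variable u : X -> R.
Hypothesis hu : positive_harmonic DD omega D u.
Context {Y : pseudoMetricType R} {q : Y} {Z : pseudoMetricType R} {z0 : Z}.
Variables (j : X -> Z) (pr : Z -> Y) (kappa : Y -> X -> R) (bK : set (borel q)).
Hypotheses (cZ : compact [set: Z]) (cpr : continuous pr).
Hypothesis mj : measurable_fun setT (j : borel p -> borel z0).
Hypothesis mbK : measurable bK.
Hypothesis mkappa : forall x, D x ->
  measurable_fun bK (fun eta => kappa eta x : R).
Hypothesis kappa_extreme : forall eta, bK eta ->
  extreme_harmonic DD omega (D := D) x0 (sigL D (kappa eta)).
Hypothesis kappa_onto : forall f, extreme_harmonic DD omega (D := D) x0 f ->
  exists eta, bK eta /\ sigL D (kappa eta) = f.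
Hypothesis kappa_concentrates : forall eta (a : Y -> R), bK eta ->
  continuous a -> (forall z, 0 <= a z <= 1) ->
  \int[omega (E n) x0]_(y in boundary (E n)) (a (pr (j y)) * kappa eta y)
    @[n --> \oo] --> a eta.

Let mbE n : measurable (boundary (E n) : set (borel p)).
Proof. exact: measurable_boundary. Qed.

Let bED n : boundary (E n) `<=` D.
Proof.
move=> y ny; apply/(inD hE); exists n.+1.
exact: (exhaustion_boundary hE (ltnSn n)).
Qed.

Let u_bounded n : bounded_measurable (boundary (E n) : set (borel p)) u.
Proof.
have := harmonic_boundary_bounded (exhaustion_step hE n).1 _ hu.1; apply.
by move=> x nx; apply/(inD hE); exists n.+1; exact: (exhaustion_step hE n).2.
Qed.

Let u_ge0 n y : boundary (E n) y -> 0 <= u y.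
Proof. by move=> /bED Dy; exact/ltW/hu.2. Qed.

Let mun n : {finite_measure set (borel p) -> \bar R} :=
  restricted_density (omega (E n) x0) (mbE n) (u_bounded n) (@u_ge0 n).

Lemma boundary_mass n : \int[omega (E n) x0]_(y in boundary (E n)) u y = u x0.
Proof.
apply: (harmonic_mass hE); apply: harmonic_onS hu.1 => z nz.
by apply/(inD hE); exists n.+1.
Qed.

Let kappa_harmonic eta : bK eta -> exists v, [/\ positive_harmonic DD omega D v,
  v x0 = 1 & forall x, D x -> v x = kappa eta x].
Proof.
move=> /kappa_extreme[[v [hv v1] vE] _]; exists v; split => // x Dx.
exact: (congr1 (fun f => f (SigSub (mem_set Dx))) vE).
Qed.

Let mpr : measurable_fun setT (pr : borel z0 -> borel q).
Proof.
apply: within_continuous_borel; first exact: measurableT.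
exact: continuous_subspaceT.
Qed.

Let mbhat : measurable (pr @^-1` bK : set (borel z0)).
Proof. by rewrite -[X in measurable X]setTI; exact: mpr. Qed.

Let mkappa_pr x : D x -> measurable_fun (pr @^-1` bK : set (borel z0))
  (fun z => kappa (pr z) x : R).
Proof.
move=> Dx; apply: (measurable_comp mbK _ (mkappa Dx)); last exact: measurable_funTS.
by move=> _ [z bz <-].
Qed.

Let continuous_bounded (f : Z -> R) : continuous f ->
  bounded_measurable (setT : set (borel z0)) f.
Proof.
move=> cf; apply: compact_bounded_measurable => //.
exact: continuous_subspaceT.
Qed.

(** The measure [mu] is the law of the limit position [e t] of the codes, which
    represents [h t] for almost every [t]. *)
Lemma limit_measure : exists (psi : nat -> nat)
    (mu : {finite_measure set (borel z0) -> \bar R}) (G : set (borel z0)),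
  [/\ forall i, (psi i < psi i.+1)%N,
      mu setT = (u x0)%:E /\ forall f : Z -> R, continuous f ->
        \int[omega (E (psi n)) x0]_(y in boundary (E (psi n))) (f (j y) * u y)
          @[n --> \oo] --> \int[mu]_z f z,
      mu (~` (pr @^-1` bK)) = 0%E,
      forall x, D x ->
        bounded_measurable (pr @^-1` bK : set (borel z0))
          (fun z => kappa (pr z) x) /\
        u x = \int[mu]_(z in pr @^-1` bK) kappa (pr z) x &
      [/\ measurable G, mu (~` G) = 0%E &
        forall z, G z -> forall k N, exists n, (N <= n)%N /\
          exists2 y, boundary (E (psi n)) y & ball z k.+1%:R^-1 (j y) /\
          forall x, E (psi k) x ->
            `|kk (psi n) x y - kappa (pr z) x| <= k.+1%:R^-1]].
Proof.
have u0 : 0 < u x0.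
  by apply: hu.2; apply/(inD hE); exists 0%N; exact: exhaustion_base hE 0%N.
have [net1 [net1_sub net1P]] := exists_nets hDD hE.
have [cover coverP] := compact_covers cZ.
pose code1 := position_code E x0 kk net1 (z0 := z0) j cover.
have mcode1 n i : measurable ([set y | code1 n y i] : set (borel p)).
  exact: (measurable_position_code hE).
have mass n : mun n setT = (u x0)%:E.
  by rewrite restricted_density_setT boundary_mass.
have [psi [psi_inc [d [S [P [lcode [PT mlcode cvg_cyl lcode_gt0]]]]]]] :=
  coding_limit u0 mass mcode1.
have hF := exhaustion_subsequence hE psi_inc.
set F := E \o psi in hF; set kF := kk \o psi in hF.
pose mu n := mun (psi n); pose code n := code1 (psi n).
have mcode n i : measurable ([set y | code n y i] : set (borel p)).
  exact: mcode1.
have mbF n : measurable (boundary (F n) : set (borel p)) by exact: mbE.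
have mu_boundary n : mu n (~` boundary (F n)) = 0%E.
  exact: restricted_density_setC.
have mu_integral n f : bounded_measurable (boundary (F n) : set (borel p)) f ->
    \int[mu n]_(y in boundary (F n)) f y =
    \int[omega (F n) x0]_(y in boundary (F n)) (f y * u y).
  by move=> bf; exact: Rintegral_restricted_density.
have supp t m N : exists n, (N <= n)%N /\ exists2 y, boundary (E (psi n)) y &
    mkseq (code1 (psi n) y) m = mkseq (lcode t) m.
  exact (coded_support mcode mbF mu_boundary cvg_cyl lcode_gt0 t m N).
have [e e_track] := exists_limit_position cZ coverP supp.
have [h [h_track1 hP]] := exists_limit_kernel hDD hE net1_sub net1P psi_inc supp.
have h_pos t : positive_harmonic DD omega D (h t) by case: (hP t).
have h_base t : h t x0 = 1 by case: (hP t).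
have [net [net_sub netP]] := exists_nets hDD hF.
have h_track m' r : 0 < r -> exists m N, forall t n y, (N <= n)%N ->
    boundary (F n) y -> mkseq (code n y) m = mkseq (lcode t) m ->
    forall x, F m' x -> `|kF n x y - h t x| <= r.
  exact: h_track1.
have z_tracks (f : Z -> R) : continuous f ->
    @tracks _ (borel p) R code (fun n => boundary (F n)) _ S lcode
      (fun _ y => f (j y)) (f \o e).
  move=> cf r r0; have [s s0 sP] := compact_uniform_modulus cZ cf r0.
  have [m mP] := e_track s s0; exists m, 0%N => n y t _ ny yt.
  by rewrite distrC; apply: sP; exact: (mP t n y).
have jb (f : Z -> R) : continuous f -> exists M, forall y, `|f (j y)| <= M.
  by move=> cf; have [_ [M fM]] := continuous_bounded cf; exists M => y; exact: fM.
have mfj (f : Z -> R) : continuous f ->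
    measurable_fun (setT : set (borel p)) (fun y => f (j y)).
  by move=> cf; apply: measurableT_comp mj; case: (continuous_bounded cf).
have be (f : Z -> R) : continuous f -> bounded_measurable setT (f \o e).
  move=> cf; have [M fM] := jb f cf.
  apply: (tracks_measurable (M := M) mcode mbF mu_boundary mlcode
    cvg_cyl lcode_gt0 _ (z_tracks f cf)).
  by exists 0%N.
have me : measurable_fun setT (e : S -> borel z0).
  by apply: measurable_of_continuous_tests => f cf _; case: (be f cf).
have kappa_concentrates' eta (a : Y -> R) : bK eta -> continuous a ->
    (forall z, 0 <= a z <= 1) ->
    \int[omega (F n) x0]_(y in boundary (F n)) (a (pr (j y)) * kappa eta y)
      @[n --> \oo] --> a eta.
  move=> beta ca a01.
  exact: cvg_comp (increasing_cvg psi_inc) (kappa_concentrates beta ca a01).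
have cpr' (a : Y -> R) : continuous a -> continuous (a \o pr).
  by move=> ca z; apply: continuous_comp; [exact: cpr|exact: ca].
have [N0 [mN0 PN0 NP]] := ae_kernel_at_position hDD hF net_sub netP hu
  (fun n => mass (psi n)) mu_boundary mu_integral mcode PT mlcode cvg_cyl lcode_gt0
  h_track h_pos h_base (jK := pr \o j) (eK := pr \o e)
  (fun a ca => mfj _ (cpr' a ca)) (fun a ca _ => z_tracks _ (cpr' a ca))
  mbK mkappa kappa_extreme kappa_onto kappa_concentrates'.
have [G [mG Ge GP]] := approximable_set hF net_sub netP mbhat mkappa_pr
  kappa_harmonic supp e_track h_track h_pos h_base.
have null_image (B : set (borel z0)) : measurable B ->
    (forall t, ~ N0 t -> ~ B (e t)) -> image_measure P me B = 0%E.
  move=> mB BN; apply: (@subset_measure0 _ _ _ P _ N0) => //.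
    by rewrite -[X in measurable X]setTI; exact: me.
  by move=> t Bt; apply: contrapT => Nt; exact: BN Bt.
exists psi, (image_measure P me : {finite_measure set (borel z0) -> \bar R}), G.
split => //.
- split; first by rewrite /= /image_measure /pushforward preimage_setT.
  move=> f cf; rewrite Rintegral_image_measure; last exact: continuous_bounded.
  have [M fM] := jb f cf.
  have eI n : \int[omega (F n) x0]_(y in boundary (F n)) (f (j y) * u y) =
      \int[mu n]_(y in boundary (F n)) f (j y).
    rewrite mu_integral//; split; first exact: measurable_funTS (mfj f cf).
    by exists M => y _; exact: fM.
  under eq_fun do rewrite eI.
  exact: (tracks_integral (fun n => mass (psi n)) mcode mbF mu_boundary PT mlcode
    cvg_cyl lcode_gt0 (fun n => measurable_funTS (mfj f cf))
    (ex_intro _ 0%N (fun n y _ _ => fM y)) (z_tracks f cf)).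
- apply: null_image; first exact: measurableC.
  by move=> t Nt nb; apply: nb; exact: (NP t Nt).1.
- move=> x Dx; set g := fun z => kappa (pr z) x.
  have [M hM] := normalized_bound hDD hE Dx.
  have bg : bounded_measurable (pr @^-1` bK : set (borel z0)) g.
    split; first exact: mkappa_pr.
    exists M => z /kappa_harmonic[v [hv v1 vE]]; rewrite /g -vE//; exact: hM.
  split => //; have bg' := bounded_measurable_patch mbhat bg.
  have bge : bounded_measurable setT (fun t => (g \_ (pr @^-1` bK)) (e t)).
    have [mg [Mg gM]] := bg'; split; first exact: (measurableT_comp mg me).
    by exists Mg => t _; exact: gM.
  rewrite -(barycenter hDD hF hu (fun n => mass (psi n)) mu_boundary mu_integral
    mcode PT mlcode cvg_cyl lcode_gt0 h_track Dx).
  transitivity (\int[P]_t (g \_ (pr @^-1` bK)) (e t)).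
    have bh := h_bounded_measurable hDD hF mu_boundary mcode mlcode cvg_cyl
      lcode_gt0 h_track Dx.
    rewrite -(bmRintegral_setC0 measurableT mN0 PN0 bh).
    rewrite -(bmRintegral_setC0 measurableT mN0 PN0 bge).
    apply: eq_Rintegral => t; rewrite inE => -[_ /NP[bt kt]].
    by rewrite patchE mem_set// /g kt.
  rewrite -(Rintegral_image_measure P me bg') /Rintegral.
  rewrite [in RHS]integral_mkcond; congr fine; apply: eq_integral => z _.
  by rewrite !patchE; case: ifPn.
- split => //; apply: null_image; first exact: measurableC.
  by move=> t Nt nG; apply: nG; have [bt kt] := NP t Nt; exact: Ge.
Qed.

End limit_measure.

(** * Compactifications and weak limits *)

Lemma compact_set_type (T : topologicalType) (A : set T) :
  compact A -> compact [set: A].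
Proof.
move=> cA F FF _; have FA : (set_val @ F) A.
  by apply: nearW => a; exact: set_valP.
have [c [Ac clc]] := cA _ _ FA.
exists (SigSub (mem_set Ac)); split => // B C FB.
rewrite nbhsE => -[_ [[W oW <-] Wc] WC].
have [_ [[b Bb <-] Wb]] : set_val @` B `&` W !=set0.
  apply: clc; last exact: open_nbhs_nbhs.
  rewrite /= /fmap/nbhs/=; by apply: (@filterS _ F) FB => b Bb; exists b.
by exists b; split => //; exact: WC.
Qed.

(** Evaluation at a point is continuous for uniform convergence on compact
    sets. *)
Lemma measurable_evaluation {R : realType} {X : topologicalType} {D : set X}
    (d : D) : measurable_fun setT
  ((fun f => f d) : borel ((fun=> 0) : {family compact, D -> R}) -> R).
Proof.
apply: within_continuous_measurable; first exact: measurableT.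
apply: continuous_subspaceT => f.
have ff : {family compact, nbhs (f : {family compact, D -> R}) --> f} by [].
have := pointwise_cvg_compact_family (nbhs_filter f) ff.
by move/pointwise_cvgP/(_ d).
Qed.

Lemma uniform_cvg {R : realType} {X : topologicalType} (N : set X)
    (f_ : nat -> X -> R) (f : X -> R) :
  (forall e : R, 0 < e -> \forall n \near \oo, forall x, N x ->
    `|f_ n x - f x| <= e) -> {uniform N, f_ @ \oo --> f}.
Proof.
move=> ff P /uniform_nbhs[V [entV VP]].
move: entV; rewrite -entourage_ballE => -[e /= e0 eV].
have e2 : 0 < e / 2 by rewrite divr_gt0.
apply: filterS (ff _ e2) => n nP; apply: VP => x Nx; apply: eV => /=.
rewrite /ball/= distrC; apply: le_lt_trans (nP x Nx) _.
by rewrite ltr_pdivrMr// ltr_pMr// ltr1n.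
Qed.

Section finite_measures.
Context {R : realType} {Z : pseudoMetricType R} {z0 : Z}.
Variable m : {measure set (borel z0) -> \bar R}.
Hypothesis mT : (m setT < +oo)%E.

(** An alias of [m] that carries a structure of finite measure. *)
Definition finite_copy of (m setT < +oo)%E : set (borel z0) -> \bar R := m.

Let m_fin : fin_num_fun (finite_copy mT).
Proof. exact: lty_fin_num_fun. Qed.

HB.instance Definition _ := Measure.on (finite_copy mT).
HB.instance Definition _ := Measure_isFinite.Build _ _ _ (finite_copy mT) m_fin.

Lemma continuous_integrals_unique (mu : {finite_measure set (borel z0) -> \bar R}) :
  (forall f : Z -> R, continuous f ->
    (\int[m]_z (f z)%:E = (\int[mu]_z f z)%:E)%E) ->
  forall A : set (borel z0), measurable A -> m A = mu A.
Proof.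
move=> mmu; apply: (@borel_measure_unique _ _ _ (finite_copy mT)) => f cf _.
by rewrite {1}/Rintegral mmu.
Qed.

End finite_measures.

Lemma measurable_extension {R : realType} {X : topologicalType} {p : X} (D : set X)
    {Y : topologicalType} {q : Y} (i : D -> Y) (y : Y) :
  open D -> continuous i ->
  measurable_fun setT (valL_ y i : borel p -> borel q).
Proof.
move=> oD ci; have mD := @open_borel X p D oD.
have -> : [set: borel p] = D `|` ~` D by rewrite setUv.
apply/measurable_funU => //; first exact: measurableC.
split; first by apply: within_continuous_borel => //; exact/subspace_valL_continuousP'.
apply: (@eq_measurable_fun _ _ _ _ _ (cst y : borel p -> borel q)).
  by move=> x; rewrite inE => Dx; rewrite /valL_ /= oinv_set_val insubF// memNset.
exact: measurable_cst.
Qed.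

Section refinement.
Context {T YG YK : topologicalType} {D : set T} (iG : D -> YG) (iK : D -> YK).

Lemma compact_common_refinement : compact [set: YG] -> compact [set: YK] ->
  compact [set: common_refinement iG iK].
Proof.
move=> cG cK; apply: compact_set_type.
exact (subclosed_compact (@closed_closure _ _) (compact_setX cG cK)
  (fun _ _ => conj I I)).
Qed.

Lemma continuous_refinement_incl : continuous iG -> continuous iK ->
  continuous (refinement_incl iG iK).
Proof.
move=> cG cK; apply: continuous_comp_initial => x.
exact: (cvg_pair (cG x) (cK x)).
Qed.

Lemma continuous_refinement_proj : continuous (@refinement_proj _ _ _ _ iG iK).
Proof.
move=> z; apply: continuous_comp; first exact: initial_continuous.
exact: cvg_snd.
Qed.

End refinement.

Lemma regular_exhaustion {R : realType} {X : metricType R} {p : X}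
    (DD : set (set X)) (omega : set X -> X -> probability (borel p) R) (x0 : X)
    (D : set X) (D0 : nat -> set X) (k0 : nat -> X -> X -> R) :
  (forall n, DD (D0 n) /\ regular (D0 n) (omega (D0 n))) -> D0 0%N x0 ->
  (forall n, compactly_contained (D0 n) (D0 n.+1)) -> D = \bigcup_n D0 n ->
  (forall n, relative_kernel omega (D0 n) x0 (k0 n) /\
    jointly_continuous (D0 n) (k0 n)) ->
  kernel_exhaustion DD omega x0 D D0 k0.
Proof.
move=> hD0 hx0 hcont hunion hk0; split=> // n.
- exact: (hD0 n).1.
- exact: (hD0 n).2.
- by elim: n => // n nx; apply: (hcont n).2; exact: subset_closure.
- exact: (hk0 n).1.
- exact: (hk0 n).2.
Qed.

Theorem theorem4p11 (R : realType) (X : metricType R)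
  (D : set X) (hD : domain D) (x0 : D)
  (DD : set (set X)) (omega : set X -> X -> probability (borel (set_val x0)) R)
  (hDD : harmonic_framework DD omega)
  (D0 : nat -> set X)
  (hD0 : forall n, DD (D0 n) /\ regular (D0 n) (omega (D0 n)))
  (hx0 : D0 0%N (set_val x0))
  (hcont : forall n, compactly_contained (D0 n) (D0 n.+1))
  (hunion : D = \bigcup_n D0 n)
  (k0 : nat -> X -> X -> R)
  (hk0 : forall n, relative_kernel omega (D0 n) (set_val x0) (k0 n) /\
                   jointly_continuous (D0 n) (k0 n))
  (DK : metricType R) (iK : D -> DK) (hiK : compactification iK)
  (bK : set DK) (hbK : bK `<=` ~` range iK)
  (mbK : measurable (bK : set (borel (iK x0))))
  (kappa : DK -> X -> R)
  (mkappa : measurable_fun (bK : set (borel (iK x0)))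
     (fun eta => sigL D (kappa eta)
        : borel ((fun=> 0) : {family compact, D -> R})))
  (bijkappa : set_bij bK (extreme_harmonic DD omega (D := D) (set_val x0))
     (fun eta => sigL D (kappa eta)))
  (s : nat -> nat) (hs : forall j, (s j < s j.+1)%N)
  (hweak : forall eta, bK eta ->
     weak_cvg
       (fun j => weighted_image (q := iK x0) iK
                   (omega (D0 (s j)) (set_val x0)) (boundary (D0 (s j)))
                   (kappa eta))
       (dirac (eta : borel (iK x0))))
  (DG : metricType R) (iG : D -> DG) (hiG : compactification iG)
  (u : X -> R) (hu : positive_harmonic DD omega D u) :
  let Dn := fun j => D0 (s j) in
  let k := fun j => k0 (s j) in
  let Dhat := common_refinement iG iK in
  let ihat := refinement_incl iG iK in
  let bhat := (@refinement_proj _ _ _ _ iG iK) @^-1` bK in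
  let khat := fun (x : X) (e : Dhat) => kappa (refinement_proj e) x in
  let lambda := fun n => weighted_image (q := ihat x0) ihat
       (omega (Dn n) (set_val x0)) (boundary (Dn n)) u in
  let approximating := fun (phi : nat -> nat) (e : Dhat) (psi : nat -> nat)
       (y : nat -> D) =>
     [/\ forall j, (psi j < psi j.+1)%N,
         forall j, boundary (Dn (phi (psi j))) (set_val (y j)),
         ihat (y j) @[j --> \oo] --> e
       & locally_uniform_cvg D
           (fun j x => k (phi (psi j)) x (set_val (y j)))
           (fun x => khat x e)] in
  (exists (phi : nat -> nat)
     (mu : {measure set (borel (ihat x0)) -> \bar R}),
     (forall j, (phi j < phi j.+1)%N) /\ weak_cvg (lambda \o phi) mu) /\
  (forall (phi : nat -> nat)
     (mu : {measure set (borel (ihat x0)) -> \bar R}),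
     (forall j, (phi j < phi j.+1)%N) -> weak_cvg (lambda \o phi) mu ->
     [/\ mu [set: Dhat] = (u (set_val x0))%:E,
         mu (~` bhat) = 0%E,
         forall x, D x ->
           (u x)%:E = (\int[mu]_(e in bhat) (khat x e)%:E)%E,
         {ae mu, forall e : Dhat, bhat e ->
           exists psi y, approximating phi e psi y}
       & (forall n y, boundary (Dn n) y ->
            minimal_harmonic DD omega (Dn n) (fun x => k n x y)) ->
         forall (e : Dhat) psi y, bhat e -> approximating phi e psi y ->
         forall j, minimal_harmonic DD omega (Dn (phi (psi j)))
           (fun x => k (phi (psi j)) x (set_val (y j)))]).
Proof.
move=> Dn k Dhat ihat bhat khat lambda approximating.
have oD : open D by case: hD.
have hD0E := regular_exhaustion hD0 hx0 hcont hunion hk0.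
have hE := exhaustion_subsequence hD0E hs.
have cZ : compact [set: Dhat].
  apply: compact_common_refinement; first exact: compactification_compact hiG.
  exact: compactification_compact hiK.
have cihat : continuous ihat.
  apply: continuous_refinement_incl; first exact: compactification_continuous hiG.
  exact: compactification_continuous hiK.
pose pr : Dhat -> DK := @refinement_proj _ _ _ _ iG iK.
have cpr : continuous pr by exact: continuous_refinement_proj.
(* The boundaries of the inner domains lie in [D], where [j] is the inclusion. *)
pose j := valL_ (ihat x0) ihat.
have jE x : j (set_val x) = ihat x.
  exact: (congr1 (fun f => f x) (valLK (ihat x0) ihat)).
have mj : measurable_fun setT
    (j : borel (set_val x0) -> borel (ihat x0)) by exact: measurable_extension.
have mpr : measurable_fun setT (pr : borel (ihat x0) -> borel (iK x0)).
  apply: within_continuous_borel; first exact: measurableT.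
  exact: continuous_subspaceT.
have mbhat : measurable (bhat : set (borel (ihat x0))).
  by rewrite -[X in measurable X]setTI; exact: mpr.
have continuous_bounded (Z : pseudoMetricType R) (z0 : Z) (f : Z -> R) :
    compact [set: Z] -> continuous f ->
    bounded_measurable (setT : set (borel z0)) f.
  move=> cZ' cf; apply: compact_bounded_measurable => //.
  exact: continuous_subspaceT.
have bD n : boundary (Dn n) `<=` D.
  move=> y ny; apply/(inD hE); exists n.+1.
  exact: (exhaustion_boundary hE (ltnSn n)).
have mb n : measurable (boundary (Dn n) : set (borel (set_val x0))).
  exact: measurable_boundary.
have harmonic_bounded n v : positive_harmonic DD omega D v ->
    bounded_measurable (boundary (Dn n) : set (borel (set_val x0))) v.
  move=> hv; apply: (harmonic_boundary_bounded (exhaustion_step hE n).1 _ hv.1).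
  by move=> x nx; apply/(inD hE); exists n.+1; exact: (exhaustion_step hE n).2.
have [kappa_in kappa_inj kappa_sur] := bijkappa.
have kappa_onto f : extreme_harmonic DD omega (D := D) (set_val x0) f ->
    exists eta, bK eta /\ sigL D (kappa eta) = f.
  by move=> /kappa_sur[eta beta etaE]; exists eta.
have mkappa_at x : D x -> measurable_fun (bK : set (borel (iK x0)))
    (fun eta => kappa eta x : R).
  move=> Dx; exact: (measurable_comp measurableT (@subsetT _ _)
    (measurable_evaluation (SigSub (mem_set Dx))) mkappa).
have kappa_concentrates eta (a : DK -> R) : bK eta -> continuous a ->
    (forall z, 0 <= a z <= 1) ->
    \int[omega (Dn n) (set_val x0)]_(y in boundary (Dn n))
      (a (pr (j y)) * kappa eta y) @[n --> \oo] --> a eta.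
  move=> beta ca a01; have [[v [hv v1] vE] _] := kappa_in eta beta.
  have vk x : D x -> v x = kappa eta x.
    by move=> Dx; exact: (congr1 (fun f => f (SigSub (mem_set Dx))) vE).
  have bk n : bounded_measurable
      (boundary (Dn n) : set (borel (set_val x0))) (kappa eta).
    apply: eq_bounded_measurable (harmonic_bounded n v hv).
    by move=> y /bD; exact: vk.
  have k_ge0 n y : boundary (Dn n) y -> 0 <= kappa eta y.
    by move=> /bD Dy; rewrite -vk//; exact/ltW/hv.2.
  have ba : bounded_measurable (setT : set (borel (iK x0))) a.
    exact: continuous_bounded (compactification_compact hiK) ca.
  have ij (x : D) : pr (j (set_val x)) = iK x by rewrite jE.
  have wE n : (\int[weighted_image (q := iK x0) iK
      (omega (Dn n) (set_val x0)) (boundary (Dn n)) (kappa eta)]_y (a y)%:E)%E =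
    (\int[omega (Dn n) (set_val x0)]_(y in boundary (Dn n))
      (a (pr (j y)) * kappa eta y))%:E.
    exact (weighted_image_integral (j := pr \o j) ij (measurableT_comp mpr mj)
      (omega (Dn n) (set_val x0)) (mb n) (@bD n) (bk n) (@k_ge0 n) ba).
  have := hweak eta beta a ca.
  rewrite (_ : (fun n => _) = (fun n => (\int[omega (Dn n) (set_val x0)]_(y in
    boundary (Dn n)) (a (pr (j y)) * kappa eta y))%:E)); last exact/funext.
  rewrite integral_dirac//; last by apply/measurable_EFinP; case: ba.
  by rewrite diracT mul1e => /fine_cvg.
have lambdaE n (f : Dhat -> R) : continuous f ->
    (\int[lambda n]_e (f e)%:E)%E =
    (\int[omega (Dn n) (set_val x0)]_(y in boundary (Dn n)) (f (j y) * u y))%:E.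
  move=> cf; apply: (weighted_image_integral jE mj
      (omega (Dn n) (set_val x0)) (mb n) (@bD n) (harmonic_bounded n u hu)).
    by move=> y /bD Dy; exact/ltW/hu.2.
  exact: continuous_bounded.
(* Along any subsequence of the given domains, a further subsequence has the
   limit measure of [limit_measure]. *)
have core phi (phi_inc : forall i, (phi i < phi i.+1)%N) :=
  limit_measure hDD (exhaustion_subsequence hE phi_inc) hu cZ cpr mj mbK mkappa_at
    kappa_in kappa_onto (fun eta a beta ca a01 => cvg_comp _ _
      (increasing_cvg phi_inc) (kappa_concentrates eta a beta ca a01)).
split.
  have [phi [mu [G [phi_inc [_ mu_lim] _ _ _]]]] := core id (fun i => ltnSn i).
  exists phi, mu; split => // f cf.
  rewrite -Rintegral_EFin//; last exact: continuous_bounded.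
  apply: cvg_EFin; first by apply: nearW => n /=; rewrite lambdaE.
  apply: cvg_trans (mu_lim f cf); apply: near_eq_cvg; apply: nearW => n /=.
  by rewrite lambdaE.
move=> phi mu phi_inc mu_lim.
have [psi [mu' [G [psi_inc [mu'T mu'_lim] mu'0 mu'K [mG G0 GP]]]]] := core phi phi_inc.
have muT : mu setT = (u (set_val x0))%:E.
  have c_cst : continuous (cst 1 : Dhat -> R) by exact: cst_continuous.
  have <- : (\int[mu]_e (cst (1 : R) e)%:E)%E = mu setT.
    by rewrite -[RHS]mul1e -(integral_cst mu measurableT 1%E).
  apply: (cvg_unique (@ereal_hausdorff R) (mu_lim _ c_cst)).
  apply: cvg_near_cst; apply: nearW => n /=.
  rewrite lambdaE//.
  under eq_Rintegral do rewrite mul1r.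
  by rewrite (boundary_mass hE hu).
(* Both measures are weak limits along the further subsequence. *)
have muE (A : set (borel (ihat x0))) : measurable A -> mu A = mu' A.
  move=> mA; apply: continuous_integrals_unique => //; first by rewrite muT ltry.
  move=> f cf; have c1 : (\int[omega (Dn (phi (psi n))) (set_val x0)]_(y in
      boundary (Dn (phi (psi n)))) (f (j y) * u y))%:E @[n --> \oo] -->
      (\int[mu']_e f e)%:E.
    by apply: cvg_EFin; [exact: nearW|exact: mu'_lim].
  apply: (cvg_unique (@ereal_hausdorff R) _ c1).
  apply: cvg_trans (cvg_comp _ _ (increasing_cvg psi_inc) (mu_lim f cf)).
  by apply: near_eq_cvg; apply: nearW => n /=; rewrite lambdaE.
split => //.
- by rewrite muE//; exact: measurableC.
- move=> x Dx; have [bk ->] := mu'K x Dx.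
  rewrite Rintegral_EFin//; apply: eq_measure_integral => A mA _.
  by rewrite muE.
- exists (~` G); split; [exact: measurableC|by rewrite muE//; exact: measurableC|].
  move=> e /= nP Ge; apply: nP => be.
  have hF := exhaustion_subsequence (exhaustion_subsequence hE phi_inc) psi_inc.
  have [i N|sigma [sigma_inc sigmaP]] := @extract_subsequence (fun i n =>
    exists2 y, boundary (Dn (phi (psi n))) y & ball e i.+1%:R^-1 (j y) /\
    forall x, Dn (phi (psi i)) x ->
      `|k (phi (psi n)) x y - kappa (pr e) x| <= i.+1%:R^-1).
    by have [n [Nn nP]] := GP e Ge i N.+1; exists n.
  have /choice[y yP] : forall i, exists y : D,
      boundary (Dn (phi (psi (sigma i)))) (set_val y) /\
      (ball e i.+1%:R^-1 (ihat y) /\ forall x, Dn (phi (psi i)) x ->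
      `|k (phi (psi (sigma i))) x (set_val y) - kappa (pr e) x| <= i.+1%:R^-1).
    move=> i; have [y yb yP] := sigmaP i.
    by exists (SigSub (mem_set (bD _ y yb))); split => //; rewrite -jE.
  exists (psi \o sigma), y; split.
  + by move=> i; exact: (homo_ltn ltn_trans psi_inc).
  + by move=> i; exact: (yP i).1.
  + apply/cvg_ballP => r r0; near=> i; apply: (le_ball _ (yP i).2.1).
    near: i; have := near_infty_natSinv_lt (PosNum r0).
    by apply: filterS => i /ltW.
  + move=> x /(inD hF)[m mx]; exists (Dn (phi (psi m))).
      by apply: open_nbhs_nbhs; split => //; exact: (exhaustion_open hDD hF m).
    apply: uniform_cvg => r r0; near=> i => x' mx'.
    apply: (le_trans ((yP i).2.2 x' _)).
      apply: (exhaustion_sub hF _ mx'); near: i; exact: nbhs_infty_ge.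
    near: i; have := near_infty_natSinv_lt (PosNum r0).
    by apply: filterS => i /ltW.
- move=> k_min e sigma y _ [_ ybd _ _] i; exact: k_min.
Unshelve. all: by end_near. Qed.
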